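(* $$\sum_{k=0}^\infty\frac{\binom{2k}{k}}{(2k+1)16^k}\left(\left(\sum_{j=0}^k\frac{33}{(2j+1)^5}\right)+\frac{4}{(2k+1)^5}\right)=\frac{35}{288}\pi^3\zeta_3+\frac{1003}{96}\pi\zeta_5.$$
   Context: $\zeta_n:=\sum_{i=1}^\infty \frac{1}{i^n}$ for integers $n\ge 2$. *)

(* Defs.v *)
From Stdlib Require Import Reals.
From Coquelicot Require Import Coquelicot.
Open Scope R_scope.

(* The summation index is shifted: the term of rank [i] is 1/(i+1)^n.
   [Series] is a total operator; the series converges exactly for [n >= 2]. *)
Definition zeta (n : nat) : R := Series (fun i : nat => / INR (S i) ^ n).

(* Main.v *)
(* Put t = 2 sin (x / 2), L = ln t and h = PI / 3 - x for 0 < x < PI / 3.  By the arcsine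
   series and 1 / n ^ 5 = (integral of s ^ (n - 1) (ln s) ^ 4 / 24 over [0, 1]), the sum is
   an integral over x in which the tail of the inner sum produces the form
   d ln (1 - t ^ 2) = d ln (2 cos x - 1).

   Let z = exp (i x) and w = 1 - z, so that |w| = t and 1 - w + w ^ 2 = 1 - z (1 - z) =
   z (2 cos x - 1).  At x = PI / 3 the numbers exp (i PI / 3) w and z w are both 1, with
   logarithms L - i h / 2 and L - 3 i h / 2.  Integrating the fifth powers of these
   logarithms against d ln (1 - w + w ^ 2) gives polylogarithms of order 6 at sixth roots
   of unity, and the two imaginary parts together express the integral of
   L ^ 4 h d ln (2 cos x - 1) through integrals of L ^ a h ^ b dx with a + b = 5.

   Those are found in the same way.  Expanding in powers of w gives L ^ 5, and L ^ 3 h ^ 2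
   through the sum Z of H_(n-1) sin (n PI / 3) / n ^ 5; expanding on the unit circle |z| = 1
   gives L h ^ 4, and Z once more, since the sum of H_(n-1) z ^ n / n is (ln (1 - z)) ^ 2 / 2.
   The Clausen values at PI / 3 and 2 PI / 3 are proportional with ratio 33 / 32, which is
   why the weights 33 and 4 leave only zeta values. *)
Require Import Defs.
From Stdlib Require Import Reals Arith Lra Lia Psatz.
From Coquelicot Require Import Coquelicot.
Open Scope R_scope.

(** The weights come from one linear condition. With A and B in place of 33 and 4, the elimination
    leaves (3 A / 4 + 9 B / 16) [s6] - (27 A / 32) [t6], where [s6] and [t6] are the sums of sin (n
    PI / 3) / n ^ 6 and sin (2 n PI / 3) / n ^ 6. Neither is evaluated; only s6 = 33 / 32 t6 is
    known, and it cancels the combination when 4 A = 33 B.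

    Two obstacles shape the analysis. The integrands are singular at the end points: powers of L at
    x = 0, and d ln (2 cos x - 1) at x = PI / 3. Integrals are therefore differences of limits of
    explicit primitives, obtained by repeated integration by parts of polylogarithms. The logarithms
    are normalised to vanish at PI / 3, so that there only the term of top order survives, while at
    0 the modulus t beats every power of L. On |z| = 1, on the other hand, the series of order 1
    does not converge absolutely and cannot be reached by termwise differentiation; its explicit
    boundary value takes its place and is approached from inside the disk. *)

Lemma is_derive_eq (f : R -> R) (x l l' : R) : is_derive f x l -> l = l' -> is_derive f x l'.
Proof. intros H <-; exact H. Qed.

Lemma is_derive_continuous (f : R -> R) (x l : R) : is_derive f x l -> continuous f x.
Proof. intros H; apply (ex_derive_continuous f); exists l; exact H. Qed.

(** * Dominated series of real functions: limits and derivatives *)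

Lemma ex_series_Rmult_l (c : R) (a : nat -> R) : ex_series a -> ex_series (fun n => c * a n).
Proof. apply (ex_series_scal (V := R_NormedModule) c a). Qed.

Lemma ex_series_Rmult_r (c : R) (a : nat -> R) : ex_series a -> ex_series (fun n => a n * c).
Proof.
intros H; apply ex_series_ext with (fun n => c * a n); [intros n; apply Rmult_comm|].
apply ex_series_Rmult_l, H.
Qed.

Lemma ex_series_le_R (a b : nat -> R) :
  (forall n, Rabs (a n) <= b n) -> ex_series b -> ex_series a.
Proof.
intros H Hb; apply (ex_series_le (K := R_AbsRing) (V := R_CompleteNormedModule) a b); auto.
Qed.

Lemma Series_abs_le (a b : nat -> R) :
  (forall n, Rabs (a n) <= b n) -> ex_series b -> Rabs (Series a) <= Series b.
Proof.
intros H Hb.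
assert (Ha : ex_series (fun n => Rabs (a n))).
{ apply (ex_series_le_R _ b); auto; intros n; rewrite Rabs_Rabsolu; auto. }
eapply Rle_trans; [apply Series_Rabs, Ha|].
apply Series_le; auto; intros n; split; auto; apply Rabs_pos.
Qed.

Lemma Series_tail_small (M : nat -> R) (eps : R) :
  ex_series M -> 0 < eps ->
  exists N, Rabs (Series (fun k => M (S N + k)%nat)) < eps.
Proof.
intros HM He.
pose proof (Series_correct _ HM) as H.
assert (H1 : is_lim_seq (sum_n M) (Series M)) by exact H.
apply is_lim_seq_spec in H1.
destruct (H1 (mkposreal _ He)) as [N HN]; exists N.
specialize (HN N (le_n _)); simpl in HN.
rewrite sum_n_Reals in HN.
rewrite (Series_incr_n M (S N)) in HN; [|lia|assumption].
replace (Init.Nat.pred (S N)) with N in HN by reflexivity.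
rewrite Rabs_minus_sym in HN.
replace (sum_f_R0 M N + Series (fun k => M (S N + k)%nat) - sum_f_R0 M N)
  with (Series (fun k => M (S N + k)%nat)) in HN by ring.
exact HN.
Qed.

Lemma filterlim_sum_f_R0 {T : Type} (F : (T -> Prop) -> Prop) {FF : Filter F}
  (f : T -> nat -> R) (l : nat -> R) (N : nat) :
  (forall n, filterlim (fun x => f x n) F (locally (l n))) ->
  filterlim (fun x => sum_f_R0 (f x) N) F (locally (sum_f_R0 l N)).
Proof.
intros H; induction N as [|N IH]; simpl; [apply H|].
eapply filterlim_comp_2; [apply IH|apply H|].
apply (filterlim_plus (V := R_NormedModule)).
Qed.

(** Dominated convergence for series: the bound passes to the limits because the filter is proper,
    and beyond a suitable rank both tails are small. The filter is arbitrary, so the same lemma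
    serves one-sided limits at end points, difference quotients and sequences of radii. *)
Lemma Series_tannery {T : Type} (F : (T -> Prop) -> Prop) {FF : ProperFilter F}
  (f : T -> nat -> R) (M l : nat -> R) :
  ex_series M ->
  F (fun x => forall n, Rabs (f x n) <= M n) ->
  (forall n, filterlim (fun x => f x n) F (locally (l n))) ->
  filterlim (fun x => Series (f x)) F (locally (Series l)).
Proof.
intros HM Hb Hl.
assert (Hlb : forall n, Rabs (l n) <= M n).
{ intros n; apply Rnot_lt_le; intros Hn.
  assert (He : 0 < Rabs (l n) - M n) by lra.
  pose proof (proj1 (filterlim_locally _ _) (Hl n) (mkposreal _ He)) as H1.
  destruct (filter_ex _ (filter_and _ _ Hb H1)) as [x [Hx1 Hx2]].
  specialize (Hx1 n); unfold ball in Hx2; simpl in Hx2.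
  unfold AbsRing_ball, abs, minus, plus, opp in Hx2; simpl in Hx2.
  pose proof (Rabs_triang_inv (l n) (f x n)) as H2.
  rewrite Rabs_minus_sym in H2; unfold Rminus in H2; lra. }
apply filterlim_locally; intros eps.
assert (He : 0 < eps / 4) by (destruct eps; simpl; lra).
destruct (Series_tail_small M _ HM He) as [N HN].
assert (HMt : ex_series (fun k => M (S N + k)%nat)) by (apply (ex_series_incr_n M (S N)), HM).
pose proof (filterlim_sum_f_R0 F f l N Hl) as Hs.
pose proof (proj1 (filterlim_locally _ _) Hs (mkposreal _ He)) as H1.
generalize (filter_and _ _ Hb H1); apply filter_imp; intros x [Hx1 Hx2].
unfold ball in *; simpl in *; unfold AbsRing_ball, abs, minus, plus, opp in *; simpl in *.
assert (Hfx : ex_series (f x)) by (apply (ex_series_le_R _ M); auto).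
assert (Hlx : ex_series l) by (apply (ex_series_le_R _ M); auto).
rewrite (Series_incr_n (f x) (S N)), (Series_incr_n l (S N)); [|lia|assumption|lia|assumption].
simpl Init.Nat.pred.
pose proof (Series_abs_le (fun k => f x (S N + k)%nat) _ (fun k => Hx1 _) HMt) as B1.
pose proof (Series_abs_le (fun k => l (S N + k)%nat) _ (fun k => Hlb _) HMt) as B2.
pose proof (Rle_abs (Series (fun k => M (S N + k)%nat))) as B3.
match goal with |- Rabs (?a + ?b + - (?c + ?d)) < _ =>
  replace (a + b + - (c + d)) with ((a + - c) + (b + - d)) by ring;
  pose proof (Rabs_triang (a + - c) (b + - d));
  pose proof (Rabs_triang b (- d)); rewrite (Rabs_Ropp d) in * end.
simpl in *.
destruct eps as [e e0]; simpl in *; lra.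
Qed.

(** By the mean value theorem a bound on the derivatives of the terms also bounds their difference
    quotients, to which [Series_tannery] applies in the punctured neighbourhood of 0. *)
Lemma is_derive_Series (f f' : R -> nat -> R) (M : nat -> R) (a b x : R) :
  a < x < b -> ex_series M ->
  (forall n y, a < y < b -> is_derive (fun y => f y n) y (f' y n)) ->
  (forall n y, a < y < b -> Rabs (f' y n) <= M n) ->
  (forall y, a < y < b -> ex_series (f y)) ->
  is_derive (fun y => Series (f y)) x (Series (f' x)).
Proof.
intros Hx HM Hd Hb He.
set (G := fun h : R => fun n => (f (x + h) n - f x n) / h).
set (d := Rmin (x - a) (b - x)).
assert (Hd0 : 0 < d) by (unfold d; apply Rmin_pos; lra).
assert (Hin : forall h, Rabs h < d -> a < x + h < b).
{ intros h Hh; unfold d in Hh.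
  pose proof (Rmin_l (x - a) (b - x)); pose proof (Rmin_r (x - a) (b - x)).
  apply Rabs_def2 in Hh; lra. }
assert (Hlim : filterlim (fun h => Series (G h)) (locally' 0) (locally (Series (f' x)))).
{ apply (Series_tannery (locally' 0) (FF := Rbar_locally'_filter (Finite 0)) G M (f' x)).
  - exact HM.
  - unfold locally', within.
    exists (mkposreal _ Hd0); intros h Hh Hh0 n.
    unfold ball in Hh; simpl in Hh; unfold AbsRing_ball, abs, minus, plus, opp in Hh; simpl in Hh.
    rewrite Ropp_0, Rplus_0_r in Hh.
    assert (HI : forall y, Rmin x (x + h) <= y <= Rmax x (x + h) -> a < y < b).
    { intros y Hy; specialize (Hin h Hh).
      unfold Rmin, Rmax in Hy; destruct (Rle_dec x (x + h)); lra. }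
    destruct (MVT_gen (fun y => f y n) x (x + h) (fun y => f' y n)) as [c [Hc Hc2]].
    + intros y Hy; apply Hd, HI; lra.
    + intros y Hy; apply continuity_pt_filterlim.
      apply (ex_derive_continuous (fun y => f y n)).
      exists (f' y n); apply Hd, HI, Hy.
    + unfold G; rewrite Hc2.
      replace (f' c n * (x + h - x) / h) with (f' c n) by (field; exact Hh0).
      apply Hb, HI, Hc.
  - intros n.
    specialize (Hd n x Hx); apply is_derive_Reals in Hd.
    apply filterlim_locally; intros eps.
    destruct (Hd eps (cond_pos eps)) as [delta Hdelta].
    exists delta; intros h Hh Hh0.
    unfold ball in *; simpl in *; unfold AbsRing_ball, abs, minus, plus, opp in *; simpl in *.
    rewrite Ropp_0, Rplus_0_r in Hh.
    apply Hdelta; auto. }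
apply is_derive_Reals; intros eps Heps.
destruct (proj1 (filterlim_locally _ _) Hlim (mkposreal _ Heps)) as [delta Hdelta].
assert (Hm : 0 < Rmin delta d) by (apply Rmin_pos; auto; apply cond_pos).
exists (mkposreal _ Hm); intros h Hh0 Hh; simpl in Hh.
assert (Hh1 : Rabs h < delta) by (eapply Rlt_le_trans; [exact Hh|apply Rmin_l]).
assert (Hh2 : Rabs h < d) by (eapply Rlt_le_trans; [exact Hh|apply Rmin_r]).
specialize (Hdelta h).
unfold ball in Hdelta; simpl in Hdelta; unfold AbsRing_ball, abs, minus, plus, opp in Hdelta; simpl in Hdelta.
rewrite Ropp_0, Rplus_0_r in Hdelta.
specialize (Hdelta Hh1 Hh0).
replace ((Series (f (x + h)) - Series (f x)) / h) with (Series (G h)); [exact Hdelta|].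
unfold G, Rdiv; rewrite Series_scal_r, Series_minus; auto.
Qed.

(* Newton integral over the open interval: primitives need only have limits at
   the end points, so that integrands unbounded there are allowed. *)
Definition nint (f : R -> R) (a b I : R) : Prop :=
  exists (F : R -> R) (A B : R),
    (forall x, a < x < b -> is_derive F x (f x)) /\
    filterlim F (at_right a) (locally A) /\
    filterlim F (at_left b) (locally B) /\ I = B - A.

Lemma at_right_lt (a b : R) : a < b -> at_right a (fun x => a < x < b).
Proof.
intros H; assert (H0 : 0 < b - a) by lra.
exists (mkposreal _ H0); intros y Hy Hy2.
unfold ball in Hy; simpl in Hy; unfold AbsRing_ball, abs, minus, plus, opp in Hy; simpl in Hy.
apply Rabs_def2 in Hy; lra.
Qed.

Lemma at_left_gt (a b : R) : a < b -> at_left b (fun x => a < x < b).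
Proof.
intros H; assert (H0 : 0 < b - a) by lra.
exists (mkposreal _ H0); intros y Hy Hy2.
unfold ball in Hy; simpl in Hy; unfold AbsRing_ball, abs, minus, plus, opp in Hy; simpl in Hy.
apply Rabs_def2 in Hy; lra.
Qed.

Lemma filterlim_Rplus {T : Type} {F : (T -> Prop) -> Prop} {FF : Filter F} (f g : T -> R) (l m : R) :
  filterlim f F (locally l) -> filterlim g F (locally m) ->
  filterlim (fun x => f x + g x) F (locally (l + m)).
Proof.
intros Hf Hg; eapply filterlim_comp_2; [exact Hf|exact Hg|].
apply (filterlim_plus (V := R_NormedModule)).
Qed.

Lemma filterlim_Rmult {T : Type} {F : (T -> Prop) -> Prop} {FF : Filter F} (f g : T -> R) (l m : R) :
  filterlim f F (locally l) -> filterlim g F (locally m) ->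
  filterlim (fun x => f x * g x) F (locally (l * m)).
Proof.
intros Hf Hg; eapply filterlim_comp_2; [exact Hf|exact Hg|].
apply (filterlim_mult (K := R_AbsRing)).
Qed.

Lemma filterlim_Ropp {T : Type} {F : (T -> Prop) -> Prop} {FF : Filter F} (f : T -> R) (l : R) :
  filterlim f F (locally l) -> filterlim (fun x => - f x) F (locally (- l)).
Proof.
intros Hf; eapply filterlim_comp; [exact Hf|].
apply (filterlim_opp (V := R_NormedModule)).
Qed.

Lemma filterlim_Rminus {T : Type} {F : (T -> Prop) -> Prop} {FF : Filter F} (f g : T -> R) (l m : R) :
  filterlim f F (locally l) -> filterlim g F (locally m) ->
  filterlim (fun x => f x - g x) F (locally (l - m)).
Proof. intros Hf Hg; apply filterlim_Rplus; [exact Hf|apply filterlim_Ropp, Hg]. Qed.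

Lemma filterlim_scal_zero {T : Type} {F : (T -> Prop) -> Prop} {FF : Filter F} (k : R) (f : T -> R) :
  filterlim f F (locally 0) -> filterlim (fun x => k * f x) F (locally 0).
Proof.
intros Hf; pose proof (filterlim_Rmult (fun _ => k) f k 0 (filterlim_const k) Hf) as H.
rewrite Rmult_0_r in H; exact H.
Qed.

Lemma is_derive_zero_const (F : R -> R) (a b : R) :
  (forall x, a < x < b -> is_derive F x 0) ->
  forall x y, a < x < b -> a < y < b -> F x = F y.
Proof.
intros H x y Hx Hy.
assert (HI : forall z, Rmin x y <= z <= Rmax x y -> a < z < b).
{ intros z Hz; unfold Rmin, Rmax in Hz; destruct (Rle_dec x y); lra. }
destruct (MVT_gen F x y (fun _ => 0)) as [c [_ Hc]].
- intros z Hz; apply H, HI; lra.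
- intros z Hz; apply continuity_pt_filterlim, (ex_derive_continuous F).
  exists 0; apply H, HI, Hz.
- lra.
Qed.

Lemma nint_plus (f g : R -> R) (a b I J : R) :
  nint f a b I -> nint g a b J -> nint (fun x => f x + g x) a b (I + J).
Proof.
intros (F & A & B & Hd & Ha & Hb & ->) (G & A' & B' & Hd' & Ha' & Hb' & ->).
exists (fun x => F x + G x), (A + A'), (B + B'); (split; [|split; [|split]]).
- intros x Hx; apply (is_derive_plus (V := R_NormedModule)); auto.
- apply filterlim_Rplus; auto.
- apply filterlim_Rplus; auto.
- ring.
Qed.

Lemma nint_scal (c : R) (f : R -> R) (a b I : R) :
  nint f a b I -> nint (fun x => c * f x) a b (c * I).
Proof.
intros (F & A & B & Hd & Ha & Hb & ->).
exists (fun x => c * F x), (c * A), (c * B); (split; [|split; [|split]]).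
- intros x Hx; apply is_derive_scal; auto.
- apply filterlim_Rmult; auto; apply filterlim_const.
- apply filterlim_Rmult; auto; apply filterlim_const.
- ring.
Qed.

Lemma nint_ext (f g : R -> R) (a b I : R) :
  (forall x, a < x < b -> f x = g x) -> nint f a b I -> nint g a b I.
Proof.
intros H (F & A & B & Hd & Ha & Hb & ->).
exists F, A, B; (split; [|split; [|split]]); auto.
intros x Hx; rewrite <- H; auto.
Qed.

(** Two primitives differ by a constant, which is both the difference of the left limits and that of
    the right limits. Most relations between constants below arise by evaluating one integrand in
    two ways. *)
Lemma nint_unique (f : R -> R) (a b I J : R) :
  a < b -> nint f a b I -> nint f a b J -> I = J.
Proof.
intros Hab (F & A & B & Hd & Ha & Hb & ->) (G & A' & B' & Hd' & Ha' & Hb' & ->).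
set (D := fun x => F x - G x).
assert (HD : forall x, a < x < b -> is_derive D x 0).
{ intros x Hx; unfold D.
  replace 0 with (f x - f x) by ring.
  apply (is_derive_minus (V := R_NormedModule)); auto. }
set (m := (a + b) / 2).
assert (Hm : a < m < b) by (unfold m; lra).
pose proof (is_derive_zero_const D a b HD) as HC.
assert (H1 : D m = A - A').
{ apply (filterlim_locally_unique (F := at_right a) D).
  - apply filterlim_ext_loc with (fun _ => D m); [|apply filterlim_const].
    generalize (at_right_lt a b Hab); apply filter_imp; intros x Hx; apply HC; auto.
  - apply filterlim_Rminus; auto. }
assert (H2 : D m = B - B').
{ apply (filterlim_locally_unique (F := at_left b) D).
  - apply filterlim_ext_loc with (fun _ => D m); [|apply filterlim_const].
    generalize (at_left_gt a b Hab); apply filter_imp; intros x Hx; apply HC; auto.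
  - apply filterlim_Rminus; auto. }
lra.
Qed.

(** * Complex-valued functions of a real variable *)

(** Everything complex is treated by components: only derivatives along real parametrised curves
    occur, so no holomorphy is required and the real lemmas transfer directly. *)
Definition Cder (f : R -> C) (x : R) (l : C) : Prop :=
  is_derive (fun y => Re (f y)) x (Re l) /\ is_derive (fun y => Im (f y)) x (Im l).

Definition Clim {T : Type} (f : T -> C) (F : (T -> Prop) -> Prop) (l : C) : Prop :=
  filterlim (fun y => Re (f y)) F (locally (Re l)) /\
  filterlim (fun y => Im (f y)) F (locally (Im l)).

Definition CSeries (a : nat -> C) : C :=
  (Series (fun n => Re (a n)), Series (fun n => Im (a n))).

Definition cnint (f : R -> C) (a b : R) (I : C) : Prop :=
  nint (fun x => Re (f x)) a b (Re I) /\ nint (fun x => Im (f x)) a b (Im I).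

Lemma im_le_Cmod (c : C) : Rabs (Im c) <= Cmod c.
Proof. eapply Rle_trans; [apply Rmax_r|apply (Rmax_Cmod c)]. Qed.

Lemma Cmod_le_Re_Im (c : C) : Cmod c <= Rabs (Re c) + Rabs (Im c).
Proof.
apply Rsqr_incr_0_var; [|pose proof (Rabs_pos (Re c)); pose proof (Rabs_pos (Im c)); lra].
unfold Rsqr; replace (Cmod c * Cmod c) with (Cmod c ^ 2) by ring; rewrite Cmod2_alt.
pose proof (Rabs_pos (Re c)); pose proof (Rabs_pos (Im c)).
rewrite <- (pow2_abs (Re c)), <- (pow2_abs (Im c)); nra.
Qed.

Lemma C_eq (x y : C) : Re x = Re y -> Im x = Im y -> x = y.
Proof. destruct x, y; simpl; intros -> ->; reflexivity. Qed.

Lemma Cder_ext (f g : R -> C) (x : R) (l : C) :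
  (forall y, f y = g y) -> Cder f x l -> Cder g x l.
Proof.
intros H [H1 H2]; split.
- apply is_derive_ext with (2 := H1); intros y; rewrite H; reflexivity.
- apply is_derive_ext with (2 := H2); intros y; rewrite H; reflexivity.
Qed.

Lemma Cder_eq (f : R -> C) (x : R) (l l' : C) : Cder f x l -> l = l' -> Cder f x l'.
Proof. intros H <-; exact H. Qed.

Lemma Cder_const (c : C) (x : R) : Cder (fun _ => c) x 0.
Proof. split; apply (is_derive_const (V := R_NormedModule)). Qed.

Lemma Cder_plus (f g : R -> C) (x : R) (l m : C) :
  Cder f x l -> Cder g x m -> Cder (fun y => f y + g y)%C x (l + m)%C.
Proof.
intros [H1 H2] [H3 H4]; split; apply (is_derive_plus (V := R_NormedModule)); assumption.
Qed.

Lemma Cder_mult (f g : R -> C) (x : R) (l m : C) :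
  Cder f x l -> Cder g x m -> Cder (fun y => f y * g y)%C x (l * g x + f x * m)%C.
Proof.
intros [H1 H2] [H3 H4]; split.
- eapply is_derive_ext;
    [|eapply is_derive_eq;
      [apply (is_derive_minus (V := R_NormedModule));
       [apply (is_derive_mult (K := R_AbsRing)); [exact H1|exact H3|apply Rmult_comm]
       |apply (is_derive_mult (K := R_AbsRing)); [exact H2|exact H4|apply Rmult_comm]]|]].
  + intros t; reflexivity.
  + unfold minus, plus, opp, mult, Re, Im; simpl; ring.
- eapply is_derive_ext;
    [|eapply is_derive_eq;
      [apply (is_derive_plus (V := R_NormedModule));
       [apply (is_derive_mult (K := R_AbsRing)); [exact H1|exact H4|apply Rmult_comm]
       |apply (is_derive_mult (K := R_AbsRing)); [exact H2|exact H3|apply Rmult_comm]]|]].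
  + intros t; reflexivity.
  + unfold minus, plus, opp, mult, Re, Im; simpl; ring.
Qed.

Lemma Cder_scal (c : C) (f : R -> C) (x : R) (l : C) :
  Cder f x l -> Cder (fun y => c * f y)%C x (c * l)%C.
Proof.
intros H; eapply Cder_eq; [apply Cder_mult; [apply Cder_const|exact H]|cbv beta; ring].
Qed.

Lemma Cder_minus (f g : R -> C) (x : R) (l m : C) :
  Cder f x l -> Cder g x m -> Cder (fun y => f y - g y)%C x (l - m)%C.
Proof.
intros H1 H2; eapply Cder_ext; [|eapply Cder_eq;
  [apply Cder_plus; [exact H1|apply (Cder_scal (-1)), H2]|ring]].
intros y; simpl; ring.
Qed.

Lemma Cder_pow (f : R -> C) (n : nat) (x : R) (l : C) :
  Cder f x l -> Cder (fun y => f y ^ S n)%C x (INR (S n) * l * f x ^ n)%C.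
Proof.
intros H; induction n as [|n IH].
- eapply Cder_ext; [|eapply Cder_eq; [exact H|]].
  + intros y; simpl; ring.
  + simpl; ring.
- eapply Cder_ext; [|eapply Cder_eq; [apply Cder_mult; [exact H|exact IH]|]].
  + intros y; reflexivity.
  + rewrite (S_INR (S n)), RtoC_plus, (Cpow_S (f x) n); ring.
Qed.

Lemma Clim_const {T : Type} {F : (T -> Prop) -> Prop} {FF : Filter F} (c : C) :
  Clim (fun _ => c) F c.
Proof. split; apply filterlim_const. Qed.

Lemma Clim_ext_loc {T : Type} {F : (T -> Prop) -> Prop} {FF : Filter F} (f g : T -> C) (l : C) :
  F (fun x => f x = g x) -> Clim f F l -> Clim g F l.
Proof.
intros H [H1 H2]; split.
- apply filterlim_ext_loc with (2 := H1); revert H; apply filter_imp; intros x ->; reflexivity.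
- apply filterlim_ext_loc with (2 := H2); revert H; apply filter_imp; intros x ->; reflexivity.
Qed.

Lemma Clim_ext {T : Type} {F : (T -> Prop) -> Prop} {FF : Filter F} (f g : T -> C) (l : C) :
  (forall x, f x = g x) -> Clim f F l -> Clim g F l.
Proof. intros H; apply Clim_ext_loc, filter_forall, H. Qed.

Lemma Clim_mult {T : Type} {F : (T -> Prop) -> Prop} {FF : Filter F} (f g : T -> C) (l m : C) :
  Clim f F l -> Clim g F m -> Clim (fun y => f y * g y)%C F (l * m)%C.
Proof.
intros [H1 H2] [H3 H4]; split.
- apply filterlim_Rminus; apply filterlim_Rmult; assumption.
- apply filterlim_Rplus; apply filterlim_Rmult; assumption.
Qed.

Lemma Clim_eq {T : Type} {F : (T -> Prop) -> Prop} (f : T -> C) (l l' : C) :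
  Clim f F l -> l = l' -> Clim f F l'.
Proof. intros H <-; exact H. Qed.

Lemma Clim_minus {T : Type} {F : (T -> Prop) -> Prop} {FF : Filter F} (f g : T -> C) (l m : C) :
  Clim f F l -> Clim g F m -> Clim (fun y => f y - g y)%C F (l - m)%C.
Proof.
intros [H1 H2] [H3 H4]; split; apply filterlim_Rminus; assumption.
Qed.

Lemma Clim_pow {T : Type} {F : (T -> Prop) -> Prop} {FF : Filter F} (f : T -> C) (l : C) (n : nat) :
  Clim f F l -> Clim (fun y => f y ^ n)%C F (l ^ n)%C.
Proof.
intros H; induction n as [|n IH]; [apply Clim_const|].
simpl; apply Clim_mult; assumption.
Qed.

Lemma filterlim_zero_of_le {T : Type} {F : (T -> Prop) -> Prop} {FF : Filter F} (f g : T -> R) :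
  F (fun x => Rabs (f x) <= g x) -> filterlim g F (locally 0) -> filterlim f F (locally 0).
Proof.
intros H Hg; apply filterlim_locally; intros eps.
pose proof (proj1 (filterlim_locally _ _) Hg eps) as H1.
generalize (filter_and _ _ H H1); apply filter_imp; intros x [Hx1 Hx2].
unfold ball in *; simpl in *; unfold AbsRing_ball, abs, minus, plus, opp in *; simpl in *.
rewrite Ropp_0, Rplus_0_r in *.
pose proof (Rle_abs (g x)); lra.
Qed.

Lemma Clim_zero_of_le {T : Type} {F : (T -> Prop) -> Prop} {FF : Filter F} (f : T -> C) (g : T -> R) :
  F (fun x => Cmod (f x) <= g x) -> filterlim g F (locally 0) -> Clim f F 0.
Proof.
intros H Hg; split; apply (filterlim_zero_of_le _ g); auto; revert H; apply filter_imp;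
  intros x Hx.
- eapply Rle_trans; [apply re_le_Cmod|exact Hx].
- eapply Rle_trans; [apply im_le_Cmod|exact Hx].
Qed.

Lemma cnint_of_primitive (F f : R -> C) (a b : R) (A B : C) :
  (forall x, a < x < b -> Cder F x (f x)) ->
  Clim F (at_right a) A -> Clim F (at_left b) B -> cnint f a b (B - A)%C.
Proof.
intros Hd [Ha1 Ha2] [Hb1 Hb2]; split.
- exists (fun x => Re (F x)), (Re A), (Re B); split; [|split; [|split]]; auto.
  intros x Hx; apply (Hd x Hx).
- exists (fun x => Im (F x)), (Im A), (Im B); split; [|split; [|split]]; auto.
  intros x Hx; apply (Hd x Hx).
Qed.

Lemma CSeries_ext (a b : nat -> C) : (forall n, a n = b n) -> CSeries a = CSeries b.
Proof. intros H; unfold CSeries; f_equal; apply Series_ext; intros n; rewrite H; reflexivity. Qed.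

Lemma ex_series_Re (a : nat -> C) (M : nat -> R) :
  (forall n, Cmod (a n) <= M n) -> ex_series M -> ex_series (fun n => Re (a n)).
Proof.
intros H HM; apply (ex_series_le_R _ M); auto.
intros n; eapply Rle_trans; [apply re_le_Cmod|apply H].
Qed.

Lemma ex_series_Im (a : nat -> C) (M : nat -> R) :
  (forall n, Cmod (a n) <= M n) -> ex_series M -> ex_series (fun n => Im (a n)).
Proof.
intros H HM; apply (ex_series_le_R _ M); auto.
intros n; eapply Rle_trans; [apply im_le_Cmod|apply H].
Qed.

Lemma CSeries_scal (c : C) (a : nat -> C) (M : nat -> R) :
  (forall n, Cmod (a n) <= M n) -> ex_series M ->
  CSeries (fun n => c * a n)%C = (c * CSeries a)%C.
Proof.
intros H HM.
pose proof (ex_series_Re a M H HM) as HR; pose proof (ex_series_Im a M H HM) as HI.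
apply C_eq; simpl.
- rewrite <- !Series_scal_l, <- Series_minus; auto;
    apply ex_series_Rmult_l; auto.
- rewrite <- !Series_scal_l, <- Series_plus; auto;
    apply ex_series_Rmult_l; auto.
Qed.

Lemma CSeries_plus (a b : nat -> C) (M N : nat -> R) :
  (forall n, Cmod (a n) <= M n) -> ex_series M ->
  (forall n, Cmod (b n) <= N n) -> ex_series N ->
  CSeries (fun n => a n + b n)%C = (CSeries a + CSeries b)%C.
Proof.
intros H HM H' HN.
apply C_eq; simpl; apply Series_plus;
  eauto using ex_series_Re, ex_series_Im.
Qed.

Lemma Cmod_CSeries_le (a : nat -> C) (M : nat -> R) :
  (forall n, Cmod (a n) <= M n) -> ex_series M -> Cmod (CSeries a) <= 2 * Series M.
Proof.
intros H HM; eapply Rle_trans; [apply Cmod_le_Re_Im|simpl].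
assert (Rabs (Series (fun n => Re (a n))) <= Series M).
{ apply Series_abs_le; auto; intros n; eapply Rle_trans; [apply re_le_Cmod|apply H]. }
assert (Rabs (Series (fun n => Im (a n))) <= Series M).
{ apply Series_abs_le; auto; intros n; eapply Rle_trans; [apply im_le_Cmod|apply H]. }
lra.
Qed.

Lemma CSeries_tannery {T : Type} {F : (T -> Prop) -> Prop} {FF : ProperFilter F}
  (f : T -> nat -> C) (M : nat -> R) (l : nat -> C) :
  ex_series M ->
  F (fun x => forall n, Cmod (f x n) <= M n) ->
  (forall n, Clim (fun x => f x n) F (l n)) ->
  Clim (fun x => CSeries (f x)) F (CSeries l).
Proof.
intros HM Hb Hl; split; simpl.
- apply (Series_tannery F (fun x n => Re (f x n)) M); auto.
  + revert Hb; apply filter_imp; intros x Hx n.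
    eapply Rle_trans; [apply re_le_Cmod|apply Hx].
  + intros n; apply (Hl n).
- apply (Series_tannery F (fun x n => Im (f x n)) M); auto.
  + revert Hb; apply filter_imp; intros x Hx n.
    eapply Rle_trans; [apply im_le_Cmod|apply Hx].
  + intros n; apply (Hl n).
Qed.

Lemma Cder_CSeries (f f' : R -> nat -> C) (M N : nat -> R) (a b x : R) :
  a < x < b -> ex_series M -> ex_series N ->
  (forall n y, a < y < b -> Cder (fun y => f y n) y (f' y n)) ->
  (forall n y, a < y < b -> Cmod (f' y n) <= M n) ->
  (forall n y, a < y < b -> Cmod (f y n) <= N n) ->
  Cder (fun y => CSeries (f y)) x (CSeries (f' x)).
Proof.
intros Hx HM HN Hd Hb He; split; simpl.
- apply (is_derive_Series (fun y n => Re (f y n)) (fun y n => Re (f' y n)) M a b); auto.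
  + intros n y Hy; apply (Hd n y Hy).
  + intros n y Hy; eapply Rle_trans; [apply re_le_Cmod|auto].
  + intros y Hy; apply (ex_series_Re _ N); auto.
- apply (is_derive_Series (fun y n => Im (f y n)) (fun y n => Im (f' y n)) M a b); auto.
  + intros n y Hy; apply (Hd n y Hy).
  + intros n y Hy; eapply Rle_trans; [apply im_le_Cmod|auto].
  + intros y Hy; apply (ex_series_Im _ N); auto.
Qed.

(** * Weighted polylogarithms *)

(* With weights [c = 1], [Li c k] is the polylogarithm of order [k]; the index is
   shifted by one, so that [c n] is the weight of [q ^ S n]. *)
Definition Li (c : nat -> R) (k : nat) (q : C) : C :=
  CSeries (fun n => RtoC (c n / INR (S n) ^ k) * q ^ S n)%C.

Lemma INR_S_ge_1 (n : nat) : 1 <= INR (S n).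
Proof. rewrite S_INR; pose proof (pos_INR n); lra. Qed.

Lemma INR_S_pow_ge_1 (n k : nat) : 1 <= INR (S n) ^ k.
Proof. apply pow_R1_Rle, INR_S_ge_1. Qed.

Lemma Cmod_Li_term (c : nat -> R) (k n m : nat) (q : C) :
  Cmod (RtoC (c n / INR (S n) ^ k) * q ^ m)%C = Rabs (c n) / INR (S n) ^ k * Cmod q ^ m.
Proof.
pose proof (INR_S_pow_ge_1 n k).
rewrite Cmod_mult, Cmod_R, Cmod_pow; f_equal.
unfold Rdiv; rewrite Rabs_mult; f_equal; apply Rabs_pos_eq.
left; apply Rinv_0_lt_compat; lra.
Qed.

Lemma weight_div_pos (c : nat -> R) (k n : nat) : 0 <= Rabs (c n) / INR (S n) ^ k.
Proof.
pose proof (INR_S_pow_ge_1 n k); apply Rdiv_le_0_compat; [apply Rabs_pos|lra].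
Qed.

Lemma weight_div_le (c : nat -> R) (j k n : nat) :
  (j <= k)%nat -> Rabs (c n) / INR (S n) ^ k <= Rabs (c n) / INR (S n) ^ j.
Proof.
intros H; unfold Rdiv; apply Rmult_le_compat_l; [apply Rabs_pos|].
pose proof (INR_S_pow_ge_1 n j); apply Rinv_le_contravar; [lra|].
apply Rle_pow; [apply INR_S_ge_1|exact H].
Qed.

(** Of the two growth conditions on weights, this one dominates the orders at least 2 uniformly on
    the closed disk, while [sublinear] gives geometric domination of the lower orders inside the
    disk. The weights [one] and [harm] satisfy both. *)
Definition summable2 (c : nat -> R) : Prop :=
  ex_series (fun n => Rabs (c n) / INR (S n) ^ 2).

Definition sublinear (c : nat -> R) : Prop := forall n, Rabs (c n) <= INR (S n).

Lemma Cmod_pow_le_1 (q : C) (n : nat) : Cmod q <= 1 -> Cmod q ^ n <= 1.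
Proof.
intros H; rewrite <- (pow1 n); apply pow_incr; split; [apply Cmod_ge_0|exact H].
Qed.

Lemma Li_term_le2 (c : nat -> R) (k n : nat) (q : C) :
  (2 <= k)%nat -> Cmod q <= 1 ->
  Cmod (RtoC (c n / INR (S n) ^ k) * q ^ S n)%C <= Rabs (c n) / INR (S n) ^ 2.
Proof.
intros Hk Hq; rewrite Cmod_Li_term.
pose proof (weight_div_le c 2 k n Hk); pose proof (weight_div_pos c k n).
pose proof (Cmod_pow_le_1 q (S n) Hq); pose proof (pow_le (Cmod q) (S n) (Cmod_ge_0 q)).
nra.
Qed.

Lemma Li_lim {T : Type} {F : (T -> Prop) -> Prop} {FF : ProperFilter F}
  (c : nat -> R) (k : nat) (q : T -> C) (q0 : C) :
  (2 <= k)%nat -> summable2 c -> F (fun x => Cmod (q x) <= 1) -> Clim q F q0 ->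
  Clim (fun x => Li c k (q x)) F (Li c k q0).
Proof.
intros Hk Hc Hq Hl; unfold Li.
apply (CSeries_tannery _ (fun n => Rabs (c n) / INR (S n) ^ 2)); [exact Hc| |].
- revert Hq; apply filter_imp; intros x Hx n; apply Li_term_le2; auto.
- intros n; apply Clim_mult; [apply Clim_const|apply Clim_pow, Hl].
Qed.

(** The constant is uniform in the order, and the factor [Cmod q] is what later absorbs the powers
    of the logarithm where the curve starts at 0. *)
Lemma Cmod_Li_le2 (c : nat -> R) :
  summable2 c -> exists K, 0 <= K /\
  forall k q, (2 <= k)%nat -> Cmod q <= 1 -> Cmod (Li c k q) <= K * Cmod q.
Proof.
intros Hc; exists (2 * Series (fun n => Rabs (c n) / INR (S n) ^ 2)); split.
- apply Rmult_le_pos; [lra|].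
  rewrite <- (Rabs_R0).
  eapply Rle_trans; [|apply (Series_abs_le (fun _ => 0) _)]; [|intros n; rewrite Rabs_R0; apply weight_div_pos|exact Hc].
  rewrite Rabs_R0; apply Rabs_pos.
- intros k q Hk Hq.
  rewrite Rmult_assoc, <- Series_scal_r; apply Cmod_CSeries_le.
  + intros n; rewrite Cmod_Li_term; simpl (Cmod q ^ S n).
    pose proof (weight_div_le c 2 k n Hk); pose proof (weight_div_pos c k n).
    pose proof (Cmod_pow_le_1 q n Hq); pose proof (pow_le (Cmod q) n (Cmod_ge_0 q)).
    pose proof (Cmod_ge_0 q).
    assert (Cmod q * Cmod q ^ n <= Cmod q) by nra.
    apply Rmult_le_compat; auto; nra.
  + apply ex_series_Rmult_r; exact Hc.
Qed.

Lemma ex_series_geom_R (r : R) : 0 <= r < 1 -> ex_series (fun n => r ^ n).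
Proof. intros H; apply ex_series_geom; rewrite Rabs_pos_eq; lra. Qed.

Lemma Li_term_le1 (c : nat -> R) (k n : nat) (q : C) :
  (1 <= k)%nat -> sublinear c ->
  Cmod (RtoC (c n / INR (S n) ^ k) * q ^ S n)%C <= Cmod q * Cmod q ^ n.
Proof.
intros Hk Hc; rewrite Cmod_Li_term; simpl (Cmod q ^ S n).
pose proof (weight_div_le c 1 k n Hk); pose proof (weight_div_pos c k n).
assert (Rabs (c n) / INR (S n) ^ 1 <= 1).
{ pose proof (INR_S_ge_1 n).
  apply Rmult_le_reg_r with (INR (S n)); [lra|].
  rewrite pow_1; unfold Rdiv; rewrite Rmult_assoc, Rinv_l by lra; rewrite Rmult_1_r, Rmult_1_l.
  apply Hc. }
assert (0 <= Cmod q * Cmod q ^ n) by (apply (pow_le (Cmod q) (S n)), Cmod_ge_0).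
nra.
Qed.

Lemma Cmod_Li_le1 (c : nat -> R) (q : C) :
  sublinear c -> Cmod q < 1 -> Cmod (Li c 1 q) <= 2 * (Cmod q / (1 - Cmod q)).
Proof.
intros Hc Hq; pose proof (Cmod_ge_0 q).
replace (Cmod q / (1 - Cmod q)) with (Series (fun n => Cmod q * Cmod q ^ n)).
- apply Cmod_CSeries_le.
  + intros n; apply Li_term_le1; auto.
  + apply ex_series_Rmult_l, ex_series_geom_R; lra.
- rewrite Series_scal_l, Series_geom; [reflexivity|rewrite Rabs_pos_eq; lra].
Qed.

Lemma ex_series_S_pow (r : R) : 0 < r < 1 -> ex_series (fun n => INR (S n) * r ^ n).
Proof.
intros Hr.
assert (H : ex_series (fun n => Rabs (INR (S n) * r ^ n))).
{ apply (ex_series_DAlembert _ r); [lra| |].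
  - intros n; pose proof (INR_S_ge_1 n); pose proof (pow_lt r n (proj1 Hr)); nra.
  - apply is_lim_seq_ext with (fun n => r * (1 + / INR (S n))).
    + intros n; pose proof (INR_S_ge_1 n); pose proof (pow_lt r n (proj1 Hr)).
      rewrite (S_INR (S n)); simpl (r ^ S n).
      replace ((INR (S n) + 1) * (r * r ^ n) / (INR (S n) * r ^ n))
        with (r * (1 + / INR (S n))) by (field; split; lra).
      rewrite Rabs_pos_eq; auto.
      assert (0 < / INR (S n)) by (apply Rinv_0_lt_compat; lra); nra.
    + replace (Finite r) with (Rbar_mult r (1 + 0)) by (simpl; f_equal; ring).
      apply is_lim_seq_scal_l.
      apply is_lim_seq_plus'; [apply is_lim_seq_const|].
      apply (is_lim_seq_incr_1 (fun n => / INR n)).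
      replace (Finite 0) with (Rbar_inv p_infty) by reflexivity.
      apply is_lim_seq_inv; [apply is_lim_seq_INR|discriminate]. }
apply (ex_series_le_R _ _ (fun n => Rle_refl _) H).
Qed.

Lemma ex_series_weight_pow (c : nat -> R) (k : nat) (r : R) :
  sublinear c -> 0 < r < 1 -> ex_series (fun n => Rabs (c n) / INR (S n) ^ k * r ^ n).
Proof.
intros Hc Hr; apply (ex_series_le_R _ (fun n => INR (S n) * r ^ n)); [|apply ex_series_S_pow, Hr].
intros n; pose proof (weight_div_le c 0 k n (Nat.le_0_l k)); pose proof (weight_div_pos c k n).
pose proof (pow_lt r n (proj1 Hr)); pose proof (Hc n).
rewrite Rabs_pos_eq by nra.
apply Rmult_le_compat_r; [lra|].
rewrite pow_O in H; lra.
Qed.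

(** Differentiating [q ^ S n] produces the factor [INR (S n)], which lowers the order by one, and q'
    = dl q restores the power of q. The value r = 1 is permitted if the weights themselves are
    summable, as happens on the unit circle for higher orders; inside the disk r < 1 gives the
    summability. *)
Lemma Li_der (c : nat -> R) (k : nat) (q q' : R -> C) (dl : C) (a b x B r : R) :
  a < x < b -> 0 <= r <= 1 ->
  ex_series (fun n => Rabs (c n) / INR (S n) ^ k * r ^ n) ->
  (forall y, a < y < b -> Cder q y (q' y)) ->
  (forall y, a < y < b -> Cmod (q' y) <= B) ->
  (forall y, a < y < b -> Cmod (q y) <= r) ->
  q' x = (dl * q x)%C ->
  Cder (fun y => Li c (S k) (q y)) x (dl * Li c k (q x))%C.
Proof.
intros Hx Hr Hs Hd HB Hq Hdl; unfold Li.
assert (Hpow : forall y n, a < y < b -> Cmod (q y) ^ n <= r ^ n).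
{ intros y n Hy; apply pow_incr; split; [apply Cmod_ge_0|auto]. }
apply Cder_eq with
  (CSeries (fun n => RtoC (c n / INR (S n) ^ k) * q x ^ n * q' x)%C).
- apply (Cder_CSeries _ (fun y n => RtoC (c n / INR (S n) ^ k) * q y ^ n * q' y)%C
    (fun n => B * (Rabs (c n) / INR (S n) ^ k * r ^ n))
    (fun n => Rabs (c n) / INR (S n) ^ k * r ^ n) a b); auto.
  + apply ex_series_Rmult_l, Hs.
  + intros n y Hy; eapply Cder_eq; [apply Cder_scal, Cder_pow, Hd, Hy|].
    pose proof (INR_S_pow_ge_1 n k); pose proof (INR_S_ge_1 n).
    replace (c n / INR (S n) ^ S k) with (c n / INR (S n) ^ k * / INR (S n)) by (rewrite <- tech_pow_Rmult; field; split; lra).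
    rewrite RtoC_mult, RtoC_inv by lra.
    assert (RtoC (INR (S n)) <> 0%C) by (intros E; apply RtoC_inj in E; lra).
    field; assumption.
  + intros n y Hy; rewrite Cmod_mult, Cmod_Li_term.
    rewrite (Rmult_comm B).
    pose proof (weight_div_pos c k n); pose proof (Cmod_ge_0 (q' y)).
    pose proof (Hpow y n Hy); pose proof (pow_le (Cmod (q y)) n (Cmod_ge_0 _)).
    apply Rmult_le_compat; auto; [nra|].
    apply Rmult_le_compat_l; auto.
  + intros n y Hy; rewrite Cmod_Li_term.
    pose proof (weight_div_le c k (S k) n (Nat.le_succ_diag_r k)); pose proof (weight_div_pos c (S k) n).
    pose proof (Hpow y n Hy); pose proof (pow_le (Cmod (q y)) n (Cmod_ge_0 _)).
    pose proof (Cmod_ge_0 (q y)); pose proof (Hq y Hy).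
    apply Rmult_le_compat; auto; simpl; nra.
- rewrite Hdl, <- (CSeries_scal dl _ (fun n => Rabs (c n) / INR (S n) ^ k * r ^ n)); auto.
  + apply CSeries_ext; intros n; rewrite Cpow_S; ring.
  + intros n; rewrite Cmod_Li_term.
    pose proof (weight_div_pos c k n).
    pose proof (Hpow x n Hx); pose proof (pow_le (Cmod (q x)) n (Cmod_ge_0 _)).
    pose proof (Cmod_ge_0 (q x)); pose proof (Hq x Hx).
    apply Rmult_le_compat_l; auto; simpl; nra.
Qed.

(* Integration by parts: if [P (S k)' = l' P k] along a curve then [W m (S k)] is a
   primitive of [l ^ m l' P k]. *)
Fixpoint W (m k : nat) (l : C) (P : nat -> C) : C :=
  match m with
  | O => P k
  | S m' => (l ^ S m' * P k - INR (S m') * W m' (S k) l P)%C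
  end.

Lemma W_der (m k : nat) (l : R -> C) (P : R -> nat -> C) (dl : C) (x : R) :
  Cder l x dl ->
  (forall j, (k <= j)%nat -> Cder (fun y => P y (S j)) x (dl * P x j)%C) ->
  Cder (fun y => W m (S k) (l y) (P y)) x (l x ^ m * dl * P x k)%C.
Proof.
intros Hl; revert k; induction m as [|m IH]; intros k HP.
- simpl; eapply Cder_eq; [apply HP; lia|ring].
- eapply Cder_eq; [apply Cder_minus;
    [apply Cder_mult; [apply Cder_pow, Hl|apply HP; lia]
    |apply Cder_scal, IH; intros j Hj; apply HP; lia]|].
  simpl; ring.
Qed.

Lemma W_lim {T : Type} {F : (T -> Prop) -> Prop} {FF : Filter F}
  (m k : nat) (l : T -> C) (P : T -> nat -> C) (l0 : C) (P0 : nat -> C) :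
  Clim l F l0 -> (forall j, (k <= j)%nat -> Clim (fun y => P y j) F (P0 j)) ->
  Clim (fun y => W m k (l y) (P y)) F (W m k l0 P0).
Proof.
intros Hl; revert k; induction m as [|m IH]; intros k HP.
- apply HP; lia.
- apply Clim_minus.
  + apply Clim_mult; [apply (Clim_pow l l0 (S m)), Hl|apply HP; lia].
  + apply Clim_mult; [apply Clim_const|apply IH; intros j Hj; apply HP; lia].
Qed.

(** Every term but the innermost carries a positive power of the logarithm, and the factors met on
    the way down multiply to (-1) ^ m m!. *)
Lemma W_zero (m k : nat) (P : nat -> C) :
  W m k 0 P = (RtoC ((-1) ^ m * INR (fact m)) * P (k + m)%nat)%C.
Proof.
revert k; induction m as [|m IH]; intros k.
- simpl; rewrite Nat.add_0_r, Rmult_1_l; ring.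
- change (W (S m) k 0 P) with (0 ^ S m * P k - INR (S m) * W m (S k) 0 P)%C.
  rewrite IH.
  replace (S k + m)%nat with (k + S m)%nat by lia.
  change (fact (S m)) with (S m * fact m)%nat; rewrite mult_INR.
  rewrite !RtoC_mult, <- tech_pow_Rmult, RtoC_mult, Cpow_S.
  ring.
Qed.

Lemma W_vanish {T : Type} {F : (T -> Prop) -> Prop} {FF : Filter F}
  (m k : nat) (l : T -> C) (P : T -> nat -> C) :
  (forall i j, (k <= j)%nat -> Clim (fun y => l y ^ i * P y j)%C F 0) ->
  Clim (fun y => W m k (l y) (P y)) F 0.
Proof.
revert k; induction m as [|m IH]; intros k HP.
- apply Clim_ext with (2 := HP O k (le_n _)); intros y; simpl; ring.
- eapply Clim_eq; [apply Clim_minus; [apply (HP (S m) k (le_n _))|apply Clim_mult;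
    [apply Clim_const|apply IH; intros i j Hj; apply HP; lia]]|ring].
Qed.

(** * The two weights, and closed forms inside the disk *)

Lemma ex_series_telescope (u v : nat -> R) :
  (forall n, 0 <= u n <= v n - v (S n)) -> (forall n, 0 <= v n) -> ex_series u.
Proof.
intros H Hv.
apply ex_finite_lim_seq_incr with (M := v O).
- intros n; rewrite sum_Sn; unfold plus; simpl; specialize (H (S n)); lra.
- intros n.
  assert (sum_n u n <= v O - v (S n)).
  { induction n as [|n IH]; [rewrite sum_O; apply H|].
    rewrite sum_Sn; unfold plus; simpl; specialize (H (S n)); lra. }
  eapply Rle_trans; [exact H0|specialize (Hv (S n)); lra].
Qed.

Definition one (_ : nat) : R := 1.

(* [Li harm k q] is the sum over [n >= 1] of [H_(n-1) * q ^ n / n ^ k]. *)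
Fixpoint harm (n : nat) : R :=
  match n with O => 0 | S m => harm m + / INR (S m) end.

Lemma harm_S (n : nat) : harm (S n) = harm n + / INR (S n).
Proof. reflexivity. Qed.

Lemma harm_pos (n : nat) : 0 <= harm n.
Proof.
induction n as [|n IH]; [simpl; lra|rewrite harm_S].
pose proof (INR_S_ge_1 n); assert (0 < / INR (S n)) by (apply Rinv_0_lt_compat; lra); lra.
Qed.

Lemma sublinear_one : sublinear one.
Proof. intros n; unfold one; rewrite Rabs_R1; apply INR_S_ge_1. Qed.

Lemma sublinear_harm : sublinear harm.
Proof.
intros n; rewrite (Rabs_pos_eq _ (harm_pos n)).
induction n as [|n IH]; [simpl; lra|rewrite harm_S].
pose proof (INR_S_ge_1 n).
assert (/ INR (S n) <= 1) by (rewrite <- Rinv_1; apply Rinv_le_contravar; lra).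
rewrite (S_INR (S n)); lra.
Qed.

Lemma summable2_one : summable2 one.
Proof.
apply (ex_series_telescope _ (fun n => 2 / INR (S n))); intros n; pose proof (INR_S_ge_1 n).
- split; [apply weight_div_pos|].
  unfold one; rewrite Rabs_R1, (S_INR (S n)).
  apply Rminus_le_0.
  replace (2 / INR (S n) - 2 / (INR (S n) + 1) - 1 / INR (S n) ^ 2)
    with ((INR (S n) - 1) / (INR (S n) ^ 2 * (INR (S n) + 1))) by (field; lra).
  apply Rdiv_le_0_compat; [lra|].
  apply Rmult_lt_0_compat; [apply pow_lt|]; lra.
- apply Rdiv_le_0_compat; lra.
Qed.

(** The tail of the sum of (ln n) / n ^ 2 has size (ln n + 1) / n, which suggests the telescoping
    majorant; its constants leave enough slack for the difference to have the visibly nonnegative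
    numerator H (n - 1) + 2 n. *)
Lemma summable2_harm : summable2 harm.
Proof.
apply (ex_series_telescope _ (fun n => 2 * (harm n + 2) / INR (S n))); intros n;
  pose proof (INR_S_ge_1 n); pose proof (harm_pos n).
- split; [apply weight_div_pos|].
  rewrite Rabs_pos_eq by assumption; rewrite harm_S, (S_INR (S n)).
  apply Rminus_le_0.
  replace (2 * (harm n + 2) / INR (S n) - 2 * (harm n + / INR (S n) + 2) / (INR (S n) + 1) - harm n / INR (S n) ^ 2)
    with ((harm n * (INR (S n) - 1) + 2 * INR (S n)) / (INR (S n) ^ 2 * (INR (S n) + 1))) by (field; lra).
  apply Rdiv_le_0_compat; [nra|].
  apply Rmult_lt_0_compat; [apply pow_lt|]; lra.
- apply Rdiv_le_0_compat; lra.
Qed.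

Lemma CSeries_incr_1 (a : nat -> C) (M : nat -> R) :
  (forall n, Cmod (a n) <= M n) -> ex_series M ->
  CSeries a = (a O + CSeries (fun n => a (S n)))%C.
Proof.
intros H HM; apply C_eq; simpl; apply Series_incr_1; eauto using ex_series_Re, ex_series_Im.
Qed.

Lemma one_minus_neq_0 (q : C) : Cmod q < 1 -> (1 - q)%C <> 0%C.
Proof.
intros H E.
assert (q = 1%C) by (rewrite <- (Cplus_0_r q), <- E; ring).
subst q; rewrite Cmod_1 in H; lra.
Qed.

Lemma Li_0_term_le (c : nat -> R) (q : C) (r : R) (n : nat) :
  Cmod q <= r -> r <= 1 ->
  Cmod (RtoC (c n / INR (S n) ^ 0) * q ^ S n)%C <= Rabs (c n) / INR (S n) ^ 0 * r ^ n.
Proof.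
intros Hq Hr; rewrite Cmod_Li_term.
pose proof (weight_div_pos c 0 n); pose proof (Cmod_ge_0 q).
assert (Cmod q ^ n <= r ^ n) by (apply pow_incr; lra).
pose proof (pow_le (Cmod q) n (Cmod_ge_0 q)).
apply Rmult_le_compat_l; auto; simpl; nra.
Qed.

Lemma lt_1_between (q : C) : Cmod q < 1 -> exists r, 0 < r < 1 /\ Cmod q <= r.
Proof. intros H; pose proof (Cmod_ge_0 q); exists ((1 + Cmod q) / 2); lra. Qed.

(** Splitting off the first term gives the equation X = q + q X for the geometric series. *)
Lemma Li_one_0 (q : C) : Cmod q < 1 -> Li one 0 q = (q / (1 - q))%C.
Proof.
intros Hq; pose proof (one_minus_neq_0 q Hq) as H0.
destruct (lt_1_between q Hq) as [r [Hr Hqr]].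
pose proof (ex_series_weight_pow one 0 r sublinear_one Hr) as Hs.
assert (E : Li one 0 q = (q + q * Li one 0 q)%C).
{ unfold Li at 1.
  rewrite (CSeries_incr_1 _ _ (fun n => Li_0_term_le one q r n Hqr (Rlt_le _ _ (proj2 Hr))) Hs).
  unfold Li; rewrite <- (CSeries_scal q _ _ (fun n => Li_0_term_le one q r n Hqr (Rlt_le _ _ (proj2 Hr))) Hs).
  unfold one; f_equal.
  - rewrite pow_O, Cpow_1_r; unfold Rdiv; rewrite Rinv_1, Rmult_1_r; ring.
  - apply CSeries_ext; intros n; rewrite !pow_O, (Cpow_S q (S n)); ring. }
assert (E2 : (Li one 0 q * (1 - q) = q)%C).
{ transitivity (Li one 0 q - q * Li one 0 q)%C; [ring|rewrite E at 1; ring]. }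
rewrite <- E2 at 2; field; exact H0.
Qed.

(** The step H_n = H_(n-1) + 1 / n turns the shift of the series into X = q (X + [Li one 1 q]); the
    first term vanishes because [harm 0] is 0. *)
Lemma Li_harm_0 (q : C) : Cmod q < 1 -> Li harm 0 q = (Li one 1 q * (q / (1 - q)))%C.
Proof.
intros Hq; pose proof (one_minus_neq_0 q Hq) as H0.
destruct (lt_1_between q Hq) as [r [Hr Hqr]].
pose proof (ex_series_weight_pow harm 0 r sublinear_harm Hr) as Hs.
assert (H1 : forall n, Cmod (RtoC (one n / INR (S n) ^ 1) * q ^ S n)%C <= Cmod q * Cmod q ^ n).
{ intros n; apply Li_term_le1; [lia|apply sublinear_one]. }
assert (H1s : ex_series (fun n => Cmod q * Cmod q ^ n)).
{ apply ex_series_Rmult_l, ex_series_geom_R; pose proof (Cmod_ge_0 q); lra. }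
pose proof (fun n => Li_0_term_le harm q r n Hqr (Rlt_le _ _ (proj2 Hr))) as H2.
assert (E : Li harm 0 q = (q * (Li harm 0 q + Li one 1 q))%C).
{ unfold Li at 1; rewrite (CSeries_incr_1 _ _ H2 Hs).
  unfold Li; rewrite <- (CSeries_plus _ _ _ _ H2 Hs H1 H1s).
  rewrite <- (CSeries_scal q _ (fun n => Rabs (harm n) / INR (S n) ^ 0 * r ^ n + Cmod q * Cmod q ^ n)).
  - transitivity (0 + CSeries (fun n => RtoC (harm (S n) / INR (S (S n)) ^ 0) * q ^ S (S n)))%C.
    + f_equal; change (harm 0) with 0; unfold Rdiv; rewrite Rmult_0_l; ring.
    + rewrite Cplus_0_l; apply CSeries_ext; intros n.
      rewrite !pow_O, pow_1, (Cpow_S q (S n)), harm_S; unfold one.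
      unfold Rdiv; rewrite Rinv_1, !Rmult_1_r, Rmult_1_l, RtoC_plus; ring.
  - intros n; eapply Rle_trans; [apply Cmod_triangle|apply Rplus_le_compat; auto].
  - apply (ex_series_plus (V := R_NormedModule)); assumption. }
assert (E2 : (Li harm 0 q * (1 - q) = q * Li one 1 q)%C).
{ transitivity (Li harm 0 q - q * Li harm 0 q)%C; [ring|rewrite E at 1; ring]. }
replace (Li one 1 q * (q / (1 - q)))%C with (q * Li one 1 q / (1 - q))%C by (field; exact H0).
rewrite <- E2; field; exact H0.
Qed.

(** The device behind the functional identities below: equal derivatives along a curve, and equal
    limits at its left end. *)
Lemma Cder_unique (F G g : R -> C) (a b : R) :
  a < b ->
  (forall x, a < x < b -> Cder F x (g x)) -> (forall x, a < x < b -> Cder G x (g x)) ->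
  Clim (fun x => F x - G x)%C (at_right a) 0 ->
  forall x, a < x < b -> F x = G x.
Proof.
intros Hab HF HG Hl x Hx.
assert (HD : forall y, a < y < b -> Cder (fun x => F x - G x)%C y 0).
{ intros y Hy; eapply Cder_eq; [apply Cder_minus; auto|ring]. }
destruct Hl as [Hl1 Hl2].
assert (E : forall f : R -> R, (forall y, a < y < b -> is_derive f y 0) ->
  filterlim f (at_right a) (locally 0) -> f x = 0).
{ intros f Hf Hlf; apply (filterlim_locally_unique (F := at_right a) f); auto.
  apply filterlim_ext_loc with (fun _ => f x); [|apply filterlim_const].
  generalize (at_right_lt a b Hab); apply filter_imp; intros y Hy.
  apply (is_derive_zero_const f a b); auto. }
apply C_eq; apply Rminus_diag_uniq.
- apply (E (fun y => Re (F y - G y)%C)); [intros y Hy; apply (HD y Hy)|exact Hl1].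
- apply (E (fun y => Im (F y - G y)%C)); [intros y Hy; apply (HD y Hy)|exact Hl2].
Qed.

Lemma Cder_RtoC (f : R -> R) (x l : R) : is_derive f x l -> Cder (fun y => RtoC (f y)) x (RtoC l).
Proof. intros H; split; [exact H|change (is_derive (fun _ : R => 0) x 0); apply (is_derive_const (V := R_NormedModule))]. Qed.

Lemma Clim_RtoC {T : Type} {F : (T -> Prop) -> Prop} {FF : Filter F} (f : T -> R) (l : R) :
  filterlim f F (locally l) -> Clim (fun y => RtoC (f y)) F (RtoC l).
Proof. intros H; split; [exact H|apply filterlim_const]. Qed.

Lemma Cder_radial (q0 : C) (x : R) : Cder (fun y => RtoC y * q0)%C x q0.
Proof.
eapply Cder_eq; [apply Cder_mult; [apply Cder_RtoC, is_derive_id|apply Cder_const]|].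
unfold one; simpl; change (Hierarchy.one : R) with 1; ring.
Qed.

Lemma Cmod_radial (q0 : C) (y : R) : 0 <= y -> Cmod (RtoC y * q0)%C = y * Cmod q0.
Proof. intros H; rewrite Cmod_mult, Cmod_R, Rabs_pos_eq; auto. Qed.

Lemma Li_der_radial (c : nat -> R) (k : nat) (q0 : C) (b x : R) :
  sublinear c -> 0 < x < b -> b * Cmod q0 < 1 ->
  Cder (fun y => Li c (S k) (RtoC y * q0)) x (RtoC (/ x) * Li c k (RtoC x * q0))%C.
Proof.
intros Hc Hx Hb.
assert (Hr : exists r, 0 < r < 1 /\ b * Cmod q0 <= r).
{ pose proof (Cmod_ge_0 q0); assert (0 <= b * Cmod q0) by nra.
  exists ((1 + b * Cmod q0) / 2); lra. }
destruct Hr as [r [Hr Hbr]].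
apply (Li_der c k (fun y => RtoC y * q0)%C (fun _ => q0) _ 0 b x (Cmod q0) r); auto.
- lra.
- apply ex_series_weight_pow; auto.
- intros y Hy; apply Cder_radial.
- intros y Hy; lra.
- intros y Hy; rewrite Cmod_radial by lra; pose proof (Cmod_ge_0 q0); nra.
- rewrite Cmult_assoc, <- RtoC_mult, Rinv_l by lra; ring.
Qed.

Lemma filterlim_id_at_right (a : R) : filterlim (fun y : R => y) (at_right a) (locally a).
Proof.
intros P [d Hd]; exists d; intros y Hy _; apply Hd, Hy.
Qed.

Lemma filterlim_id_at_left (a : R) : filterlim (fun y : R => y) (at_left a) (locally a).
Proof.
intros P [d Hd]; exists d; intros y Hy _; apply Hd, Hy.
Qed.

Lemma Li_radial_lim0 (c : nat -> R) (q0 : C) :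
  sublinear c -> Cmod q0 <= 1 -> Clim (fun y => Li c 1 (RtoC y * q0)) (at_right 0) 0.
Proof.
intros Hc Hq; apply (Clim_zero_of_le _ (fun y => 4 * y)).
- assert (H : 0 < / 2) by lra.
  generalize (at_right_lt 0 (/ 2) H); apply filter_imp; intros y Hy.
  assert (Hm : Cmod (RtoC y * q0)%C <= y).
  { rewrite Cmod_radial by lra; pose proof (Cmod_ge_0 q0); nra. }
  eapply Rle_trans; [apply Cmod_Li_le1; auto; lra|].
  set (m := Cmod (RtoC y * q0)%C) in *.
  assert (0 <= m) by apply Cmod_ge_0.
  assert (m / (1 - m) <= 2 * m).
  { apply Rmult_le_reg_r with (1 - m); [lra|].
    unfold Rdiv; rewrite Rmult_assoc, Rinv_l by lra; nra. }
  lra.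
- apply filterlim_scal_zero, filterlim_id_at_right.
Qed.

(** An identity at q is read off at y = 1 on the ray y q; with b > 1 the point 1 is interior to the
    parameter interval while the ray stays inside the disk. *)
Lemma radial_bound (q0 : C) : Cmod q0 < 1 -> exists b, 1 < b /\ b * Cmod q0 < 1.
Proof.
intros H; pose proof (Cmod_ge_0 q0).
exists (2 / (1 + Cmod q0)); split.
- apply Rmult_lt_reg_r with (1 + Cmod q0); [lra|].
  unfold Rdiv; rewrite Rmult_assoc, Rinv_l by lra; lra.
- apply Rmult_lt_reg_r with (1 + Cmod q0); [lra|].
  replace (2 / (1 + Cmod q0) * Cmod q0 * (1 + Cmod q0)) with (2 * Cmod q0) by (field; lra); lra.
Qed.

(** Along the ray both sides tend to 0 and have logarithmic derivative [Li one 1] times q / (1 - q),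
    on the left by [Li_harm_0] and on the right by [Li_one_0]. *)
Lemma Li_harm_1 (q : C) : Cmod q < 1 -> Li harm 1 q = (/ 2 * Li one 1 q ^ 2)%C.
Proof.
intros Hq; destruct (radial_bound q Hq) as [b [Hb Hbq]].
pose proof (Cmod_ge_0 q).
rewrite <- (Cmult_1_l q).
apply (Cder_unique (fun y => Li harm 1 (RtoC y * q)) (fun y => / 2 * Li one 1 (RtoC y * q) ^ 2)%C
  (fun y => RtoC (/ y) * Li harm 0 (RtoC y * q))%C 0 b); try lra.
- intros x Hx; apply Li_der_radial with b; auto using sublinear_harm.
- intros x Hx; eapply Cder_eq;
    [apply Cder_scal, Cder_pow, (Li_der_radial one 0 q b x); auto using sublinear_one|].
  assert (Hm : Cmod (RtoC x * q)%C < 1) by (rewrite Cmod_radial by lra; nra).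
  rewrite Li_harm_0, Li_one_0, Cpow_1_r by exact Hm.
  simpl (INR 2); pose proof (one_minus_neq_0 _ Hm).
  replace (RtoC (1 + 1)) with (RtoC 2) by (f_equal; ring).
  field; auto.
- assert (Hq1 : Cmod q <= 1) by lra.
  eapply Clim_eq; [apply Clim_minus; [apply Li_radial_lim0; auto using sublinear_harm
    |apply Clim_mult; [apply Clim_const|apply Clim_pow, Li_radial_lim0; auto using sublinear_one]]|].
  simpl; ring.
Qed.

(** * Boundary values on the unit circle *)

(** On the unit circle the derivative of the order 2 series is a series of order 1, which no
    summable majorant dominates. It is reached as a limit over radii r < 1 instead, for which
    uniform convergence of the derivatives is needed; the mean value theorem does the rest. *)
Lemma is_derive_lim (f g : nat -> R -> R) (F G : R -> R) (e : nat -> R) (a b x : R) :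
  a < x < b ->
  (forall n y, a < y < b -> is_derive (f n) y (g n y)) ->
  (forall y, a < y < b -> is_lim_seq (fun n => f n y) (F y)) ->
  (forall n y, a < y < b -> Rabs (g n y - G y) <= e n) ->
  is_lim_seq e 0 -> continuity_pt G x -> is_derive F x (G x).
Proof.
intros Hx Hd Hl He He0 Hc.
apply is_derive_Reals; intros eps Heps.
assert (Heps2 : 0 < eps / 2) by lra.
destruct (Hc (eps / 2) Heps2) as [d [Hd0 Hd1]].
set (d' := Rmin (Rmin (x - a) (b - x)) d).
assert (Hd' : 0 < d') by (unfold d'; repeat apply Rmin_pos; lra).
exists (mkposreal _ Hd'); intros h Hh0 Hh; simpl in Hh.
assert (Hin : forall y, Rmin x (x + h) <= y <= Rmax x (x + h) -> a < y < b /\ Rabs (G y - G x) < eps / 2).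
{ intros y Hy.
  assert (Hyx : Rabs (y - x) <= Rabs h).
  { unfold Rmin, Rmax in Hy; destruct (Rle_dec x (x + h)); unfold Rabs;
      destruct (Rcase_abs (y - x)), (Rcase_abs h); lra. }
  assert (Hyd : Rabs (y - x) < d') by lra.
  unfold d' in Hyd.
  pose proof (Rmin_l (Rmin (x - a) (b - x)) d); pose proof (Rmin_r (Rmin (x - a) (b - x)) d).
  pose proof (Rmin_l (x - a) (b - x)); pose proof (Rmin_r (x - a) (b - x)).
  split; [assert (Hy2 : Rabs (y - x) < Rmin (x - a) (b - x)) by lra; apply Rabs_def2 in Hy2; lra|].
  destruct (Req_dec y x) as [->|Hne]; [rewrite Rminus_diag, Rabs_R0; lra|].
  apply (Hd1 y); split; [split; [exact I|auto]|].
  simpl; unfold Rdist; lra. }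
assert (Hxin : a < x + h < b).
{ apply Hin; split; [apply Rmin_r|apply Rmax_r]. }
assert (Hn : forall n, Rabs (f n (x + h) - f n x - G x * h) <= (e n + eps / 2) * Rabs h).
{ intros n.
  destruct (MVT_gen (f n) x (x + h) (g n)) as [c [Hc1 Hc2]].
  - intros y Hy; apply Hd, Hin; lra.
  - intros y Hy; apply continuity_pt_filterlim, (ex_derive_continuous (f n)).
    exists (g n y); apply Hd, Hin, Hy.
  - rewrite Hc2; replace (g n c * (x + h - x) - G x * h) with ((g n c - G c + (G c - G x)) * h) by ring.
    rewrite Rabs_mult; apply Rmult_le_compat_r; [apply Rabs_pos|].
    eapply Rle_trans; [apply Rabs_triang|].
    destruct (Hin c Hc1) as [Hc3 Hc4].
    specialize (He n c Hc3); lra. }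
assert (HF : Rabs (F (x + h) - F x - G x * h) <= (0 + eps / 2) * Rabs h).
{ apply (is_lim_seq_le (fun n => Rabs (f n (x + h) - f n x - G x * h))
    (fun n => (e n + eps / 2) * Rabs h) (Rabs (F (x + h) - F x - G x * h)) ((0 + eps / 2) * Rabs h)); auto.
  - apply (is_lim_seq_abs _ (Finite (F (x + h) - F x - G x * h))).
    apply is_lim_seq_minus'; [apply is_lim_seq_minus'; auto|apply is_lim_seq_const].
  - apply (is_lim_seq_scal_r _ (Rabs h) (Finite (0 + eps / 2))).
    apply is_lim_seq_plus'; [auto|apply is_lim_seq_const]. }
assert (Hhp : 0 < Rabs h) by (apply Rabs_pos_lt; auto).
replace ((F (x + h) - F x) / h - G x) with ((F (x + h) - F x - G x * h) / h) by (field; auto).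
unfold Rdiv; rewrite Rabs_mult, Rabs_inv.
apply Rmult_lt_reg_r with (Rabs h); auto.
rewrite Rmult_assoc, Rinv_l by lra; nra.
Qed.

Lemma Cder_lim (f g : nat -> R -> C) (F G : R -> C) (e : nat -> R) (a b x : R) :
  a < x < b ->
  (forall n y, a < y < b -> Cder (f n) y (g n y)) ->
  (forall y, a < y < b -> Clim (fun n => f n y) eventually (F y)) ->
  (forall n y, a < y < b -> Cmod (g n y - G y)%C <= e n) ->
  is_lim_seq e 0 ->
  continuity_pt (fun y => Re (G y)) x -> continuity_pt (fun y => Im (G y)) x ->
  Cder F x (G x).
Proof.
intros Hx Hd Hl He He0 H1 H2; split.
- apply (is_derive_lim (fun n y => Re (f n y)) (fun n y => Re (g n y)) _ (fun y => Re (G y)) e a b); auto.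
  + intros n y Hy; apply (Hd n y Hy).
  + intros y Hy; apply (Hl y Hy).
  + intros n y Hy; eapply Rle_trans; [apply (re_le_Cmod (g n y - G y))|auto].
- apply (is_derive_lim (fun n y => Im (f n y)) (fun n y => Im (g n y)) _ (fun y => Im (G y)) e a b); auto.
  + intros n y Hy; apply (Hd n y Hy).
  + intros y Hy; apply (Hl y Hy).
  + intros n y Hy; eapply Rle_trans; [apply (im_le_Cmod (g n y - G y))|auto].
Qed.

Definition cis (x : R) : C := (cos x, sin x).

Lemma Cmod_cis (x : R) : Cmod (cis x) = 1.
Proof.
unfold Cmod, cis; simpl fst; simpl snd.
replace (cos x ^ 2 + sin x ^ 2) with 1; [apply sqrt_1|].
pose proof (sin2_cos2 x); unfold Rsqr in *; lra.
Qed.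

Lemma cis_plus (x y : R) : cis (x + y) = (cis x * cis y)%C.
Proof. apply C_eq; unfold cis; simpl; rewrite ?cos_plus, ?sin_plus; ring. Qed.

Lemma Cder_cis (a e x : R) : Cder (fun y => cis (a + e * y)) x (RtoC e * Ci * cis (a + e * x))%C.
Proof.
split; unfold cis; simpl; auto_derive; auto; ring.
Qed.

Lemma filterlim_at_right_of_continuous (f : R -> R) (a : R) :
  continuous f a -> filterlim f (at_right a) (locally (f a)).
Proof. intros H; eapply filterlim_filter_le_1; [|exact H]; apply filter_le_within. Qed.

Lemma filterlim_at_left_of_continuous (f : R -> R) (a : R) :
  continuous f a -> filterlim f (at_left a) (locally (f a)).
Proof. intros H; eapply filterlim_filter_le_1; [|exact H]; apply filter_le_within. Qed.

Lemma polar_denominator_pos (r x : R) : 0 <= r < 1 -> 0 < 1 - 2 * r * cos x + r ^ 2 /\ 0 < 1 - r * cos x.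
Proof.
intros H; pose proof (COS_bound x); nra.
Qed.

(** This is - ln (1 - q) in polar form. Since 1 - r cos x > 0, the argument is given by [atan]
    without any branch correction; both sides have derivative cis x / (1 - y cis x) in the radius y
    and vanish at y = 0. *)
Lemma Li_one_1_polar (r x : R) : 0 < r < 1 ->
  Li one 1 (RtoC r * cis x) =
  (- / 2 * ln (1 - 2 * r * cos x + r ^ 2), atan (r * sin x / (1 - r * cos x))).
Proof.
intros Hr.
set (b := (1 + r) / 2).
assert (Hb : r < b < 1) by (unfold b; lra).
apply (Cder_unique (fun y => Li one 1 (RtoC y * cis x))
  (fun y => (- / 2 * ln (1 - 2 * y * cos x + y ^ 2), atan (y * sin x / (1 - y * cos x))))
  (fun y => RtoC (/ y) * Li one 0 (RtoC y * cis x))%C 0 b); try lra.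
- intros y Hy; apply Li_der_radial with b; auto using sublinear_one.
  rewrite Cmod_cis; lra.
- intros y Hy.
  assert (Hm : Cmod (RtoC y * cis x)%C < 1) by (rewrite Cmod_radial, Cmod_cis by lra; lra).
  assert (Hy1 : 0 <= y < 1) by lra.
  destruct (polar_denominator_pos y x Hy1) as [HD H1].
  pose proof (one_minus_neq_0 _ Hm) as H0.
  assert (Hcs : cos x ^ 2 + sin x ^ 2 = 1) by (pose proof (sin2_cos2 x); unfold Rsqr in *; lra).
  apply Cder_eq with ((cos x - y) / (1 - 2 * y * cos x + y ^ 2), sin x / (1 - 2 * y * cos x + y ^ 2)).
  + split; simpl.
    * auto_derive; [lra|]; field; simpl in HD; lra.
    * auto_derive; [lra|].
      assert (0 < (1 - y * cos x) ^ 2 + (y * sin x) ^ 2) by (assert (0 < (1 - y * cos x) ^ 2) by (apply pow_lt; lra); nra).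
      replace (1 - 2 * y * cos x + y * (y * 1)) with ((1 - y * cos x) ^ 2 + (y * sin x) ^ 2) by nra.
      unfold Rsqr; field; split; [lra|].
      replace ((1 - y * cos x) * (1 - y * cos x) + y * sin x * (y * sin x)) with ((1 - y * cos x) ^ 2 + (y * sin x) ^ 2) by ring.
      lra.
  + rewrite Li_one_0 by exact Hm.
    assert (Hy0 : RtoC y <> 0%C) by (intros E; apply RtoC_inj in E; lra).
    replace (RtoC (/ y) * (RtoC y * cis x / (1 - RtoC y * cis x)))%C with (cis x / (1 - RtoC y * cis x))%C
      by (rewrite RtoC_inv by lra; field; auto).
    match goal with |- ?v = _ => set (u := v : C) end.
    assert (E : (u * (1 - RtoC y * cis x))%C = cis x).
    { unfold u; apply C_eq; simpl.
      - field_simplify; [|simpl in HD; lra]. 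
        replace (sin x ^ 2) with (1 - cos x ^ 2) by lra; field; simpl in HD; lra.
      - field; simpl in HD; lra. }
    change (u = (cis x / (1 - RtoC y * cis x))%C).
    rewrite <- E at 1; field; exact H0.
- eapply Clim_eq; [apply (Clim_minus _ _ 0 (- / 2 * ln (1 - 2 * 0 * cos x + 0 * (0 * 1)), atan (0 * sin x / (1 - 0 * cos x)))); [apply Li_radial_lim0; auto using sublinear_one; rewrite Cmod_cis; lra|]|].
  + split; simpl.
    * apply (filterlim_at_right_of_continuous (fun y => - / 2 * ln (1 - 2 * y * cos x + y * (y * 1)))).
      apply (ex_derive_continuous (fun y => - / 2 * ln (1 - 2 * y * cos x + y * (y * 1)))).
      auto_derive; lra.
    * apply (filterlim_at_right_of_continuous (fun y => atan (y * sin x / (1 - y * cos x)))).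
      apply (ex_derive_continuous (fun y => atan (y * sin x / (1 - y * cos x)))).
      auto_derive; lra.
  + apply C_eq; simpl.
    * replace (1 - 2 * 0 * cos x + 0 * (0 * 1)) with 1 by ring; rewrite ln_1; ring.
    * replace (0 * sin x / (1 - 0 * cos x)) with 0 by field; rewrite atan_0; ring.
Qed.

Lemma ln_lipschitz (m x y : R) : 0 < m -> m <= x -> m <= y -> Rabs (ln x - ln y) <= Rabs (x - y) / m.
Proof.
intros Hm.
assert (H : forall x y, m <= x -> m <= y -> ln x - ln y <= Rabs (x - y) / m).
{ clear x y; intros x y Hx Hy; rewrite <- ln_div by lra.
  assert (Hp : 0 < x / y) by (apply Rdiv_lt_0_compat; lra).
  pose proof (exp_ineq1_le (ln (x / y))) as H; rewrite exp_ln in H by exact Hp.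
  apply Rle_trans with ((x - y) / y); [replace ((x - y) / y) with (x / y - 1) by (field; lra); lra|].
  unfold Rdiv; apply Rle_trans with (Rabs (x - y) * / y).
  - apply Rmult_le_compat_r; [left; apply Rinv_0_lt_compat; lra|apply Rle_abs].
  - apply Rmult_le_compat_l; [apply Rabs_pos|apply Rinv_le_contravar; lra]. }
intros Hx Hy; apply Rabs_le; split.
- pose proof (H y x Hy Hx) as H1; rewrite Rabs_minus_sym in H1; lra.
- apply H; auto.
Qed.

Lemma atan_lipschitz (x y : R) : Rabs (atan x - atan y) <= Rabs (x - y).
Proof.
destruct (MVT_gen atan y x (fun z => / (1 + z ^ 2))) as [c [_ Hc]].
- intros z _; auto_derive; auto; unfold Rsqr; field; nra.
- intros z _; apply continuity_pt_filterlim, (ex_derive_continuous atan).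
  auto_derive; auto.
- rewrite Hc, Rabs_mult.
  apply Rle_trans with (1 * Rabs (x - y)); [|lra].
  apply Rmult_le_compat_r; [apply Rabs_pos|].
  rewrite Rabs_pos_eq.
  + rewrite <- Rinv_1; apply Rinv_le_contravar; nra.
  + left; apply Rinv_0_lt_compat; nra.
Qed.

Definition lsin (x : R) : R := ln (2 * sin (x / 2)).

(* The boundary value of [- ln (1 - z)] at [z = cis x], for [0 < x < 2 PI]. *)
Definition bdlog (x : R) : C := (- lsin x, (PI - x) / 2).

Lemma sin_half_pos (x : R) : 0 < x < 2 * PI -> 0 < sin (x / 2).
Proof. intros H; apply sin_gt_0; lra. Qed.

Lemma lsin_cos (x : R) : 0 < x < 2 * PI -> lsin x = / 2 * ln (2 - 2 * cos x).
Proof.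
intros H; pose proof (sin_half_pos x H) as Hs; unfold lsin.
replace (2 - 2 * cos x) with ((2 * sin (x / 2)) * (2 * sin (x / 2))).
- rewrite (ln_mult (2 * sin (x / 2)) (2 * sin (x / 2))) by lra; field.
- replace x with (2 * (x / 2)) at 3 by field; rewrite cos_2a_sin; ring.
Qed.

(** By half angles sin x / (1 - cos x) = cot (x / 2), and the complementary angle (PI - x) / 2 lies
    in the range of [atan]. *)
Lemma bdlog_atan (x : R) : 0 < x < 2 * PI -> (PI - x) / 2 = atan (sin x / (1 - cos x)).
Proof.
intros H; pose proof (sin_half_pos x H) as Hs.
rewrite <- (atan_tan ((PI - x) / 2)) by lra; f_equal.
replace x with (2 * (x / 2)) at 2 3 by field; rewrite sin_2a, cos_2a_sin.
unfold tan; replace ((PI - x) / 2) with (PI / 2 - x / 2) by field.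
rewrite sin_shift, cos_shift; field; split; nra.
Qed.

(** Abel's limit with a linear rate, uniform in the angle away from 0, where the logarithm is
    singular. *)
Lemma Li_one_1_boundary (d : R) : 0 < d < PI -> exists K, 0 <= K /\
  forall r x, / 2 <= r < 1 -> d < x < PI ->
  Cmod (Li one 1 (RtoC r * cis x) - bdlog x)%C <= K * (1 - r).
Proof.
intros Hd; set (m := 1 - cos d).
assert (Hm : 0 < m <= 2).
{ unfold m; pose proof (COS_bound d).
  assert (cos d < cos 0) by (apply cos_decreasing_1; lra); rewrite cos_0 in *; lra. }
assert (Hi : 0 < / m) by (apply Rinv_0_lt_compat; lra).
(* The first summand bounds the real part: for r at least 1 / 2 the arguments of both [ln] are at
   least m, and they differ by at most 4 (1 - r). The second bounds the imaginary part: the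
   denominators 1 - r cos x and 1 - cos x are at least m / 2 and m. *)
exists (2 / m + 2 / m ^ 2); split.
{ apply Rplus_le_le_0_compat; apply Rdiv_le_0_compat; try apply pow_lt; lra. }
intros r x Hr Hx.
assert (Hr2 : 0 < r < 1) by lra.
assert (Hx2 : 0 < x < 2 * PI) by lra.
assert (Hc : cos x <= 1 - m).
{ unfold m; assert (cos x < cos d) by (apply cos_decreasing_1; lra); lra. }
pose proof (COS_bound x) as Hcb; pose proof (SIN_bound x) as Hsb.
rewrite (Li_one_1_polar r x Hr2).
eapply Rle_trans; [apply Cmod_le_Re_Im|].
unfold bdlog; rewrite (lsin_cos x Hx2), (bdlog_atan x Hx2).
cbn [Re Im fst snd Cminus Cplus Copp].
rewrite Rmult_plus_distr_r; apply Rplus_le_compat.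
- replace (- / 2 * ln (1 - 2 * r * cos x + r ^ 2) + - - (/ 2 * ln (2 - 2 * cos x)))
    with (/ 2 * (ln (2 - 2 * cos x) - ln (1 - 2 * r * cos x + r ^ 2))) by ring.
  rewrite Rabs_mult, (Rabs_pos_eq (/ 2)) by lra.
  assert (HL : Rabs (ln (2 - 2 * cos x) - ln (1 - 2 * r * cos x + r ^ 2)) <=
    Rabs (2 - 2 * cos x - (1 - 2 * r * cos x + r ^ 2)) / m) by (apply ln_lipschitz; nra).
  assert (HB : Rabs (2 - 2 * cos x - (1 - 2 * r * cos x + r ^ 2)) <= 4 * (1 - r)).
  { replace (2 - 2 * cos x - (1 - 2 * r * cos x + r ^ 2)) with ((1 - r) * (1 + r - 2 * cos x)) by ring.
    apply Rabs_le; nra. }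
  assert (Rabs (2 - 2 * cos x - (1 - 2 * r * cos x + r ^ 2)) / m <= 4 * (1 - r) / m)
    by (apply Rmult_le_compat_r; lra).
  replace (2 / m * (1 - r)) with (/ 2 * (4 * (1 - r) / m)) by (field; lra).
  lra.
- eapply Rle_trans; [apply atan_lipschitz|].
  assert (H1 : m / 2 <= 1 - r * cos x) by nra.
  replace (r * sin x / (1 - r * cos x) - sin x / (1 - cos x))
    with ((1 - r) * (- sin x) * (/ (1 - r * cos x) * / (1 - cos x))) by (field; lra).
  assert (H2 : 0 < / (1 - r * cos x) <= 2 / m).
  { split; [apply Rinv_0_lt_compat; lra|].
    replace (2 / m) with (/ (m / 2)) by (field; lra); apply Rinv_le_contravar; lra. }
  assert (H3 : 0 < / (1 - cos x) <= / m).
  { split; [apply Rinv_0_lt_compat; lra|apply Rinv_le_contravar; lra]. }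
  rewrite !Rabs_mult, (Rabs_pos_eq (1 - r)), (Rabs_pos_eq (/ _)), (Rabs_pos_eq (/ (1 - cos x))) by lra.
  assert (H4 : Rabs (- sin x) <= 1) by (apply Rabs_le; lra).
  assert (H5 : / (1 - r * cos x) * / (1 - cos x) <= 2 / m * / m) by (apply Rmult_le_compat; lra).
  assert (H6 : 0 < / (1 - r * cos x) * / (1 - cos x)) by nra.
  replace (2 / m ^ 2 * (1 - r)) with ((1 - r) * 1 * (2 / m * / m)) by (field; lra).
  apply Rmult_le_compat; [apply Rmult_le_pos; [lra|apply Rabs_pos]|lra| |exact H5].
  apply Rmult_le_compat_l; lra.
Qed.

Lemma bdlog_bounded (d : R) : 0 < d < PI -> exists K, forall x, d < x < PI -> Cmod (bdlog x) <= K.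
Proof.
intros Hd; exists (Rabs (lsin d) + ln 2 + PI); intros x Hx.
eapply Rle_trans; [apply Cmod_le_Re_Im|]; unfold bdlog; simpl.
assert (H1 : lsin d <= lsin x <= ln 2).
{ unfold lsin.
  assert (0 < sin (d / 2)) by (apply sin_half_pos; lra).
  assert (sin (d / 2) <= sin (x / 2)) by (apply sin_incr_1; lra).
  pose proof (SIN_bound (x / 2)).
  split; apply ln_le; lra. }
assert (H2 : 0 <= ln 2) by (rewrite <- ln_1; apply ln_le; lra).
rewrite (Rabs_pos_eq ((PI - x) / 2)) by lra; rewrite Rabs_Ropp.
assert (Rabs (lsin x) <= Rabs (lsin d) + ln 2).
{ apply Rabs_le; pose proof (Rle_abs (- lsin d)); rewrite Rabs_Ropp in *.
  pose proof (Rabs_pos (lsin d)); lra. }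
lra.
Qed.

Lemma continuity_pt_lsin (x : R) : 0 < x < 2 * PI -> continuity_pt lsin x.
Proof.
intros H; apply continuity_pt_filterlim, (ex_derive_continuous lsin).
unfold lsin; pose proof (sin_half_pos x H); auto_derive; lra.
Qed.

Lemma is_lim_seq_inv_S : is_lim_seq (fun n => / INR (S (S n))) 0.
Proof.
apply (is_lim_seq_incr_1 (fun n => / INR (S n))), (is_lim_seq_incr_1 (fun n => / INR n)).
replace (Finite 0) with (Rbar_inv p_infty) by reflexivity.
apply is_lim_seq_inv; [apply is_lim_seq_INR|discriminate].
Qed.

(** [P] stands for the boundary value of the order 1 series and is kept abstract because two of them
    are used: [bdlog] for the weights [one], and half its square for [harm]. The circles of radius r
    < 1 provide the approximating functions of [Cder_lim]. *)
Lemma Li_2_circle_der (c : nat -> R) (P : R -> C) (x : R) :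
  summable2 c -> sublinear c -> 0 < x < PI ->
  (forall d, 0 < d < PI -> exists K, 0 <= K /\ forall r y, / 2 <= r < 1 -> d < y < PI ->
     Cmod (Li c 1 (RtoC r * cis y) - P y)%C <= K * (1 - r)) ->
  continuity_pt (fun y => Re (P y)) x -> continuity_pt (fun y => Im (P y)) x ->
  Cder (fun y => Li c 2 (cis y)) x (Ci * P x)%C.
Proof.
intros Hc2 Hc1 Hx HK HP1 HP2.
assert (Hd : 0 < x / 2 < PI) by lra.
destruct (HK _ Hd) as [K [HK0 HK1]].
(* The double successor keeps the radii in [1 / 2, 1), the range covered by the boundary
   estimate. *)
set (r := fun n : nat => 1 - / INR (S (S n))).
assert (Hr : forall n, / 2 <= r n < 1).
{ intros n; unfold r; pose proof (pos_INR n).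
  assert (0 < / INR (S (S n)) <= / 2); [|lra].
  rewrite !S_INR; split; [apply Rinv_0_lt_compat; lra|apply Rinv_le_contravar; lra]. }
apply (Cder_lim (fun n y => Li c 2 (RtoC (r n) * cis y)) (fun n y => Ci * Li c 1 (RtoC (r n) * cis y))%C
  (fun y => Li c 2 (cis y)) (fun y => Ci * P y)%C (fun n => K * (1 - r n)) (x / 2) PI x); try lra.
- intros n y Hy.
  apply (Li_der c 1 (fun y => RtoC (r n) * cis y)%C (fun y => Ci * (RtoC (r n) * cis y))%C Ci (x / 2) PI y 1 (r n)); auto.
  + specialize (Hr n); lra.
  + apply ex_series_weight_pow; auto; specialize (Hr n); lra.
  + intros z Hz; eapply Cder_eq; [apply Cder_scal|].
    * eapply Cder_ext; [|apply (Cder_cis 0 1 z)].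
      intros t; simpl; f_equal; ring.
    * replace (0 + 1 * z) with z by ring; ring.
  + intros z Hz; rewrite Cmod_mult, Cmod_Ci, Cmod_radial, Cmod_cis by (specialize (Hr n); lra).
    specialize (Hr n); lra.
  + intros z Hz; rewrite Cmod_radial, Cmod_cis by (specialize (Hr n); lra); lra.
- intros y Hy; apply Li_lim; auto.
  + apply filter_forall; intros n; rewrite Cmod_radial, Cmod_cis by (specialize (Hr n); lra).
    specialize (Hr n); lra.
  + eapply Clim_eq; [apply Clim_mult; [apply Clim_RtoC|apply Clim_const]|apply Cmult_1_l].
    replace 1 with (1 - 0) by ring.
    apply filterlim_Rminus; [apply filterlim_const|apply is_lim_seq_inv_S].
- intros n y Hy.
  replace (Ci * Li c 1 (RtoC (r n) * cis y) - Ci * P y)%C with (Ci * (Li c 1 (RtoC (r n) * cis y) - P y))%C by ring.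
  rewrite Cmod_mult, Cmod_Ci, Rmult_1_l; auto.
- apply is_lim_seq_ext with (fun n => K * / INR (S (S n))); [intros n; unfold r; ring|].
  replace (Finite 0) with (Rbar_mult K 0) by (simpl; f_equal; ring).
  apply is_lim_seq_scal_l, is_lim_seq_inv_S.
- apply continuity_pt_ext with (fun y => - Im (P y)); [intros y; unfold Re, Im; simpl; ring|].
  apply continuity_pt_opp, HP2.
- apply continuity_pt_ext with (fun y => Re (P y)); [intros y; unfold Re, Im; simpl; ring|].
  exact HP1.
Qed.

Lemma continuity_pt_bdlog (x : R) : 0 < x < PI ->
  continuity_pt (fun y => Re (bdlog y)) x /\ continuity_pt (fun y => Im (bdlog y)) x.
Proof.
intros Hx; split; simpl.
- apply continuity_pt_opp, continuity_pt_lsin; lra.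
- apply continuity_pt_filterlim, (ex_derive_continuous (fun y => (PI - y) / 2)); auto_derive; auto.
Qed.

Lemma Li_one_2_circle_der (x : R) : 0 < x < PI ->
  Cder (fun y => Li one 2 (cis y)) x (Ci * bdlog x)%C.
Proof.
intros Hx; destruct (continuity_pt_bdlog x Hx).
apply Li_2_circle_der; auto using summable2_one, sublinear_one, Li_one_1_boundary.
Qed.

Lemma Li_harm_2_circle_der (x : R) : 0 < x < PI ->
  Cder (fun y => Li harm 2 (cis y)) x (Ci * (/ 2 * bdlog x ^ 2))%C.
Proof.
intros Hx; destruct (continuity_pt_bdlog x Hx) as [H1 H2].
apply (Li_2_circle_der harm (fun y => / 2 * bdlog y ^ 2)%C); auto using summable2_harm, sublinear_harm.
- intros d Hd; destruct (Li_one_1_boundary d Hd) as [K [HK0 HK]].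
  destruct (bdlog_bounded d Hd) as [B HB].
  (* The half squares of u and v differ by (u - v) (v + (u - v) / 2), where |v| is at most B and |u
     - v| at most K (1 - r). *)
  exists (K * (B + K)); split.
  + assert (0 <= B); [|nra].
    eapply Rle_trans; [|apply (HB ((d + PI) / 2)); lra]; apply Cmod_ge_0.
  + intros r y Hr Hy.
    assert (Hm : Cmod (RtoC r * cis y)%C < 1) by (rewrite Cmod_radial, Cmod_cis by lra; lra).
    rewrite (Li_harm_1 _ Hm).
    specialize (HK r y Hr Hy); specialize (HB y Hy).
    set (u := Li one 1 (RtoC r * cis y)) in *; set (v := bdlog y) in *.
    replace (/ 2 * u ^ 2 - / 2 * v ^ 2)%C with ((u - v) * (v + / 2 * (u - v)))%C by (simpl; field; intros E; apply RtoC_inj in E; lra).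
    rewrite Cmod_mult.
    pose proof (Cmod_triangle v (/ 2 * (u - v))%C) as HT.
    rewrite (Cmod_mult (/ 2)%C (u - v)%C), Cmod_inv, Cmod_R, (Rabs_pos_eq 2) in HT by (try lra; intros E; apply RtoC_inj in E; lra).
    pose proof (Cmod_ge_0 (u - v)%C); pose proof (Cmod_ge_0 v); pose proof (Cmod_ge_0 (v + / 2 * (u - v))%C).
    assert (Cmod (v + / 2 * (u - v))%C <= B + K) by nra.
    replace (K * (B + K) * (1 - r)) with (K * (1 - r) * (B + K)) by ring.
    apply Rmult_le_compat; auto.
- apply continuity_pt_ext with (fun y => / 2 * (Re (bdlog y) * Re (bdlog y) - Im (bdlog y) * Im (bdlog y))).
  + intros y; unfold Re, Im; simpl; field.
  + apply continuity_pt_mult; [apply continuity_pt_const; intros ? ?; reflexivity|].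
    apply continuity_pt_minus; apply continuity_pt_mult; auto.
- apply continuity_pt_ext with (fun y => Re (bdlog y) * Im (bdlog y)).
  + intros y; unfold Re, Im; simpl; field.
  + apply continuity_pt_mult; auto.
Qed.

Lemma cnint_eq (f : R -> C) (a b : R) (I J : C) : cnint f a b I -> I = J -> cnint f a b J.
Proof. intros H <-; exact H. Qed.

Lemma Cder_comp_affine (f : R -> C) (a e x : R) (l : C) :
  Cder f (a + e * x) l -> Cder (fun y => f (a + e * y)) x (RtoC e * l)%C.
Proof.
assert (Ha : is_derive (fun y => a + e * y) x e) by (auto_derive; auto; ring).
intros [H1 H2]; split.
- eapply is_derive_eq; [apply (is_derive_comp (fun u => Re (f u)) (fun y => a + e * y)); eauto|].
  unfold scal, Re; simpl; unfold mult; simpl; ring.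
- eapply is_derive_eq; [apply (is_derive_comp (fun u => Im (f u)) (fun y => a + e * y)); eauto|].
  unfold scal, Im; simpl; unfold mult; simpl; ring.
Qed.

Lemma Clim_right_of_Cder (f : R -> C) (x : R) (l : C) : Cder f x l -> Clim f (at_right x) (f x).
Proof.
intros [H1 H2]; split.
- apply (filterlim_at_right_of_continuous (fun y => Re (f y))), (is_derive_continuous _ _ _ H1).
- apply (filterlim_at_right_of_continuous (fun y => Im (f y))), (is_derive_continuous _ _ _ H2).
Qed.

Lemma Clim_left_of_Cder (f : R -> C) (x : R) (l : C) : Cder f x l -> Clim f (at_left x) (f x).
Proof.
intros [H1 H2]; split.
- apply (filterlim_at_left_of_continuous (fun y => Re (f y))), (is_derive_continuous _ _ _ H1).
- apply (filterlim_at_left_of_continuous (fun y => Im (f y))), (is_derive_continuous _ _ _ H2).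
Qed.

Lemma Cder_line (e b x : R) : Cder (fun y => RtoC (e * (y - b)) * Ci)%C x (RtoC e * Ci)%C.
Proof.
eapply Cder_eq; [apply Cder_mult; [apply (Cder_RtoC _ x e)|apply Cder_const]|cbv beta; ring].
auto_derive; auto; ring.
Qed.

(** The logarithm e (x - b) i of cis (al + e x) / cis (al + e b) vanishes at the right end, so its
    powers can be integrated by parts against the polylogarithms on the arc. *)
Lemma cnint_circle (c : nat -> R) (P : R -> C) (al e a b : R) (m : nat) :
  summable2 c -> a < b ->
  (forall x, 0 < x < PI -> Cder (fun y => Li c 2 (cis y)) x (Ci * P x)%C) ->
  (forall x, a < x < b -> 0 < al + e * x < PI) ->
  cnint (fun x => (RtoC (e * (x - b)) * Ci) ^ m * (RtoC e * Ci) * P (al + e * x)%R)%C a b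
    (W m 2 0 (fun k => Li c k (cis (al + e * b)%R))
     - W m 2 (RtoC (e * (a - b)) * Ci) (fun k => Li c k (cis (al + e * a)%R)))%C.
Proof.
intros Hc Hab HP Hin.
assert (Hcirc : forall y, Cmod (cis y) <= 1) by (intros y; rewrite Cmod_cis; lra).
(* The family is patched at index 1 by the known boundary value, since nothing is proved about the
   series [Li c 1] on the circle itself; index 0 is a dummy, as the integration by parts starts from
   index 1. *)
apply (cnint_of_primitive (fun x => W m 2 (RtoC (e * (x - b)) * Ci)
  (fun k => match k with O => RtoC 0 | 1 => P (al + e * x)%R | _ => Li c k (cis (al + e * x)%R) end))).
- intros x Hx.
  apply (W_der m 1 (fun x => RtoC (e * (x - b)) * Ci)%C
    (fun x k => match k with O => RtoC 0 | 1 => P (al + e * x)%R | _ => Li c k (cis (al + e * x)%R) end)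
    (RtoC e * Ci)%C x (Cder_line e b x)).
  intros [|[|j]] Hj; [lia| |].
  + eapply Cder_eq; [apply (Cder_comp_affine (fun y => Li c 2 (cis y))), HP, Hin, Hx|ring].
  + apply (Li_der c (S (S j)) (fun y => cis (al + e * y)%R) (fun y => RtoC e * Ci * cis (al + e * y)%R)%C
      (RtoC e * Ci)%C a b x (Rabs e) 1); auto; try lra.
    * apply (ex_series_le_R _ _) with (2 := Hc); intros n.
      rewrite pow1, Rmult_1_r, Rabs_pos_eq by apply weight_div_pos.
      apply weight_div_le; lia.
    * intros y _; apply Cder_cis.
    * intros y _; rewrite !Cmod_mult, Cmod_Ci, Cmod_R, Cmod_cis; lra.
- apply (W_lim m 2 (fun x => RtoC (e * (x - b)) * Ci)%C).
  + apply (Clim_right_of_Cder (fun x => RtoC (e * (x - b)) * Ci)%C a _ (Cder_line e b a)).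
  + intros [|[|j]] Hj; [lia|lia|].
    apply Li_lim; auto; [apply filter_forall; auto|].
    apply (Clim_right_of_Cder (fun y => cis (al + e * y)%R) a _ (Cder_cis al e a)).
- apply (W_lim m 2 (fun x => RtoC (e * (x - b)) * Ci)%C).
  + eapply Clim_eq; [apply (Clim_left_of_Cder (fun x => RtoC (e * (x - b)) * Ci)%C b _ (Cder_line e b b))|].
    rewrite Rminus_diag, Rmult_0_r; ring.
  + intros [|[|j]] Hj; [lia|lia|].
    apply Li_lim; auto; [apply filter_forall; auto|].
    apply (Clim_left_of_Cder (fun y => cis (al + e * y)%R) b _ (Cder_cis al e b)).
Qed.

(** * Polylogarithms along curves inside the disk *)

Definition chord (x : R) : R := 2 * sin (x / 2).
Definition dlsin (x : R) : R := cos (x / 2) / (2 * sin (x / 2)).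

(* [lcurve be] is a logarithm of [qcurve 0 be] that vanishes at [x = PI / 3].  For
   [z = cis x] and [w = 1 - z], the curve [w] is [qcurve (- (PI / 3)) (/ 2)] and
   [z * w] is [qcurve 0 (3 / 2)]. *)
Definition lcurve (be x : R) : C := (lsin x, be * (x - PI / 3)).
Definition dlcurve (be x : R) : C := (dlsin x, be).
Definition qcurve (al be x : R) : C := (RtoC (chord x) * cis (al + be * (x - PI / 3))%R)%C.

Lemma sin_PI3_half : sin (PI / 3 / 2) = / 2.
Proof. replace (PI / 3 / 2) with (PI / 6) by field; rewrite sin_PI6; field. Qed.

Lemma chord_end : chord (PI / 3) = 1.
Proof. unfold chord; rewrite sin_PI3_half; field. Qed.

Lemma chord_bounds (x : R) : 0 < x < PI / 3 -> 0 < chord x < 1.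
Proof.
intros H; pose proof PI_RGT_0; unfold chord; split.
- assert (0 < sin (x / 2)) by (apply sin_half_pos; lra); lra.
- assert (sin (x / 2) < sin (PI / 3 / 2)) by (apply sin_increasing_1; lra).
  rewrite sin_PI3_half in *; lra.
Qed.

Lemma chord_increasing (x y : R) : 0 <= x -> x <= y -> y <= PI / 3 -> chord x <= chord y.
Proof.
intros H1 H2 H3; pose proof PI_RGT_0; unfold chord.
assert (sin (x / 2) <= sin (y / 2)) by (apply sin_incr_1; lra); lra.
Qed.

Lemma lsin_chord (x : R) : lsin x = ln (chord x).
Proof. reflexivity. Qed.

Lemma is_derive_chord (x : R) : is_derive chord x (cos (x / 2)).
Proof. unfold chord; auto_derive; auto; unfold Rdiv; field. Qed.

Lemma is_derive_lsin (x : R) : 0 < x < 2 * PI -> is_derive lsin x (dlsin x).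
Proof.
intros H; pose proof (sin_half_pos x H); unfold lsin, dlsin; auto_derive; [unfold Rdiv in *; lra|unfold Rdiv in *; field; lra].
Qed.

Lemma Cder_lcurve (be x : R) : 0 < x < 2 * PI -> Cder (lcurve be) x (dlcurve be x).
Proof.
intros H; split; simpl; [apply is_derive_lsin, H|auto_derive; auto; ring].
Qed.

Lemma Cder_qcurve (al be x : R) : 0 < x < 2 * PI ->
  Cder (qcurve al be) x (dlcurve be x * qcurve al be x)%C.
Proof.
intros H; pose proof (sin_half_pos x H); unfold qcurve.
eapply Cder_eq; [apply Cder_mult; [apply Cder_RtoC, is_derive_chord|]|].
- eapply Cder_ext; [|apply (Cder_cis (al - be * (PI / 3)) be x)].
  intros y; simpl; f_equal; ring.
- replace (al - be * (PI / 3) + be * x) with (al + be * (x - PI / 3)) by ring.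
  replace (dlcurve be x) with (RtoC (dlsin x) + RtoC be * Ci)%C
    by (unfold dlcurve; apply C_eq; simpl; ring).
  replace (cos (x / 2)) with (dlsin x * chord x) by (unfold dlsin, chord; field; lra).
  rewrite RtoC_mult; ring.
Qed.

Lemma Cmod_qcurve (al be x : R) : 0 <= chord x -> Cmod (qcurve al be x) = chord x.
Proof. intros H; unfold qcurve; rewrite Cmod_radial, Cmod_cis by auto; ring. Qed.

(** The pole of [dlsin] at 0 is cancelled by the zero of [chord]: their product is cos (x / 2). So
    termwise differentiation works down to 0. *)
Lemma Cmod_dq (al be x : R) : 0 < x < PI / 3 ->
  Cmod (dlcurve be x * qcurve al be x)%C <= 1 + Rabs be.
Proof.
intros H; pose proof (chord_bounds x H); pose proof PI_RGT_0.
rewrite Cmod_mult, Cmod_qcurve by lra.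
assert (HL : Cmod (dlcurve be x) <= Rabs (dlsin x) + Rabs be) by apply (Cmod_le_Re_Im (dlcurve be x)).
assert (Hs : 0 < sin (x / 2)) by (apply sin_half_pos; lra).
assert (H2 : Rabs (dlsin x) * chord x <= 1).
{ rewrite <- (Rabs_pos_eq (chord x)) by lra; rewrite <- Rabs_mult.
  replace (dlsin x * chord x) with (cos (x / 2)) by (unfold dlsin, chord; field; lra).
  pose proof (COS_bound (x / 2)); apply Rabs_le; lra. }
pose proof (Rabs_pos be); pose proof (Rabs_pos (dlsin x)).
nra.
Qed.

Lemma Li_der_qcurve (c : nat -> R) (k : nat) (al be x : R) :
  sublinear c -> 0 < x < PI / 3 ->
  Cder (fun y => Li c (S k) (qcurve al be y)) x (dlcurve be x * Li c k (qcurve al be x))%C.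
Proof.
intros Hc Hx; pose proof PI_RGT_0.
set (b := (x + PI / 3) / 2).
assert (Hb : 0 < b < PI / 3) by (unfold b; lra).
pose proof (chord_bounds b Hb).
apply (Li_der c k (qcurve al be) (fun y => dlcurve be y * qcurve al be y)%C _ 0 b x (1 + Rabs be) (chord b)); auto.
- unfold b; lra.
- lra.
- apply ex_series_weight_pow; auto.
- intros y Hy; apply Cder_qcurve; unfold b in Hy; lra.
- intros y Hy; apply Cmod_dq; unfold b in *; lra.
- intros y Hy; assert (Hy2 : 0 < y < PI / 3) by (unfold b in *; lra).
  pose proof (chord_bounds y Hy2); rewrite Cmod_qcurve by lra.
  apply chord_increasing; unfold b in *; lra.
Qed.

Lemma exp_INR_mult (n : nat) (x : R) : exp (INR n * x) = exp x ^ n.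
Proof.
induction n as [|n IH]; [simpl; rewrite Rmult_0_l; apply exp_0|].
rewrite S_INR, Rmult_plus_distr_r, Rmult_1_l, exp_plus, IH; simpl; ring.
Qed.

(** With y = - ln t this reads (- ln t + c) ^ i t <= K sqrt t. The inequality u <= exp u at u = (y +
    c) / (2 i), raised to the power i, spends half of the exponential on the polynomial; i = 0 is
    separated because of the division. *)
Lemma pow_mul_exp_neg (i : nat) (c : R) : 0 <= c -> exists K, 0 <= K /\
  forall y, 0 <= y -> (y + c) ^ i * exp (- y) <= K * exp (- y / 2).
Proof.
intros Hc; destruct i as [|i].
- exists 1; split; [lra|]; intros y Hy.
  rewrite pow_O, !Rmult_1_l.
  destruct (Req_dec y 0) as [->|Hy0]; [right; f_equal; field|].
  left; apply exp_increasing; lra.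
- set (n := INR (S i)).
  assert (Hn : 1 <= n) by apply INR_S_ge_1.
  exists ((2 * n) ^ S i * exp (c / 2)); split.
  { apply Rmult_le_pos; [apply pow_le; lra|left; apply exp_pos]. }
  intros y Hy.
  assert (H1 : (y + c) / (2 * n) <= exp ((y + c) / (2 * n))).
  { pose proof (exp_ineq1_le ((y + c) / (2 * n))); lra. }
  assert (H0 : 0 <= (y + c) / (2 * n)) by (apply Rdiv_le_0_compat; lra).
  assert (H2 : ((y + c) / (2 * n)) ^ S i <= exp ((y + c) / 2)).
  { replace ((y + c) / 2) with (INR (S i) * ((y + c) / (2 * n))) by (fold n; field; lra).
    rewrite exp_INR_mult; apply pow_incr; lra. }
  replace ((y + c) ^ S i) with ((2 * n) ^ S i * ((y + c) / (2 * n)) ^ S i)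
    by (rewrite <- Rpow_mult_distr; f_equal; field; lra).
  replace (exp (- y / 2)) with (exp (y / 2) * exp (- y)) by (rewrite <- exp_plus; f_equal; field).
  replace ((2 * n) ^ S i * exp (c / 2) * (exp (y / 2) * exp (- y)))
    with ((2 * n) ^ S i * (exp (y / 2) * exp (c / 2)) * exp (- y)) by ring.
  rewrite <- exp_plus; replace (y / 2 + c / 2) with ((y + c) / 2) by field.
  apply Rmult_le_compat_r; [left; apply exp_pos|].
  apply Rmult_le_compat_l; [apply pow_le; lra|exact H2].
Qed.

Lemma chord_0 : chord 0 = 0.
Proof. unfold chord; replace (0 / 2) with 0 by field; rewrite sin_0; ring. Qed.

Lemma sqrt_chord_lim : filterlim (fun x => sqrt (chord x)) (at_right 0) (locally 0).
Proof.
assert (H : filterlim (fun x => sqrt (chord x)) (at_right 0) (locally (sqrt (chord 0)))).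
- apply (filterlim_at_right_of_continuous (fun x => sqrt (chord x)) 0).
  apply (continuous_comp chord sqrt); [|apply continuous_sqrt].
  apply (is_derive_continuous _ _ _ (is_derive_chord _)).
- rewrite chord_0, sqrt_0 in H; exact H.
Qed.

Lemma lcurve_pow_chord_lim (i : nat) (be K : R) :
  0 <= K -> filterlim (fun x => K * (Cmod (lcurve be x) ^ i * chord x)) (at_right 0) (locally 0).
Proof.
intros HK; pose proof PI_RGT_0.
assert (Hc : 0 <= Rabs be * (PI / 3)) by (apply Rmult_le_pos; [apply Rabs_pos|lra]).
destruct (pow_mul_exp_neg i _ Hc) as [M [HM0 HM]].
apply (filterlim_zero_of_le _ (fun x => K * M * sqrt (chord x))).
- assert (H3 : 0 < PI / 3) by lra.
  generalize (at_right_lt 0 _ H3); apply filter_imp; intros x Hx.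
  pose proof (chord_bounds x Hx) as Hch.
  pose proof (pow_le (Cmod (lcurve be x)) i (Cmod_ge_0 _)).
  rewrite Rabs_pos_eq by (apply Rmult_le_pos; [lra|apply Rmult_le_pos; lra]).
  rewrite Rmult_assoc; apply Rmult_le_compat_l; auto.
  assert (Hl : 0 <= - lsin x).
  { rewrite lsin_chord, <- ln_Rinv by lra; rewrite <- ln_1; apply ln_le; [lra|].
    rewrite <- Rinv_1; apply Rinv_le_contravar; lra. }
  specialize (HM _ Hl).
  replace (exp (- - lsin x)) with (chord x) in HM by (rewrite Ropp_involutive, lsin_chord, exp_ln; lra).
  replace (exp (- - lsin x / 2)) with (sqrt (chord x)) in HM.
  + eapply Rle_trans; [|exact HM].
    apply Rmult_le_compat_r; [lra|apply pow_incr; split; [apply Cmod_ge_0|]].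
    eapply Rle_trans; [apply Cmod_le_Re_Im|]; unfold lcurve; simpl.
    apply Rplus_le_compat; [rewrite <- Rabs_Ropp, Rabs_pos_eq; lra|].
    rewrite Rabs_mult; apply Rmult_le_compat_l; [apply Rabs_pos|apply Rabs_le; lra].
  + rewrite <- Rpower_sqrt by lra; unfold Rpower; f_equal; rewrite lsin_chord; field.
- apply filterlim_scal_zero, sqrt_chord_lim.
Qed.

Lemma filterlim_chord_0 : filterlim chord (at_right 0) (locally 0).
Proof.
assert (H : filterlim chord (at_right 0) (locally (chord 0))).
- apply filterlim_at_right_of_continuous, (is_derive_continuous _ _ _ (is_derive_chord _)).
- rewrite chord_0 in H; exact H.
Qed.

Lemma filterlim_chord_end : filterlim chord (at_left (PI / 3)) (locally 1).
Proof.
rewrite <- chord_end.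
apply filterlim_at_left_of_continuous, (is_derive_continuous _ _ _ (is_derive_chord _)).
Qed.

Lemma chord_near_0 : at_right 0 (fun x => 0 < x < PI / 3 /\ chord x <= / 2).
Proof.
pose proof PI_RGT_0.
assert (H3 : 0 < PI / 3) by lra.
assert (H2 : 0 < / 2) by lra.
pose proof (proj1 (filterlim_locally _ _) filterlim_chord_0 (mkposreal _ H2)) as H1.
generalize (filter_and _ _ (at_right_lt 0 _ H3) H1); apply filter_imp; intros x [Hx Hy]; split; auto.
unfold ball in Hy; simpl in Hy; unfold AbsRing_ball, abs, minus, plus, opp in Hy; simpl in Hy.
apply Rabs_def2 in Hy; lra.
Qed.

Lemma chord_near_end : at_left (PI / 3) (fun x => 0 < x < PI / 3 /\ / 2 <= chord x).
Proof.
pose proof PI_RGT_0.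
assert (H3 : 0 < PI / 3) by lra.
assert (H2 : 0 < / 2) by lra.
pose proof (proj1 (filterlim_locally _ _) filterlim_chord_end (mkposreal _ H2)) as H1.
generalize (filter_and _ _ (at_left_gt 0 _ H3) H1); apply filter_imp; intros x [Hx Hy]; split; auto.
unfold ball in Hy; simpl in Hy; unfold AbsRing_ball, abs, minus, plus, opp in Hy; simpl in Hy.
apply Rabs_def2 in Hy; lra.
Qed.

(** Near 0 the polylogarithms are at most a multiple of [chord]: K serves the orders at least 2, and
    4 serves order 1 as soon as [chord] is at most 1 / 2. By [lcurve_pow_chord_lim] this beats every
    power of the logarithm. *)
Lemma Li_qcurve_vanish (c : nat -> R) (al be : R) (i j : nat) :
  summable2 c -> sublinear c -> (1 <= j)%nat ->
  Clim (fun x => lcurve be x ^ i * Li c j (qcurve al be x))%C (at_right 0) 0.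
Proof.
intros Hc2 Hc1 Hj.
destruct (Cmod_Li_le2 c Hc2) as [K [HK0 HK]].
apply (Clim_zero_of_le _ (fun x => (K + 4) * (Cmod (lcurve be x) ^ i * chord x)));
  [|apply lcurve_pow_chord_lim; lra].
generalize chord_near_0; apply filter_imp; intros x [Hx Hch].
pose proof (chord_bounds x Hx) as Hcb.
rewrite Cmod_mult, Cmod_pow.
pose proof (pow_le (Cmod (lcurve be x)) i (Cmod_ge_0 _)) as Hp.
rewrite (Rmult_comm (K + 4)), Rmult_assoc; apply Rmult_le_compat_l; auto.
pose proof (Cmod_qcurve al be x (Rlt_le _ _ (proj1 Hcb))) as Hq.
destruct j as [|[|j]]; [lia| |].
- eapply Rle_trans; [apply Cmod_Li_le1; auto; lra|]; rewrite Hq.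
  assert (chord x / (1 - chord x) <= 2 * chord x).
  { apply Rmult_le_reg_r with (1 - chord x); [lra|].
    unfold Rdiv; rewrite Rmult_assoc, Rinv_l by lra; nra. }
  nra.
- eapply Rle_trans; [apply HK; [lia|lra]|]; rewrite Hq; nra.
Qed.

(** At PI / 3 the curve may run into the singular point 1, where [Li c 1] is only bounded by a
    multiple of 1 / (1 - [chord]); this linear decay of the logarithm is the compensation. *)
Lemma lcurve_le_end (be x : R) : 0 < x < PI / 3 -> / 2 <= chord x ->
  Cmod (lcurve be x) <= (2 + 2 * Rabs be) * (1 - chord x).
Proof.
intros Hx Hch; pose proof (chord_bounds x Hx); pose proof PI_RGT_0.
eapply Rle_trans; [apply Cmod_le_Re_Im|]; unfold lcurve; simpl Re; simpl Im.
rewrite Rmult_plus_distr_r; apply Rplus_le_compat.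
- rewrite lsin_chord, <- Rabs_Ropp, <- ln_Rinv by lra.
  pose proof (exp_ineq1_le (ln (/ chord x))) as H1.
  rewrite exp_ln in H1 by (apply Rinv_0_lt_compat; lra).
  assert (H2 : 1 <= / chord x) by (rewrite <- Rinv_1; apply Rinv_le_contravar; lra).
  rewrite Rabs_pos_eq by (rewrite <- ln_1; apply ln_le; lra).
  assert (/ chord x - 1 <= 2 * (1 - chord x)).
  { apply Rmult_le_reg_r with (chord x); [lra|].
    rewrite Rmult_minus_distr_r, Rinv_l by lra; nra. }
  lra.
- rewrite Rabs_mult, (Rmult_comm 2), Rmult_assoc; apply Rmult_le_compat_l; [apply Rabs_pos|].
  destruct (MVT_gen chord x (PI / 3) (fun y => cos (y / 2))) as [y [Hy1 Hy2]].
  + intros y _; apply is_derive_chord.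
  + intros y _; apply continuity_pt_filterlim, (is_derive_continuous _ _ _ (is_derive_chord _)).
  + rewrite chord_end in Hy2.
    rewrite Rmin_left, Rmax_right in Hy1 by lra.
    assert (cos (PI / 3) <= cos (y / 2)) by (apply cos_decr_1; lra).
    rewrite cos_PI3 in *.
    rewrite <- Rabs_Ropp, Rabs_pos_eq by lra; rewrite Hy2; nra.
Qed.

(** At 0 all boundary terms vanish; at PI / 3 the logarithm is 0 and only the last one remains. The
    boundary term with [Li c 1] needs two powers of the logarithm, one against the possible pole and
    one to tend to 0, hence m >= 2. *)
Lemma cnint_qcurve (c : nat -> R) (al be : R) (m : nat) :
  summable2 c -> sublinear c -> (2 <= m)%nat ->
  cnint (fun x => lcurve be x ^ m * dlcurve be x * Li c 0 (qcurve al be x))%C 0 (PI / 3)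
    (RtoC ((-1) ^ m * INR (fact m)) * Li c (S m) (cis al))%C.
Proof.
intros Hc2 Hc1 Hm; pose proof PI_RGT_0.
eapply cnint_eq; [apply (cnint_of_primitive
  (fun x => W m 1 (lcurve be x) (fun k => Li c k (qcurve al be x))) _ 0 (PI / 3) 0
  (RtoC ((-1) ^ m * INR (fact m)) * Li c (S m) (cis al))%C)|ring].
- intros x Hx; apply (W_der m 0 (lcurve be) (fun x k => Li c k (qcurve al be x))).
  + apply Cder_lcurve; lra.
  + intros j _; apply Li_der_qcurve; auto.
- apply (W_vanish m 1 (lcurve be) (fun x k => Li c k (qcurve al be x))).
  intros i j Hj; apply Li_qcurve_vanish; auto.
- destruct m as [|[|m]]; [lia|lia|].
  assert (Hend : 0 < PI / 3 < 2 * PI) by lra.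
  assert (Hl : Clim (lcurve be) (at_left (PI / 3)) 0).
  { eapply Clim_eq; [apply (Clim_left_of_Cder _ _ _ (Cder_lcurve be _ Hend))|].
    unfold lcurve; rewrite lsin_chord, chord_end, ln_1; apply C_eq; simpl; ring. }
  assert (Hq : Clim (qcurve al be) (at_left (PI / 3)) (cis al)).
  { eapply Clim_eq; [apply (Clim_left_of_Cder _ _ _ (Cder_qcurve al be _ Hend))|].
    unfold qcurve; rewrite chord_end, Rminus_diag, Rmult_0_r, Rplus_0_r; ring. }
  assert (H1 : Clim (fun x => lcurve be x ^ S (S m) * Li c 1 (qcurve al be x))%C (at_left (PI / 3)) 0).
  { set (K := (2 + 2 * Rabs be) ^ S (S m) * 2).
    assert (HK : 0 <= 2 + 2 * Rabs be) by (pose proof (Rabs_pos be); lra).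
    apply (Clim_zero_of_le _ (fun x => K * (1 - chord x))).
    - generalize chord_near_end; apply filter_imp; intros x [Hx Hch].
      pose proof (chord_bounds x Hx) as Hcb.
      pose proof (Cmod_qcurve al be x (Rlt_le _ _ (proj1 Hcb))) as Hqm.
      rewrite Cmod_mult, Cmod_pow.
      assert (B1 : Cmod (lcurve be x) ^ S (S m) <= (2 + 2 * Rabs be) ^ S (S m) * ((1 - chord x) * (1 - chord x))).
      { eapply Rle_trans; [apply pow_incr; split; [apply Cmod_ge_0|apply lcurve_le_end; auto]|].
        rewrite Rpow_mult_distr; apply Rmult_le_compat_l; [apply pow_le; auto|].
        simpl; rewrite <- Rmult_assoc.
        assert ((1 - chord x) ^ m <= 1) by (apply Rle_trans with (1 ^ m); [apply pow_incr; lra|rewrite pow1; lra]).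
        assert (0 <= (1 - chord x) ^ m) by (apply pow_le; lra).
        apply Rle_trans with ((1 - chord x) * (1 - chord x) * 1); [apply Rmult_le_compat_l; [nra|assumption]|lra]. }
      assert (B2 : Cmod (Li c 1 (qcurve al be x)) <= 2 * / (1 - chord x)).
      { eapply Rle_trans; [apply Cmod_Li_le1; auto; lra|]; rewrite Hqm.
        apply Rmult_le_compat_l; [lra|]; unfold Rdiv.
        assert (0 < / (1 - chord x)) by (apply Rinv_0_lt_compat; lra); nra. }
      replace (K * (1 - chord x)) with
        ((2 + 2 * Rabs be) ^ S (S m) * ((1 - chord x) * (1 - chord x)) * (2 * / (1 - chord x)))
        by (unfold K; field; lra).
      apply Rmult_le_compat; auto; [apply pow_le|]; apply Cmod_ge_0.
    - replace 0 with (K * (1 - 1)) by ring.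
      apply filterlim_Rmult; [apply filterlim_const|].
      apply filterlim_Rminus; [apply filterlim_const|apply filterlim_chord_end]. }
  assert (H2 : Clim (fun x => W (S m) 2 (lcurve be x) (fun k => Li c k (qcurve al be x))) (at_left (PI / 3))
    (W (S m) 2 0 (fun k => Li c k (cis al)))).
  { apply (W_lim (S m) 2 (lcurve be) (fun x k => Li c k (qcurve al be x))); auto.
    intros j Hj; apply Li_lim; auto.
    generalize chord_near_end; apply filter_imp; intros x [Hx _].
    pose proof (chord_bounds x Hx); rewrite Cmod_qcurve; lra. }
  eapply Clim_eq; [apply Clim_minus; [exact H1|apply Clim_mult; [apply Clim_const|exact H2]]|].
  rewrite W_zero; replace (2 + S m)%nat with (S (S (S m))) by lia.
  change (fact (S (S m))) with (S (S m) * fact (S m))%nat; rewrite mult_INR.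
  rewrite !RtoC_mult, <- (tech_pow_Rmult (-1) (S m)), RtoC_mult; ring.
Qed.

Lemma nint_eq (f : R -> R) (a b I J : R) : nint f a b I -> I = J -> nint f a b J.
Proof. intros H <-; exact H. Qed.

Lemma cis_0 : cis 0 = 1%C.
Proof. unfold cis; rewrite cos_0, sin_0; reflexivity. Qed.

Lemma cis_PI : cis PI = (-1)%C.
Proof. unfold cis; rewrite cos_PI, sin_PI; apply C_eq; simpl; ring. Qed.

Lemma cis_opp (x : R) : cis (- x) = Cconj (cis x).
Proof. unfold cis, Cconj; rewrite cos_neg, sin_neg; reflexivity. Qed.

Lemma Li_conj (c : nat -> R) (k : nat) (q : C) : Li c k (Cconj q) = Cconj (Li c k q).
Proof.
apply C_eq; simpl.
- apply Series_ext; intros n; rewrite <- Cpow_conj.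
  destruct (q ^ S n)%C; simpl; ring.
- rewrite <- Series_opp; apply Series_ext; intros n; rewrite <- Cpow_conj.
  destruct (q ^ S n)%C; simpl; ring.
Qed.

Lemma Li_real (c : nat -> R) (k : nat) (r : R) : Im (Li c k (RtoC r)) = 0.
Proof.
assert (H : Cconj (RtoC r) = RtoC r) by (apply C_eq; simpl; ring).
pose proof (Li_conj c k (RtoC r)) as E; rewrite H in E.
apply (f_equal Im) in E; simpl in E |- *; lra.
Qed.

Lemma Li_one_zeta (k : nat) : Re (Li one k 1) = zeta k.
Proof.
apply Series_ext; intros n; rewrite Cpow_1_l; unfold one; simpl Re.
unfold Rdiv; simpl; ring.
Qed.

(** On the circle the logarithm is purely imaginary, so in each application a single component
    suffices: the one in which the powers of [Ci] bring out the factor [lsin]. These expansions are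
    those components. *)
Lemma W1_Im (y : R) (P : nat -> C) :
  Im (W 1 2 (RtoC y * Ci) P) = y * Re (P 2%nat) - Im (P 3%nat).
Proof.
change (W 1 2 (RtoC y * Ci) P) with ((RtoC y * Ci) ^ 1 * P 2%nat - 1 * P 3%nat)%C.
destruct (P 2%nat), (P 3%nat); simpl; ring.
Qed.

Lemma W2_Im (y : R) (P : nat -> C) :
  Im (W 2 2 (RtoC y * Ci) P) = - y ^ 2 * Im (P 2%nat) - 2 * y * Re (P 3%nat) + 2 * Im (P 4%nat).
Proof.
simpl W; destruct (P 2%nat), (P 3%nat), (P 4%nat); simpl; ring.
Qed.

Lemma W3_Re (y : R) (P : nat -> C) :
  Re (W 3 2 (RtoC y * Ci) P) =
  y ^ 3 * Im (P 2%nat) + 3 * y ^ 2 * Re (P 3%nat) - 6 * y * Im (P 4%nat) - 6 * Re (P 5%nat).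
Proof.
simpl W; destruct (P 2%nat), (P 3%nat), (P 4%nat), (P 5%nat); simpl; ring.
Qed.

Lemma W3_Im (y : R) (P : nat -> C) :
  Im (W 3 2 (RtoC y * Ci) P) =
  - y ^ 3 * Re (P 2%nat) + 3 * y ^ 2 * Im (P 3%nat) + 6 * y * Re (P 4%nat) - 6 * Im (P 5%nat).
Proof.
simpl W; destruct (P 2%nat), (P 3%nat), (P 4%nat), (P 5%nat); simpl; ring.
Qed.

Lemma W4_Im (y : R) (P : nat -> C) :
  Im (W 4 2 (RtoC y * Ci) P) =
  y ^ 4 * Im (P 2%nat) + 4 * y ^ 3 * Re (P 3%nat) - 12 * y ^ 2 * Im (P 4%nat)
  - 24 * y * Re (P 5%nat) + 24 * Im (P 6%nat).
Proof.
simpl W; destruct (P 2%nat), (P 3%nat), (P 4%nat), (P 5%nat), (P 6%nat); simpl; ring.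
Qed.

Lemma C_minus_Im (x y : C) : Im (x - y)%C = Im x - Im y.
Proof. reflexivity. Qed.

Lemma C_minus_Re (x y : C) : Re (x - y)%C = Re x - Re y.
Proof. reflexivity. Qed.

Lemma W_0_line (m k : nat) (P : nat -> C) : W m k 0 P = W m k (RtoC 0 * Ci) P.
Proof. f_equal; ring. Qed.

(** * Log-sine integrals *)

Lemma nint_lsin_pow2 :
  nint (fun y => (PI - y) ^ 2 * lsin y) 0 PI (-2 * PI * zeta 3).
Proof.
pose proof PI_RGT_0.
destruct (cnint_circle one bdlog 0 1 0 PI 2 summable2_one) as [_ HI]; auto using Li_one_2_circle_der.
{ intros x Hx; lra. }
refine (nint_eq _ _ _ _ _ (nint_ext _ _ _ _ _ _ HI) _).
- intros x Hx; replace (0 + 1 * x) with x by ring; simpl; ring.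
- rewrite C_minus_Im, W_0_line, !W2_Im.
  replace (0 + 1 * 0) with 0 by ring; replace (0 + 1 * PI) with PI by ring.
  rewrite cis_0, cis_PI, !Li_real, Li_one_zeta; ring.
Qed.

Lemma nint_lsin_pow3 (x : R) : 0 < x <= PI ->
  nint (fun y => (x - y) ^ 3 * lsin y) 0 x
    (- 6 * Re (Li one 5 (cis x)) - 3 * x ^ 2 * zeta 3 + 6 * zeta 5).
Proof.
intros Hx.
destruct (cnint_circle one bdlog 0 1 0 x 3 summable2_one) as [HR _]; auto using Li_one_2_circle_der; try lra.
{ intros y Hy; lra. }
refine (nint_eq _ _ _ _ _ (nint_ext _ _ _ _ _ _ HR) _).
- intros y Hy; replace (0 + 1 * y) with y by ring; simpl; ring.
- rewrite C_minus_Re, W_0_line, !W3_Re.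
  replace (0 + 1 * 0) with 0 by ring; replace (0 + 1 * x) with x by ring.
  rewrite cis_0, !Li_real, !Li_one_zeta; ring.
Qed.

Lemma nint_lsin_pow4 (x : R) : 0 < x <= PI ->
  nint (fun y => (x - y) ^ 4 * lsin y) 0 x
    (- 4 * x ^ 3 * zeta 3 + 24 * x * zeta 5 - 24 * Im (Li one 6 (cis x))).
Proof.
intros Hx.
destruct (cnint_circle one bdlog 0 1 0 x 4 summable2_one) as [_ HI]; auto using Li_one_2_circle_der; try lra.
{ intros y Hy; lra. }
apply (nint_scal (-1)) in HI.
refine (nint_eq _ _ _ _ _ (nint_ext _ _ _ _ _ _ HI) _).
- intros y Hy; replace (0 + 1 * y) with y by ring; simpl; ring.
- rewrite C_minus_Im, W_0_line, !W4_Im.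
  replace (0 + 1 * 0) with 0 by ring; replace (0 + 1 * x) with x by ring.
  rewrite cis_0, !Li_real, !Li_one_zeta; ring.
Qed.

Lemma nint_harm (x : R) : 0 < x <= PI ->
  nint (fun y => (x - y) ^ 3 * lsin y * ((PI - y) / 2)) 0 x
    (- 6 * Im (Li harm 5 (cis x)) - x ^ 3 * Re (Li harm 2 1) + 6 * x * Re (Li harm 4 1)).
Proof.
intros Hx.
destruct (cnint_circle harm (fun y => / 2 * bdlog y ^ 2)%C 0 1 0 x 3 summable2_harm) as [_ HI];
  auto using Li_harm_2_circle_der; try lra.
{ intros y Hy; lra. }
refine (nint_eq _ _ _ _ _ (nint_ext _ _ _ _ _ _ HI) _).
- intros y Hy; replace (0 + 1 * y) with y by ring; simpl; field.
- rewrite C_minus_Im, W_0_line, !W3_Im.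
  replace (0 + 1 * 0) with 0 by ring; replace (0 + 1 * x) with x by ring.
  rewrite cis_0, !Li_real; ring.
Qed.

(** Euler's sum of H_(n-1) / n ^ 2. On the arc that ends at PI the logarithm is proportional to the
    imaginary part of [bdlog], so the integrand becomes (PI - y) ^ 2 [lsin], already evaluated with
    the weights [one]; the end values are real. *)
Lemma Li_harm_2_1 : Re (Li harm 2 1) = zeta 3.
Proof.
pose proof PI_RGT_0.
destruct (cnint_circle harm (fun y => / 2 * bdlog y ^ 2)%C 0 1 0 PI 1 summable2_harm) as [_ HI];
  auto using Li_harm_2_circle_der; try lra.
{ intros y Hy; lra. }
pose proof (nint_scal (- / 2) _ _ _ _ nint_lsin_pow2) as H2.
assert (E : PI * Re (Li harm 2 1) = - / 2 * (-2 * PI * zeta 3)).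
{ apply (nint_unique (fun y => - / 2 * ((PI - y) ^ 2 * lsin y)) 0 PI); auto.
  refine (nint_eq _ _ _ _ _ (nint_ext _ _ _ _ _ _ HI) _).
  - intros y Hy; replace (0 + 1 * y) with y by ring; simpl; field.
  - rewrite C_minus_Im, W_0_line, !W1_Im.
    replace (0 + 1 * 0) with 0 by ring; replace (0 + 1 * PI) with PI by ring.
    rewrite cis_0, cis_PI, !Li_real; ring. }
apply Rmult_eq_reg_l with PI; lra.
Qed.

(* At [x = PI] the series over [sin (n PI)] vanishes, which gives Euler's value of
   the sum of [harm n / (n + 1) ^ 4] without evaluating [zeta 2]. *)
Lemma Li_harm_4_1 : Re (Li harm 4 1) = 2 * zeta 5 - PI ^ 2 / 6 * zeta 3.
Proof.
pose proof PI_RGT_0.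
assert (Hx : 0 < PI <= PI) by lra.
pose proof (nint_harm PI Hx) as H1.
pose proof (nint_scal (/ 2) _ _ _ _ (nint_lsin_pow4 PI Hx)) as H2.
assert (E : - 6 * Im (Li harm 5 (cis PI)) - PI ^ 3 * Re (Li harm 2 1) + 6 * PI * Re (Li harm 4 1)
  = / 2 * (- 4 * PI ^ 3 * zeta 3 + 24 * PI * zeta 5 - 24 * Im (Li one 6 (cis PI)))).
{ apply (nint_unique (fun y => / 2 * ((PI - y) ^ 4 * lsin y)) 0 PI); auto.
  refine (nint_ext _ _ _ _ _ _ H1); intros y Hy; field. }
rewrite cis_PI, !Li_real, Li_harm_2_1 in E.
apply Rmult_eq_reg_l with (6 * PI); [|lra].
lra.
Qed.

(** * Polylogarithms and integrals at PI / 3 *)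

Definition c3 := Re (Li one 3 (cis (PI / 3))).
Definition c5 := Re (Li one 5 (cis (PI / 3))).
Definition s6 := Im (Li one 6 (cis (PI / 3))).
Definition t6 := Im (Li one 6 (cis (2 * (PI / 3)))).

Lemma PI3_bound : 0 < PI / 3 <= PI.
Proof. pose proof PI_RGT_0; lra. Qed.

(** Since (PI - y) / 2 = PI / 3 + (PI / 3 - y) / 2, the integrand of [nint_harm] at PI / 3 splits
    into the third and fourth power integrals. This removes the harmonic sum in favour of [c5] and
    [s6]. *)
Lemma Im_Li_harm_5_PI3 :
  Im (Li harm 5 (cis (PI / 3))) =
  - 5 / 6 * (PI / 3) ^ 3 * zeta 3 - PI / 3 * zeta 5 + PI / 3 * c5 + 2 * s6.
Proof.
pose proof PI3_bound as Hx.
pose proof (nint_harm _ Hx) as H1.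
pose proof (nint_plus _ _ _ _ _ _ (nint_scal (PI / 3) _ _ _ _ (nint_lsin_pow3 _ Hx))
  (nint_scal (/ 2) _ _ _ _ (nint_lsin_pow4 _ Hx))) as H2.
pose proof (nint_unique _ _ _ _ _ (proj1 Hx) H2
  (nint_ext _ _ _ _ _ (fun y _ => eq_trans (ltac:(field) :
     (PI / 3 - y) ^ 3 * lsin y * ((PI - y) / 2) =
     PI / 3 * ((PI / 3 - y) ^ 3 * lsin y) + / 2 * ((PI / 3 - y) ^ 4 * lsin y)) eq_refl) H1)) as E.
rewrite Li_harm_2_1, Li_harm_4_1 in E.
fold c5 in E; fold s6 in E.
apply Rmult_eq_reg_l with (-6); [|lra].
lra.
Qed.

Lemma nint_LH4 :
  nint (fun x => lsin x * (PI / 3 - x) ^ 4) 0 (PI / 3)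
    (- 4 * (PI / 3) ^ 3 * zeta 3 + 24 * (PI / 3) * zeta 5 - 24 * s6).
Proof.
refine (nint_ext _ _ _ _ _ _ (nint_lsin_pow4 _ PI3_bound)); intros; ring.
Qed.

(** Two arcs leave PI / 3, one towards 0 and one towards 2 PI / 3. Their logarithms have opposite
    signs, so at PI / 3 the terms of even order, [s6] among them, cancel and those of odd order
    double. *)
Lemma nint_reflected :
  nint (fun x => (PI / 3 - x) ^ 4 * (lsin (PI / 3 - x) + lsin (PI / 3 + x))) 0 (PI / 3)
    (- 8 * (PI / 3) ^ 3 * c3 + 48 * (PI / 3) * c5 - 24 * t6).
Proof.
pose proof PI_RGT_0.
destruct (cnint_circle one bdlog (PI / 3) (-1) 0 (PI / 3) 4 summable2_one) as [_ H1];
  auto using Li_one_2_circle_der; try lra.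
{ intros y Hy; lra. }
destruct (cnint_circle one bdlog (PI / 3) 1 0 (PI / 3) 4 summable2_one) as [_ H2];
  auto using Li_one_2_circle_der; try lra.
{ intros y Hy; lra. }
refine (nint_eq _ _ _ _ _ (nint_ext _ _ _ _ _ _ (nint_plus _ _ _ _ _ _ H1 (nint_scal (-1) _ _ _ _ H2))) _).
- intros y Hy; replace (PI / 3 + -1 * y) with (PI / 3 - y) by ring.
  replace (PI / 3 + 1 * y) with (PI / 3 + y) by ring; simpl; field.
- rewrite !C_minus_Im, !W_0_line, !W4_Im.
  replace (PI / 3 + -1 * (PI / 3)) with 0 by ring.
  replace (PI / 3 + 1 * (PI / 3)) with (2 * (PI / 3)) by ring.
  replace (PI / 3 + -1 * 0) with (PI / 3) by ring.
  replace (PI / 3 + 1 * 0) with (PI / 3) by ring.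
  fold c3 c5 s6 t6; rewrite cis_0, !Li_real; ring.
Qed.

(* [1 - z + z ^ 2 = z (2 cos x - 1)] for [z = cis x], and [dgap] is the logarithmic
   derivative of [2 cos x - 1 = 1 - chord x ^ 2]. *)
Definition dgap (x : R) : R := - 2 * sin x / (2 * cos x - 1).

(** The logarithmic derivative of 1 - z + z ^ 2 along z = cis x, divided into the real factor and z,
    which contributes [Ci]. *)
Definition dgapC (x : R) : C := (dgap x, 1).

Lemma gap_pos (x : R) : 0 <= x < PI / 3 -> 0 < 2 * cos x - 1.
Proof.
intros H; pose proof PI_RGT_0.
assert (cos (PI / 3) < cos x) by (apply cos_decreasing_1; lra).
rewrite cos_PI3 in *; lra.
Qed.

Lemma gap_chord (x : R) : 2 * cos x - 1 = 1 - chord x ^ 2.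
Proof.
unfold chord; replace x with (2 * (x / 2)) at 1 by field; rewrite cos_2a_sin; ring.
Qed.

Lemma gap_chord_mult (x : R) : 2 * cos x - 1 = chord (PI / 3 - x) * chord (PI / 3 + x).
Proof.
pose proof (form2 x (PI / 3)) as H; rewrite cos_PI3 in H.
unfold chord.
replace ((PI / 3 - x) / 2) with (- ((x - PI / 3) / 2)) by field.
rewrite sin_neg; replace ((PI / 3 + x) / 2) with ((x + PI / 3) / 2) by field.
lra.
Qed.

(** * Logarithmic differential forms along the curves *)

Lemma Cneq_0_of_Re (z : C) : Re z <> 0 -> z <> 0%C.
Proof. intros H E; apply H; rewrite E; reflexivity. Qed.

Lemma cis_neq_0 (x : R) : cis x <> 0%C.
Proof.
intros E; pose proof (Cmod_cis x) as H; rewrite E, Cmod_0 in H; lra.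
Qed.

Lemma one_minus_cis_neq_0 (x : R) : 0 < x < PI / 3 -> (1 - cis x)%C <> 0%C.
Proof.
intros H; pose proof PI_RGT_0; apply Cneq_0_of_Re; simpl.
assert (cos x < cos 0) by (apply cos_decreasing_1; lra); rewrite cos_0 in *; lra.
Qed.

Lemma cos_half (x : R) : cos x = 1 - 2 * sin (x / 2) ^ 2.
Proof. replace x with (2 * (x / 2)) at 1 by field; rewrite cos_2a_sin; ring. Qed.

Lemma sin_half (x : R) : sin x = 2 * sin (x / 2) * cos (x / 2).
Proof. replace x with (2 * (x / 2)) at 1 by field; apply sin_2a. Qed.

Lemma cos2_half (x : R) : cos (x / 2) ^ 2 = 1 - sin (x / 2) ^ 2.
Proof. pose proof (sin2_cos2 (x / 2)); unfold Rsqr in *; lra. Qed.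

(** The argument of 1 - cis x is x / 2 - PI / 2, which equals - PI / 3 at the right end; the
    rotation by al + PI / 3 makes up for it. *)
Lemma qcurve_0_cis (al x : R) : qcurve al (/ 2) x = (cis (al + PI / 3) * (1 - cis x))%C.
Proof.
unfold qcurve.
replace (al + / 2 * (x - PI / 3)) with (al + PI / 3 + (x / 2 - PI / 2)) by field.
rewrite cis_plus; replace (1 - cis x)%C with (RtoC (chord x) * cis (x / 2 - PI / 2))%C; [ring|].
apply C_eq; unfold chord, cis; simpl.
- replace (x / 2 - PI / 2) with (- (PI / 2 - x / 2)) by ring.
  rewrite cos_neg, sin_neg, cos_shift, (cos_half x); ring.
- replace (x / 2 - PI / 2) with (- (PI / 2 - x / 2)) by ring.
  rewrite cos_neg, sin_neg, sin_shift, (sin_half x); ring.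
Qed.

Lemma qcurve_32_cis (x : R) : qcurve 0 (3 / 2) x = (cis x * (1 - cis x))%C.
Proof.
unfold qcurve.
replace (0 + 3 / 2 * (x - PI / 3)) with (x - PI / 3 + (0 + / 2 * (x - PI / 3))) by field.
rewrite cis_plus.
replace (RtoC (chord x) * (cis (x - PI / 3) * cis (0 + / 2 * (x - PI / 3))))%C
  with (cis (x - PI / 3) * qcurve 0 (/ 2) x)%C by (unfold qcurve; ring).
rewrite qcurve_0_cis, Cmult_assoc, <- cis_plus; do 2 f_equal; ring.
Qed.

Lemma dlcurve_half_cis (x : R) : 0 < x < PI / 3 -> dlcurve (/ 2) x = (- Ci * cis x / (1 - cis x))%C.
Proof.
intros Hx; pose proof (one_minus_cis_neq_0 x Hx) as H0; pose proof PI_RGT_0.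
assert (Hs : 0 < sin (x / 2)) by (apply sin_half_pos; lra).
assert (E : (dlcurve (/ 2) x * (1 - cis x) = - Ci * cis x)%C).
{ pose proof (cos2_half x) as Hc.
  unfold dlcurve, dlsin, cis; apply C_eq; simpl; rewrite (cos_half x), (sin_half x).
  - field; lra.
  - field_simplify; [|lra]; rewrite Hc; field; lra. }
rewrite <- E; field; exact H0.
Qed.

Lemma dlcurve_32_cis (x : R) : 0 < x < PI / 3 ->
  dlcurve (3 / 2) x = (Ci * (1 - 2 * cis x) / (1 - cis x))%C.
Proof.
intros Hx; pose proof (one_minus_cis_neq_0 x Hx) as H0.
replace (dlcurve (3 / 2) x) with (dlcurve (/ 2) x + Ci)%C.
- rewrite dlcurve_half_cis by exact Hx; field; exact H0.
- unfold dlcurve; apply C_eq; simpl; field.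
Qed.

Lemma gap_cis (x : R) : (1 - cis x + cis x ^ 2)%C = (cis x * RtoC (2 * cos x - 1))%C.
Proof.
pose proof (sin2_cos2 x) as H; unfold Rsqr in H.
unfold cis; apply C_eq; simpl; [|ring].
replace (sin x * (cos x * 0 + sin x * 1)) with (1 - cos x * cos x) by lra; ring.
Qed.

Lemma dgap_cis (x : R) : 0 < x < PI / 3 ->
  dgapC x = (Ci * (2 * cis x - 1) / RtoC (2 * cos x - 1))%C.
Proof.
intros Hx; assert (Hg : 0 < 2 * cos x - 1) by (apply gap_pos; lra).
assert (H0 : RtoC (2 * cos x - 1) <> 0%C) by (apply Cneq_0_of_Re; simpl; lra).
assert (E : (dgapC x * RtoC (2 * cos x - 1) = Ci * (2 * cis x - 1))%C).
{ unfold dgapC, dgap, cis; apply C_eq; simpl; field; lra. }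
rewrite <- E; field; exact H0.
Qed.

Lemma Cmod_qcurve_lt_1 (al be x : R) : 0 < x < PI / 3 -> Cmod (qcurve al be x) < 1.
Proof. intros Hx; pose proof (chord_bounds x Hx); rewrite Cmod_qcurve; lra. Qed.

Lemma gap_cis_neq_0 (x : R) : 0 < x < PI / 3 ->
  RtoC (2 * cos x - 1) <> 0%C /\ (1 - cis x + cis x ^ 2)%C <> 0%C.
Proof.
intros Hx; assert (Hg : 0 < 2 * cos x - 1) by (apply gap_pos; lra).
assert (H0 : RtoC (2 * cos x - 1) <> 0%C) by (apply Cneq_0_of_Re; simpl; lra).
split; [exact H0|]; rewrite gap_cis; apply Cmult_neq_0; [apply cis_neq_0|exact H0].
Qed.

(** With q = z w the left side is d ln q times q / (1 - q), that is - d ln (1 - q), and 1 - z w = 1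
    - z + z ^ 2. *)
Lemma form_32 (x : R) : 0 < x < PI / 3 ->
  (dlcurve (3 / 2) x * Li one 0 (qcurve 0 (3 / 2) x))%C = (- dgapC x)%C.
Proof.
intros Hx; rewrite Li_one_0 by (apply Cmod_qcurve_lt_1; exact Hx).
rewrite dlcurve_32_cis, dgap_cis, qcurve_32_cis by exact Hx.
pose proof (gap_cis x) as Eg; destruct (gap_cis_neq_0 x Hx) as [H1 H2].
pose proof (one_minus_cis_neq_0 x Hx) as H3; pose proof (cis_neq_0 x) as H4.
assert (H5 : (1 - cis x * (1 - cis x))%C <> 0%C)
  by (replace (1 - cis x * (1 - cis x))%C with (1 - cis x + cis x ^ 2)%C by ring; exact H2).
transitivity (Ci * (1 - 2 * cis x) * cis x / (1 - cis x + cis x ^ 2))%C.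
- replace (1 - cis x + cis x ^ 2)%C with (1 - cis x * (1 - cis x))%C by ring; field; auto.
- rewrite Eg; field; auto.
Qed.

Lemma cis_PI3_sum : (cis (PI / 3) + cis (- (PI / 3)))%C = 1%C.
Proof. unfold cis; rewrite cos_neg, sin_neg, cos_PI3; apply C_eq; simpl; field. Qed.

Lemma cis_PI3_prod : (cis (PI / 3) * cis (- (PI / 3)))%C = 1%C.
Proof. rewrite <- cis_plus, Rplus_opp_r; apply cis_0. Qed.

(** The two curves are r w and r' w with r, r' = exp (i PI / 3), exp (- i PI / 3). As r + r' = r r'
    = 1, the product (1 - r w) (1 - r' w) is 1 - w + w ^ 2 = 1 - z + z ^ 2, so the two forms add up
    to the one of [form_32], now with another logarithm. *)
Lemma form_half (x : R) : 0 < x < PI / 3 ->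
  (dlcurve (/ 2) x * (Li one 0 (qcurve 0 (/ 2) x) + Li one 0 (qcurve (- (2 * (PI / 3))) (/ 2) x)))%C
  = (- dgapC x)%C.
Proof.
intros Hx; rewrite !Li_one_0 by (apply Cmod_qcurve_lt_1; exact Hx).
pose proof (Cmod_qcurve_lt_1 0 (/ 2) x Hx) as M1.
pose proof (Cmod_qcurve_lt_1 (- (2 * (PI / 3))) (/ 2) x Hx) as M2.
apply one_minus_neq_0 in M1; apply one_minus_neq_0 in M2.
rewrite qcurve_0_cis in M1, M2.
rewrite dlcurve_half_cis, dgap_cis, !qcurve_0_cis by exact Hx.
replace (0 + PI / 3) with (PI / 3) in * by ring.
replace (- (2 * (PI / 3)) + PI / 3) with (- (PI / 3)) in * by ring.
pose proof (gap_cis x) as Eg; destruct (gap_cis_neq_0 x Hx) as [H1 H2].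
pose proof (one_minus_cis_neq_0 x Hx) as H3; pose proof (cis_neq_0 x) as H4.
pose proof cis_PI3_sum as Es; pose proof cis_PI3_prod as Ep.
set (r := cis (PI / 3)) in *; set (r' := cis (- (PI / 3))) in *.
set (z := cis x) in *.
assert (Er : r' = (1 - r)%C) by (rewrite <- Es; ring).
rewrite Er in *.
assert (Ew : ((1 - r * (1 - z)) * (1 - (1 - r) * (1 - z)) = 1 - z + z ^ 2)%C).
{ transitivity (z + (r * (1 - r)) * (1 - z) ^ 2)%C; [ring|rewrite Ep; ring]. }
transitivity (- Ci * z * (2 * z - 1) / (1 - z + z ^ 2))%C.
- rewrite <- Ew.
  replace (2 * z - 1)%C with (1 - 2 * (r * (1 - r)) * (1 - z))%C by (rewrite Ep; ring).
  field; auto.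
- rewrite Eg; field; auto.
Qed.

Lemma form_w (x : R) : 0 < x < PI / 3 ->
  (dlcurve (/ 2) x * Li one 0 (qcurve (- (PI / 3)) (/ 2) x))%C = (- Ci)%C.
Proof.
intros Hx; rewrite Li_one_0 by (apply Cmod_qcurve_lt_1; exact Hx).
rewrite dlcurve_half_cis, qcurve_0_cis by exact Hx.
replace (- (PI / 3) + PI / 3) with 0 by ring; rewrite cis_0, Cmult_1_l.
pose proof (one_minus_cis_neq_0 x Hx) as H3; pose proof (cis_neq_0 x) as H4.
replace (1 - (1 - cis x))%C with (cis x) by ring; field; auto.
Qed.

(* [- ln (1 - w) = - ln z] for [w = 1 - z]. *)
Lemma Li_one_1_w (x : R) : 0 < x < PI / 3 ->
  Li one 1 (qcurve (- (PI / 3)) (/ 2) x) = (- RtoC x * Ci)%C.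
Proof.
intros Hx.
apply (Cder_unique (fun y => Li one 1 (qcurve (- (PI / 3)) (/ 2) y)) (fun y => - RtoC y * Ci)%C
  (fun _ => - Ci)%C 0 (PI / 3)); auto; try lra.
- intros y Hy; eapply Cder_eq; [apply Li_der_qcurve; auto using sublinear_one|apply form_w, Hy].
- intros y Hy; split; simpl; auto_derive; auto; ring.
- eapply Clim_eq; [apply Clim_minus|].
  + apply Clim_ext with (2 := Li_qcurve_vanish one (- (PI / 3)) (/ 2) 0 1 summable2_one sublinear_one (le_n _)).
    intros y; simpl; ring.
  + apply (Clim_right_of_Cder (fun y => - RtoC y * Ci)%C 0 (- Ci)%C).
    split; simpl; auto_derive; auto; ring.
  + ring.
Qed.

(** By [Li_harm_0] this is [Li one 1] at w, equal to - i x, times the form - i of [form_w]. Harmonic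
    weights thus insert a factor x into the integrals. *)
Lemma form_harm_w (x : R) : 0 < x < PI / 3 ->
  (dlcurve (/ 2) x * Li harm 0 (qcurve (- (PI / 3)) (/ 2) x))%C = (- RtoC x)%C.
Proof.
intros Hx; pose proof (form_w x Hx) as E.
rewrite Li_harm_0 by (apply Cmod_qcurve_lt_1; exact Hx).
rewrite Li_one_0 in E by (apply Cmod_qcurve_lt_1; exact Hx).
rewrite Li_one_1_w by exact Hx.
set (u := (qcurve (- (PI / 3)) (/ 2) x / (1 - qcurve (- (PI / 3)) (/ 2) x))%C) in *.
replace (dlcurve (/ 2) x * (- RtoC x * Ci * u))%C with (- RtoC x * Ci * (dlcurve (/ 2) x * u))%C by ring.
rewrite E; apply C_eq; simpl; ring.
Qed.

(** Real and imaginary parts of (u + i v) ^ 5, and the imaginary part of (u + i v) ^ 4, expanded so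
    that integrands can be compared as rational expressions. *)
Definition re5 (u v : R) : R := u ^ 5 - 10 * u ^ 3 * v ^ 2 + 5 * u * v ^ 4.
Definition im5 (u v : R) : R := 5 * u ^ 4 * v - 10 * u ^ 2 * v ^ 3 + v ^ 5.
Definition im4 (u v : R) : R := 4 * u ^ 3 * v - 4 * u * v ^ 3.

Lemma Im_Li_neg (c : nat -> R) (k : nat) (x : R) : Im (Li c k (cis (- x))) = - Im (Li c k (cis x)).
Proof. rewrite cis_opp, Li_conj; reflexivity. Qed.

Lemma Re_Li_neg (c : nat -> R) (k : nat) (x : R) : Re (Li c k (cis (- x))) = Re (Li c k (cis x)).
Proof. rewrite cis_opp, Li_conj; reflexivity. Qed.

Lemma RtoC_mult_Im (r : R) (z : C) : Im (RtoC r * z)%C = r * Im z.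
Proof. destruct z; simpl; ring. Qed.

Lemma RtoC_mult_Re (r : R) (z : C) : Re (RtoC r * z)%C = r * Re z.
Proof. destruct z; simpl; ring. Qed.

Lemma INR_fact_5 : (-1) ^ 5 * INR (fact 5) = -120.
Proof. simpl; ring. Qed.

Lemma INR_fact_4 : (-1) ^ 4 * INR (fact 4) = 24.
Proof. simpl; ring. Qed.

(** The integrand is the imaginary part of - (L + i v) ^ 5 ([dgap] + i). The curve ends at 1, where
    the polylogarithm is real, hence the value 0. *)
Lemma nint_form_32 :
  nint (fun x => - (dgap x * im5 (lsin x) (3 / 2 * (x - PI / 3)) + re5 (lsin x) (3 / 2 * (x - PI / 3))))
    0 (PI / 3) 0.
Proof.
destruct (cnint_qcurve one 0 (3 / 2) 5 summable2_one sublinear_one) as [_ HI]; [lia|].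
refine (nint_eq _ _ _ _ _ (nint_ext _ _ _ _ _ _ HI) _).
- intros x Hx; rewrite <- Cmult_assoc, form_32 by exact Hx.
  unfold lcurve, dgapC, re5, im5; simpl; ring.
- rewrite RtoC_mult_Im, cis_0, Li_real; ring.
Qed.

(** Of the two end points 1 and exp (- 2 i PI / 3), only the second has an imaginary part to
    contribute. *)
Lemma nint_form_half :
  nint (fun x => - (dgap x * im5 (lsin x) (/ 2 * (x - PI / 3)) + re5 (lsin x) (/ 2 * (x - PI / 3))))
    0 (PI / 3) (120 * t6).
Proof.
destruct (cnint_qcurve one 0 (/ 2) 5 summable2_one sublinear_one) as [_ H1]; [lia|].
destruct (cnint_qcurve one (- (2 * (PI / 3))) (/ 2) 5 summable2_one sublinear_one) as [_ H2]; [lia|].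
refine (nint_eq _ _ _ _ _ (nint_ext _ _ _ _ _ _ (nint_plus _ _ _ _ _ _ H1 H2)) _).
- intros x Hx.
  transitivity (Im (lcurve (/ 2) x ^ 5 * - dgapC x)%C); [|unfold lcurve, dgapC, re5, im5; simpl; ring].
  rewrite <- (form_half x Hx), Cmult_plus_distr_l, Cmult_plus_distr_l, !Cmult_assoc; reflexivity.
- rewrite !RtoC_mult_Im, cis_0, Li_real, Im_Li_neg, INR_fact_5; fold t6; ring.
Qed.

Lemma nint_form_w : nint (fun x => - re5 (lsin x) (/ 2 * (x - PI / 3))) 0 (PI / 3) (120 * s6).
Proof.
destruct (cnint_qcurve one (- (PI / 3)) (/ 2) 5 summable2_one sublinear_one) as [_ HI]; [lia|].
refine (nint_eq _ _ _ _ _ (nint_ext _ _ _ _ _ _ HI) _).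
- intros x Hx; rewrite <- Cmult_assoc, form_w by exact Hx.
  unfold lcurve, re5; simpl; ring.
- rewrite RtoC_mult_Im, Im_Li_neg, INR_fact_5; fold s6; ring.
Qed.

Lemma nint_im4 : nint (fun x => im4 (lsin x) (/ 2 * (x - PI / 3))) 0 (PI / 3) (24 * c5).
Proof.
destruct (cnint_qcurve one (- (PI / 3)) (/ 2) 4 summable2_one sublinear_one) as [HR _]; [lia|].
refine (nint_eq _ _ _ _ _ (nint_ext _ _ _ _ _ _ HR) _).
- intros x Hx; rewrite <- Cmult_assoc, form_w by exact Hx.
  unfold lcurve, im4; simpl; ring.
- rewrite RtoC_mult_Re, Re_Li_neg, INR_fact_4; fold c5; ring.
Qed.

Lemma nint_x_im4 :
  nint (fun x => x * im4 (lsin x) (/ 2 * (x - PI / 3))) 0 (PI / 3) (24 * Im (Li harm 5 (cis (PI / 3)))).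
Proof.
destruct (cnint_qcurve harm (- (PI / 3)) (/ 2) 4 summable2_harm sublinear_harm) as [_ HI]; [lia|].
apply (nint_scal (-1)) in HI.
refine (nint_eq _ _ _ _ _ (nint_ext _ _ _ _ _ _ HI) _).
- intros x Hx; rewrite <- Cmult_assoc, form_harm_w by exact Hx.
  unfold lcurve, im4; simpl; ring.
- rewrite RtoC_mult_Im, Im_Li_neg, INR_fact_4; ring.
Qed.

(** With angle PI and slope 0 the curve is the real segment q = - [chord], where the order 0 series
    is - t / (1 + t). *)
Lemma nint_alternating :
  nint (fun x => lsin x ^ 4 * (dlsin x * chord x / (1 + chord x))) 0 (PI / 3) (- 24 * Re (Li one 5 (-1))).
Proof.
destruct (cnint_qcurve one PI 0 4 summable2_one sublinear_one) as [HR _]; [lia|].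
apply (nint_scal (-1)) in HR.
refine (nint_eq _ _ _ _ _ (nint_ext _ _ _ _ _ _ HR) _).
- intros x Hx; pose proof (chord_bounds x Hx) as Hc.
  rewrite Li_one_0 by (apply Cmod_qcurve_lt_1; exact Hx).
  assert (Eq : qcurve PI 0 x = RtoC (- chord x)).
  { unfold qcurve; replace (PI + 0 * (x - PI / 3)) with PI by ring; rewrite cis_PI, RtoC_opp; ring. }
  assert (El : lcurve 0 x = RtoC (lsin x)) by (unfold lcurve; apply C_eq; simpl; ring).
  assert (Ed : dlcurve 0 x = RtoC (dlsin x)) by reflexivity.
  rewrite Eq, El, Ed, <- RtoC_pow, <- RtoC_minus, <- RtoC_div, <- !RtoC_mult by lra.
  cbn [Re RtoC fst]; field; lra.
- rewrite RtoC_mult_Re, cis_PI, INR_fact_4; ring.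
Qed.

(** The integrand is the derivative of x L ^ 5 / 5. This exchanges x L ^ 4 dL, which comes from the
    weight 4, for L ^ 5. *)
Lemma nint_by_parts_lsin :
  nint (fun x => x * lsin x ^ 4 * dlsin x + / 5 * lsin x ^ 5) 0 (PI / 3) 0.
Proof.
pose proof PI_RGT_0.
set (F := fun x => / 5 * (x * lsin x ^ 5)).
assert (HF : forall x, 0 < x < 2 * PI -> is_derive F x (x * lsin x ^ 4 * dlsin x + / 5 * lsin x ^ 5)).
{ intros x Hx; pose proof (is_derive_lsin x Hx) as Hd.
  eapply is_derive_eq.
  + apply is_derive_scal, (is_derive_mult (K := R_AbsRing) (fun x => x) (fun x => lsin x ^ 5));
      [apply is_derive_id|apply (is_derive_pow lsin 5), Hd|apply Rmult_comm].
  + unfold Hierarchy.plus, Hierarchy.mult, Hierarchy.one; simpl; field. }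
exists F, 0, 0; split; [|split; [|split]]; try ring.
- intros x Hx; apply HF; lra.
- apply (filterlim_zero_of_le _ (fun x => 2 / 5 * (Cmod (lcurve 0 x) ^ 5 * chord x)));
    [|apply lcurve_pow_chord_lim; lra].
  assert (H3 : 0 < PI / 3) by lra.
  generalize (at_right_lt 0 _ H3); apply filter_imp; intros x Hx.
  unfold F; rewrite !Rabs_mult, (Rabs_pos_eq x), (Rabs_pos_eq (/ 5)) by lra.
  (* The derivative cos (y / 2) of [chord] is at least 1 / 2 here, so x can be traded for [chord]
     and the decay lemma applies. *)
  assert (Hc : x <= 2 * chord x).
  { destruct (MVT_gen chord 0 x (fun y => cos (y / 2))) as [y [Hy1 Hy2]].
    - intros y _; apply is_derive_chord.
    - intros y _; apply continuity_pt_filterlim, (is_derive_continuous _ _ _ (is_derive_chord _)).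
    - rewrite chord_0 in Hy2; rewrite Rmin_left, Rmax_right in Hy1 by lra.
      assert (cos (PI / 3) <= cos (y / 2)) by (apply cos_decr_1; lra).
      rewrite cos_PI3 in *; nra. }
  rewrite <- RPow_abs.
  assert (Hl : Rabs (lsin x) ^ 5 <= Cmod (lcurve 0 x) ^ 5).
  { apply pow_incr; split; [apply Rabs_pos|apply (re_le_Cmod (lcurve 0 x))]. }
  assert (0 <= Rabs (lsin x) ^ 5) by (apply pow_le, Rabs_pos).
  assert (x * Rabs (lsin x) ^ 5 <= 2 * chord x * Cmod (lcurve 0 x) ^ 5) by (apply Rmult_le_compat; lra).
  lra.
- assert (Hp : 0 < PI / 3 < 2 * PI) by lra.
  pose proof (filterlim_at_left_of_continuous _ _ (is_derive_continuous _ _ _ (HF _ Hp))) as H1.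
  assert (E : F (PI / 3) = 0) by (unfold F; rewrite lsin_chord, chord_end, ln_1; ring).
  rewrite E in H1; exact H1.
Qed.

(** Integrating by parts replaces [dgap] by the logarithm ln (2 cos x - 1), which factors into two
    values of [lsin]. At PI / 3 this logarithm diverges, but only as ln h against h ^ 5. *)
Lemma nint_gap_by_parts :
  nint (fun x => (PI / 3 - x) ^ 5 * dgap x - 5 * (PI / 3 - x) ^ 4 * ln (2 * cos x - 1)) 0 (PI / 3) 0.
Proof.
pose proof PI_RGT_0.
exists (fun x => (PI / 3 - x) ^ 5 * ln (2 * cos x - 1)), 0, 0; split; [|split; [|split]]; try ring.
- intros x Hx; pose proof (gap_pos x (conj (Rlt_le _ _ (proj1 Hx)) (proj2 Hx))) as Hg.
  unfold dgap; auto_derive; [lra|]; change (2 * cos x + - (1)) with (2 * cos x - 1); field; lra.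
- assert (E : (PI / 3 - 0) ^ 5 * ln (2 * cos 0 - 1) = 0).
  { rewrite cos_0; replace (2 * 1 - 1) with 1 by ring; rewrite ln_1; ring. }
  assert (Hl : filterlim (fun x => (PI / 3 - x) ^ 5 * ln (2 * cos x - 1)) (at_right 0)
    (locally ((PI / 3 - 0) ^ 5 * ln (2 * cos 0 - 1)))).
  { apply (filterlim_at_right_of_continuous (fun x => (PI / 3 - x) ^ 5 * ln (2 * cos x - 1))).
    apply (ex_derive_continuous (fun x => (PI / 3 - x) ^ 5 * ln (2 * cos x - 1))).
    auto_derive; rewrite cos_0; lra. }
  rewrite E in Hl; exact Hl.
- apply (filterlim_zero_of_le _ (fun x => PI ^ 3 * (PI / 3 - x))).
  + assert (H6 : PI / 6 < PI / 3) by lra.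
    generalize (at_left_gt _ _ H6); apply filter_imp; intros x Hx.
    assert (Hx0 : 0 <= x < PI / 3) by lra.
    pose proof (gap_pos x Hx0) as Hg.
    (* Beyond PI / 6 the derivative of 2 cos x has modulus 2 sin x >= 1. *)
    assert (Hle : PI / 3 - x <= 2 * cos x - 1).
    { destruct (MVT_gen cos x (PI / 3) (fun y => - sin y)) as [y [Hy1 Hy2]].
      - intros y _; auto_derive; auto; ring.
      - intros y _; apply continuity_pt_filterlim, (ex_derive_continuous cos); auto_derive; auto.
      - rewrite cos_PI3 in Hy2; rewrite Rmin_left, Rmax_right in Hy1 by lra.
        assert (sin (PI / 6) <= sin y) by (apply sin_incr_1; lra).
        rewrite sin_PI6 in *; nra. }
    assert (Hl1 : ln (2 * cos x - 1) <= 0).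
    { rewrite <- ln_1; apply ln_le; [lra|]; pose proof (COS_bound x); lra. }
    (* This is ln u <= u - 1 at the inverse u of 2 cos x - 1; with [Hle] it gives h |ln (2 cos x -
       1)| <= 1. *)
    assert (Hl2 : - ln (2 * cos x - 1) * (2 * cos x - 1) <= 1).
    { rewrite <- ln_Rinv by lra.
      pose proof (exp_ineq1_le (ln (/ (2 * cos x - 1)))) as H1.
      rewrite exp_ln in H1 by (apply Rinv_0_lt_compat; lra).
      assert (/ (2 * cos x - 1) * (2 * cos x - 1) = 1) by (apply Rinv_l; lra).
      nra. }
    rewrite Rabs_mult, <- (Rabs_Ropp (ln _)), !Rabs_pos_eq by (try apply pow_le; lra).
    set (h := PI / 3 - x) in *; set (l := - ln (2 * cos x - 1)) in *.
    assert (Hh : 0 < h <= PI) by (unfold h; lra).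
    assert (h * l <= 1) by (unfold l in *; nra).
    replace (h ^ 5 * l) with (h ^ 3 * h * (h * l)) by ring.
    assert (0 <= h ^ 3 <= PI ^ 3) by (split; [apply pow_le; lra|apply pow_incr; lra]).
    apply Rle_trans with (h ^ 3 * h * 1); [apply Rmult_le_compat_l; nra|nra].
  + apply filterlim_scal_zero.
    assert (Hl : filterlim (fun x => PI / 3 - x) (at_left (PI / 3)) (locally (PI / 3 - PI / 3))).
    { apply filterlim_Rminus; [apply filterlim_const|apply filterlim_id_at_left]. }
    rewrite Rminus_diag in Hl; exact Hl.
Qed.

Lemma nint_gap_H5 :
  nint (fun x => (PI / 3 - x) ^ 5 * dgap x) 0 (PI / 3)
    (5 * (- 8 * (PI / 3) ^ 3 * c3 + 48 * (PI / 3) * c5 - 24 * t6)).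
Proof.
pose proof PI_RGT_0.
refine (nint_eq _ _ _ _ _ (nint_ext _ _ _ _ _ _
  (nint_plus _ _ _ _ _ _ nint_gap_by_parts (nint_scal 5 _ _ _ _ nint_reflected))) _); [|ring].
intros x Hx; cbv beta; rewrite gap_chord_mult.
assert (H1 : 0 < chord (PI / 3 - x)).
{ unfold chord; assert (0 < sin ((PI / 3 - x) / 2)) by (apply sin_half_pos; lra); lra. }
assert (H2 : 0 < chord (PI / 3 + x)).
{ unfold chord; assert (0 < sin ((PI / 3 + x) / 2)) by (apply sin_half_pos; lra); lra. }
rewrite ln_mult by assumption; rewrite !lsin_chord; ring.
Qed.

(** * Multisection *)

(** The terms kept are those of rank a multiple of [S e]: rank and index differ by one, whence the
    index n (e + 1) + e. The partial sums of the right side form a subsequence of those on the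
    left. *)
Lemma Series_multiples (e : nat) (a : nat -> R) :
  ex_series a -> (forall n j, (j < e)%nat -> a (n * S e + j)%nat = 0) ->
  Series a = Series (fun n => a (n * S e + e)%nat).
Proof.
intros Ha H0.
assert (Hskip : forall n j, (j < e)%nat -> sum_f_R0 a (n * S e + e + S j) = sum_f_R0 a (n * S e + e)).
{ intros n j; induction j as [|j IH]; intros Hj.
  - rewrite Nat.add_1_r; simpl sum_f_R0.
    replace (S (n * S e + e)) with (S n * S e + 0)%nat by lia; rewrite H0 by lia; ring.
  - rewrite Nat.add_succ_r; simpl sum_f_R0; rewrite IH by lia.
    replace (S (n * S e + e + S j)) with (S n * S e + S j)%nat by lia; rewrite H0 by lia; ring. }
assert (Hstart : sum_f_R0 a e = a e).
{ destruct e as [|e]; [reflexivity|].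
  assert (Hz : forall j, (j < S e)%nat -> sum_f_R0 a j = 0).
  { induction j as [|j IH]; intros Hj; simpl; [apply (H0 0%nat 0%nat); lia|].
    rewrite IH by lia; pose proof (H0 0%nat (S j) Hj) as E; simpl in E; rewrite E; ring. }
  simpl; rewrite Hz by lia; ring. }
assert (Hsum : forall N, sum_f_R0 a (N * S e + e) = sum_f_R0 (fun n => a (n * S e + e)%nat) N).
{ induction N as [|N IH]; [exact Hstart|].
  replace (S N * S e + e)%nat with (S (N * S e + e + e)) by lia.
  simpl sum_f_R0; rewrite <- IH.
  replace (S (N * S e + e + e)) with (S N * S e + e)%nat by lia; f_equal.
  destruct e as [|e]; [f_equal; lia|].
  rewrite Hskip by lia; reflexivity. }
symmetry; apply is_series_unique.
change (is_lim_seq (sum_n (fun n => a (n * S e + e)%nat)) (Series a)).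
apply is_lim_seq_ext with (fun N => sum_n a (N * S e + e)).
- intros N; rewrite !sum_n_Reals; apply Hsum.
- apply (is_lim_seq_subseq (sum_n a) (Series a) (fun N => (N * S e + e)%nat)).
  + intros P [N0 HN]; exists N0; intros n Hn; apply HN; nia.
  + exact (Series_correct _ Ha).
Qed.

Lemma CSeries_multiples (e : nat) (a : nat -> C) (M : nat -> R) :
  (forall n, Cmod (a n) <= M n) -> ex_series M ->
  (forall n j, (j < e)%nat -> a (n * S e + j)%nat = 0) ->
  CSeries a = CSeries (fun n => a (n * S e + e)%nat).
Proof.
intros H HM H0; unfold CSeries; f_equal.
- apply (Series_multiples e (fun n => Re (a n))); [apply (ex_series_Re a M); auto|].
  intros n j Hj; rewrite H0 by exact Hj; reflexivity.
- apply (Series_multiples e (fun n => Im (a n))); [apply (ex_series_Im a M); auto|].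
  intros n j Hj; rewrite H0 by exact Hj; reflexivity.
Qed.

Lemma INR_multiple (e n k : nat) :
  one n / INR (S (n * S e + e)) ^ k * INR (S e) ^ k = one n / INR (S n) ^ k.
Proof.
replace (S (n * S e + e)) with (S n * S e)%nat by lia.
rewrite mult_INR, Rpow_mult_distr.
pose proof (INR_S_pow_ge_1 n k); pose proof (INR_S_pow_ge_1 e k); field; lra.
Qed.

(** Odd powers of q and - q cancel, even ones double, and the denominators (2 n) ^ k yield the
    factor 2 ^ k. *)
Lemma Li_duplication (k : nat) (q : C) : (2 <= k)%nat -> Cmod q <= 1 ->
  (RtoC (2 ^ k) * (Li one k q + Li one k (- q)) = 2 * Li one k (q ^ 2))%C.
Proof.
intros Hk Hq.
set (M := fun n => Rabs (one n) / INR (S n) ^ 2).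
assert (HM : ex_series M) by exact summable2_one.
assert (HM2 : ex_series (fun n => M n + M n)) by (apply (ex_series_plus (V := R_NormedModule)); exact HM).
assert (Hq2 : Cmod (- q) <= 1) by (rewrite Cmod_opp; exact Hq).
assert (Hq3 : Cmod (q ^ 2)%C <= 1) by (rewrite Cmod_pow; apply Cmod_pow_le_1, Hq).
pose proof (fun n => Li_term_le2 one k n q Hk Hq) as B1.
pose proof (fun n => Li_term_le2 one k n (- q)%C Hk Hq2) as B2.
pose proof (fun n => Li_term_le2 one k n (q ^ 2)%C Hk Hq3) as B3.
unfold Li at 1 2; rewrite <- (CSeries_plus _ _ M M B1 HM B2 HM).
assert (B12 : forall n, Cmod (RtoC (one n / INR (S n) ^ k) * q ^ S n + RtoC (one n / INR (S n) ^ k) * (- q) ^ S n)%C <= M n + M n).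
{ intros n; eapply Rle_trans; [apply Cmod_triangle|apply Rplus_le_compat; auto]. }
assert (Hsq : forall n, ((- q) ^ (n * 2) = q ^ (n * 2))%C).
{ intros n; rewrite Nat.mul_comm, !Cpow_mult_r; f_equal; ring. }
rewrite (CSeries_multiples 1 _ _ B12 HM2).
- rewrite <- (CSeries_scal _ _ (fun n => M (n * 2 + 1)%nat + M (n * 2 + 1)%nat)).
  + unfold Li; rewrite <- (CSeries_scal 2 _ M B3 HM).
    apply CSeries_ext; intros n.
    rewrite <- (INR_multiple 1 n k).
    replace (S (n * 2 + 1)) with (S n * 2)%nat by lia.
    rewrite (Hsq (S n)), (Nat.mul_comm (S n) 2), Cpow_mult_r, RtoC_mult.
    unfold one; replace (INR 2) with 2 by (simpl; ring); ring.
  + intros n; apply (B12 (n * 2 + 1)%nat).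
  + assert (E : forall n, M (n * 2 + 1)%nat + M (n * 2 + 1)%nat <= 2 * M n).
    { intros n; unfold M; rewrite <- Rdiv_plus_distr.
      unfold one; rewrite Rabs_R1.
      pose proof (INR_S_ge_1 n).
      assert (INR (S n) ^ 2 <= INR (S (n * 2 + 1)) ^ 2).
      { apply pow_incr; split; [lra|apply le_INR; lia]. }
      replace (2 * (1 / INR (S n) ^ 2)) with ((1 + 1) / INR (S n) ^ 2) by (field; lra).
      apply Rmult_le_compat_l; [lra|apply Rinv_le_contravar; [apply pow_lt; lra|auto]]. }
    apply (ex_series_le_R _ (fun n => 2 * M n)).
    * intros n; rewrite Rabs_pos_eq; [apply E|].
      apply Rplus_le_le_0_compat; apply weight_div_pos.
    * apply ex_series_Rmult_l, HM.
- intros n j Hj; replace j with 0%nat by lia; rewrite Nat.add_0_r, !Cpow_S, Hsq; ring.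
Qed.

(** The sum 1 + w ^ n + w ^ (2 n) is 3 if 3 divides n and 0 otherwise. *)
Lemma Li_triplication (k : nat) (w : C) : (2 <= k)%nat -> Cmod w <= 1 ->
  (1 + w + w ^ 2 = 0)%C ->
  (RtoC (3 ^ k) * (Li one k 1 + Li one k w + Li one k (w ^ 2)) = 3 * Li one k 1)%C.
Proof.
intros Hk Hw Hw0.
set (M := fun n => Rabs (one n) / INR (S n) ^ 2).
assert (HM : ex_series M) by exact summable2_one.
assert (HM2 : ex_series (fun n => M n + M n)) by (apply (ex_series_plus (V := R_NormedModule)); exact HM).
assert (HM3 : ex_series (fun n => M n + M n + M n))
  by (apply (ex_series_plus (V := R_NormedModule)); [exact HM2|exact HM]).
assert (H1 : Cmod 1 <= 1) by (rewrite Cmod_1; lra).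
assert (Hw2 : Cmod (w ^ 2)%C <= 1) by (rewrite Cmod_pow; apply Cmod_pow_le_1, Hw).
pose proof (fun n => Li_term_le2 one k n 1%C Hk H1) as B1.
pose proof (fun n => Li_term_le2 one k n w Hk Hw) as B2.
pose proof (fun n => Li_term_le2 one k n (w ^ 2)%C Hk Hw2) as B3.
assert (B12 : forall n, Cmod (RtoC (one n / INR (S n) ^ k) * 1 ^ S n + RtoC (one n / INR (S n) ^ k) * w ^ S n)%C <= M n + M n).
{ intros n; eapply Rle_trans; [apply Cmod_triangle|apply Rplus_le_compat; auto]. }
assert (B123 : forall n, Cmod (RtoC (one n / INR (S n) ^ k) * 1 ^ S n + RtoC (one n / INR (S n) ^ k) * w ^ S n
  + RtoC (one n / INR (S n) ^ k) * (w ^ 2) ^ S n)%C <= M n + M n + M n).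
{ intros n; eapply Rle_trans; [apply Cmod_triangle|apply Rplus_le_compat; auto]. }
unfold Li at 1 2 3; rewrite <- (CSeries_plus _ _ M M B1 HM B2 HM).
rewrite <- (CSeries_plus _ _ _ M B12 HM2 B3 HM).
assert (Hw3 : (w ^ 3 = 1)%C).
{ replace (w ^ 3)%C with (1 + (w - 1) * (1 + w + w ^ 2))%C by ring; rewrite Hw0; ring. }
assert (Hp : forall n, (w ^ (n * 3) = 1)%C).
{ intros n; rewrite Nat.mul_comm, Cpow_mult_r, Hw3, Cpow_1_l; reflexivity. }
assert (Hp2 : forall n, ((w ^ 2) ^ (n * 3) = 1)%C).
{ intros n; rewrite <- Cpow_mult_r; replace (2 * (n * 3))%nat with (2 * n * 3)%nat by lia; apply Hp. }
rewrite (CSeries_multiples 2 _ _ B123 HM3).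
- rewrite <- (CSeries_scal _ _ (fun n => M (n * 3 + 2)%nat + M (n * 3 + 2)%nat + M (n * 3 + 2)%nat)).
  + unfold Li; rewrite <- (CSeries_scal 3 _ M B1 HM).
    apply CSeries_ext; intros n.
    rewrite <- (INR_multiple 2 n k).
    replace (S (n * 3 + 2)) with (S n * 3)%nat by lia.
    rewrite (Hp (S n)), (Hp2 (S n)), !Cpow_1_l, RtoC_mult.
    unfold one; replace (INR 3) with 3 by (simpl; ring); ring.
  + intros n; apply (B123 (n * 3 + 2)%nat).
  + assert (E : forall n, M (n * 3 + 2)%nat <= M n).
    { intros n; unfold M, one; rewrite Rabs_R1.
      pose proof (INR_S_ge_1 n).
      assert (INR (S n) ^ 2 <= INR (S (n * 3 + 2)) ^ 2).
      { apply pow_incr; split; [lra|apply le_INR; lia]. }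
      apply Rmult_le_compat_l; [lra|apply Rinv_le_contravar; [apply pow_lt; lra|auto]]. }
    apply (ex_series_le_R _ (fun n => 3 * M n)).
    * intros n; pose proof (E n); assert (0 <= M (n * 3 + 2)%nat) by apply weight_div_pos.
      rewrite Rabs_pos_eq; lra.
    * apply ex_series_Rmult_l, HM.
- intros n j Hj; rewrite <- Nat.add_succ_r, !Cpow_add_r, Hp, Hp2, !Cpow_1_l.
  assert (Hj2 : j = 0%nat \/ j = 1%nat) by lia.
  set (c := RtoC (one (n * 3 + j) / INR (n * 3 + S j) ^ k)).
  destruct Hj2 as [-> | ->].
  + transitivity (c * (1 + w + w ^ 2))%C; [simpl; ring|rewrite Hw0; ring].
  + transitivity (c * (1 + w + w ^ 2) * (1 - w + w ^ 2))%C; [simpl; ring|rewrite Hw0; ring].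
Qed.

Lemma cis_2PI (x : R) : cis (x + 2 * PI) = cis x.
Proof.
unfold cis; rewrite cos_plus, sin_plus, cos_2PI, sin_2PI; apply C_eq; simpl; ring.
Qed.

Lemma cis_2PI3 : (1 + cis (2 * (PI / 3)) + cis (2 * (PI / 3)) ^ 2 = 0)%C.
Proof.
replace (cis (2 * (PI / 3)) ^ 2)%C with (cis (- (2 * (PI / 3)))).
- unfold cis; rewrite cos_neg, sin_neg, cos_2a_cos, cos_PI3; apply C_eq; simpl; field.
- rewrite Cpow_S, Cpow_1_r, <- cis_plus.
  replace (2 * (PI / 3) + 2 * (PI / 3)) with (- (2 * (PI / 3)) + 2 * PI) by field.
  rewrite cis_2PI; reflexivity.
Qed.

Lemma cis_PI3_opp : (- cis (PI / 3))%C = cis (- (2 * (PI / 3))).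
Proof.
replace (- (2 * (PI / 3))) with (PI / 3 - PI) by field.
unfold Rminus; rewrite cis_plus, cis_opp, cis_PI; apply C_eq; simpl; ring.
Qed.

(** Duplication at q = exp (i PI / 3), for which q ^ 2 = exp (2 i PI / 3) and - q is its
    conjugate. *)
Lemma Li_PI3_dup (k : nat) : (2 <= k)%nat ->
  (RtoC (2 ^ k) * (Li one k (cis (PI / 3)) + Cconj (Li one k (cis (2 * (PI / 3)))))
  = 2 * Li one k (cis (2 * (PI / 3))))%C.
Proof.
intros Hk.
assert (Hc : Cmod (cis (PI / 3)) <= 1) by (rewrite Cmod_cis; lra).
rewrite <- Li_conj, <- cis_opp, <- cis_PI3_opp.
rewrite Li_duplication by assumption.
replace (2 * (PI / 3)) with (PI / 3 + PI / 3) by ring; rewrite cis_plus.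
do 2 f_equal; simpl; ring.
Qed.

Lemma Re_Li_2PI3 (k : nat) : (2 <= k)%nat ->
  3 ^ k * (zeta k + 2 * Re (Li one k (cis (2 * (PI / 3))))) = 3 * zeta k.
Proof.
intros Hk.
assert (Hc : Cmod (cis (2 * (PI / 3))) <= 1) by (rewrite Cmod_cis; lra).
pose proof (Li_triplication k _ Hk Hc cis_2PI3) as H.
replace (cis (2 * (PI / 3)) ^ 2)%C with (Cconj (cis (2 * (PI / 3)))) in H.
- rewrite Li_conj in H; apply (f_equal Re) in H.
  rewrite <- !Li_one_zeta; simpl in H |- *; lra.
- rewrite <- cis_opp, Cpow_S, Cpow_1_r, <- cis_plus.
  replace (2 * (PI / 3) + 2 * (PI / 3)) with (- (2 * (PI / 3)) + 2 * PI) by field.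
  rewrite cis_2PI; reflexivity.
Qed.

Lemma Re_Li_PI3 (k : nat) : (2 <= k)%nat ->
  2 ^ k * (Re (Li one k (cis (PI / 3))) + Re (Li one k (cis (2 * (PI / 3)))))
  = 2 * Re (Li one k (cis (2 * (PI / 3)))).
Proof.
intros Hk; pose proof (f_equal Re (Li_PI3_dup k Hk)) as H; simpl in H |- *; lra.
Qed.

(** Conjugation changes the sign here but not in [Re_Li_PI3]. So the sine sums have ratio 1 + 2 ^ (1
    - k), which is 33 / 32 for k = 6, and no second relation evaluates them. *)
Lemma Im_Li_PI3 (k : nat) : (2 <= k)%nat ->
  2 ^ k * (Im (Li one k (cis (PI / 3))) - Im (Li one k (cis (2 * (PI / 3)))))
  = 2 * Im (Li one k (cis (2 * (PI / 3)))).
Proof.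
intros Hk; pose proof (f_equal Im (Li_PI3_dup k Hk)) as H; simpl in H |- *; lra.
Qed.

Lemma c3_zeta : c3 = / 3 * zeta 3.
Proof.
assert (Hk : (2 <= 3)%nat) by lia.
pose proof (Re_Li_2PI3 3 Hk); pose proof (Re_Li_PI3 3 Hk); unfold c3; lra.
Qed.

Lemma c5_zeta : c5 = 25 / 54 * zeta 5.
Proof.
assert (Hk : (2 <= 5)%nat) by lia.
pose proof (Re_Li_2PI3 5 Hk); pose proof (Re_Li_PI3 5 Hk); unfold c5; lra.
Qed.

Lemma s6_t6 : s6 = 33 / 32 * t6.
Proof.
assert (Hk : (2 <= 6)%nat) by lia.
pose proof (Im_Li_PI3 6 Hk); unfold s6, t6; lra.
Qed.

Lemma Li_5_minus_1 : Re (Li one 5 (-1)) = - 15 / 16 * zeta 5.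
Proof.
assert (Hk : (2 <= 5)%nat) by lia.
assert (H1 : Cmod 1 <= 1) by (rewrite Cmod_1; lra).
pose proof (f_equal Re (Li_duplication 5 1 Hk H1)) as H.
replace (- (1))%C with (RtoC (-1)) in H by (apply C_eq; simpl; ring).
rewrite Cpow_1_l in H.
pose proof (Li_one_zeta 5) as Hz.
simpl in H; simpl in Hz |- *; lra.
Qed.

(** * The series of the theorem *)

(** Taylor coefficients in y of 1 / sqrt (1 - y / 4), and below of 2 arcsin (sqrt y / 2) / sqrt y;
    at y = t ^ 2 the latter sums to x / t. *)
Definition cbin (k : nat) : R := Binomial.C (2 * k) k / 16 ^ k.
Definition asc (k : nat) : R := Binomial.C (2 * k) k / (INR (2 * k + 1) * 16 ^ k).

Lemma odd_pos (k : nat) : 1 <= INR (2 * k + 1).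
Proof. rewrite Nat.add_1_r; apply INR_S_ge_1. Qed.

Lemma cbin_asc (k : nat) : cbin k = (1 + 2 * INR k) * asc k.
Proof.
unfold cbin, asc; pose proof (odd_pos k) as H.
rewrite plus_INR, mult_INR in *; simpl (INR 2) in *; simpl (INR 1) in *.
field; split; [apply pow_nonzero; lra|lra].
Qed.

(** The recurrence is the differential equation (1 - y / 4) f' = f / 8, coefficient by
    coefficient. *)
Lemma cbin_S (k : nat) : INR (S k) * cbin (S k) = (/ 8 + / 4 * INR k) * cbin k.
Proof.
unfold cbin, Binomial.C.
replace (2 * S k - S k)%nat with (S k) by lia; replace (2 * k - k)%nat with k by lia.
replace (2 * S k)%nat with (S (S (2 * k))) by lia.
rewrite !fact_simpl, !mult_INR.
pose proof (INR_fact_neq_0 k); pose proof (INR_S_ge_1 k).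
rewrite (S_INR (S (2 * k))), (S_INR (2 * k)), mult_INR, (S_INR k) in *.
simpl (INR 2); simpl (16 ^ S k).
assert (16 ^ k <> 0) by (apply pow_nonzero; lra).
field; repeat split; auto; lra.
Qed.

Lemma cbin_bound (k : nat) : 0 < cbin k /\ cbin k * 4 ^ k <= 1.
Proof.
induction k as [|k [IH1 IH2]].
- unfold cbin, Binomial.C; simpl; lra.
- pose proof (cbin_S k) as H; pose proof (INR_S_ge_1 k) as Hs; pose proof (pos_INR k) as Hk.
  assert (E : cbin (S k) = (/ 8 + / 4 * INR k) / INR (S k) * cbin k)
    by (apply Rmult_eq_reg_l with (INR (S k)); [rewrite H; field; lra|lra]).
  assert (Hr : 0 < (/ 8 + / 4 * INR k) / INR (S k)) by (apply Rdiv_lt_0_compat; lra).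
  assert (Hr2 : (/ 8 + / 4 * INR k) / INR (S k) <= / 4).
  { apply Rmult_le_reg_r with (INR (S k)); [lra|].
    unfold Rdiv; rewrite Rmult_assoc, Rinv_l by lra; rewrite S_INR; lra. }
  split; [rewrite E; nra|].
  rewrite E; simpl (4 ^ S k).
  replace ((/ 8 + / 4 * INR k) / INR (S k) * cbin k * (4 * 4 ^ k))
    with (((/ 8 + / 4 * INR k) / INR (S k) * 4) * (cbin k * 4 ^ k)) by ring.
  assert (0 <= cbin k * 4 ^ k) by (apply Rmult_le_pos; [lra|apply pow_le; lra]).
  nra.
Qed.

Lemma asc_bound (k : nat) : 0 < asc k /\ asc k <= cbin k.
Proof.
pose proof (cbin_asc k) as E; destruct (cbin_bound k) as [H _]; pose proof (pos_INR k).
assert (0 < asc k).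
{ apply Rmult_lt_reg_l with (1 + 2 * INR k); [lra|]; rewrite <- E; lra. }
split; auto; rewrite E; nra.
Qed.

Lemma CV_radius_ge_4 (a : nat -> R) : (forall k, 0 <= a k <= cbin k) -> Rbar_le 4 (CV_radius a).
Proof.
intros H; apply (CV_radius_bounded a); exists 1; intros n.
destruct (cbin_bound n) as [_ Hb]; specialize (H n).
assert (0 <= 4 ^ n) by (apply pow_le; lra).
rewrite Rabs_pos_eq by nra; nra.
Qed.

Lemma CV_radius_lt (a : nat -> R) (y : R) :
  (forall k, 0 <= a k <= cbin k) -> Rabs y < 4 -> Rbar_lt (Rabs y) (CV_radius a).
Proof. intros H Hy; apply Rbar_lt_le_trans with 4; [exact Hy|apply CV_radius_ge_4, H]. Qed.

(** Multiplying coefficients by n is the operator y d/dy; this turns the recurrences for [cbin] and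
    [asc] into differential equations. *)
Lemma PSeries_affine (a : nat -> R) (al be y : R) :
  Rbar_lt (Rabs y) (CV_radius a) ->
  PSeries (fun n => (al + be * INR n) * a n) y = al * PSeries a y + be * (y * PSeries (PS_derive a) y).
Proof.
intros Hy.
rewrite <- PSeries_incr_1, <- !PSeries_scal, <- PSeries_plus.
- apply PSeries_ext; intros [|n]; unfold PS_plus, PS_scal, PS_incr_1, PS_derive, plus, scal, zero; simpl;
    unfold mult; simpl; ring.
- apply (ex_pseries_scal (K := R_AbsRing)); [apply Rmult_comm|apply CV_radius_inside, Hy].
- apply (ex_pseries_scal (K := R_AbsRing)); [apply Rmult_comm|].
  apply (ex_pseries_incr_1 (K := R_AbsRing)), CV_radius_inside; rewrite CV_radius_derive; exact Hy.
Qed.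

Lemma chord_sqr (x : R) : chord x ^ 2 = 2 - 2 * cos x.
Proof. pose proof (gap_chord x); lra. Qed.

Lemma chord_sqr_lt (x : R) : 0 <= x < PI / 2 -> Rabs (chord x ^ 2) < 4.
Proof.
intros Hx; pose proof PI_RGT_0; rewrite chord_sqr.
assert (0 < cos x) by (apply cos_gt_0; lra).
pose proof (COS_bound x); apply Rabs_def1; lra.
Qed.

Lemma cbin_hyp (k : nat) : 0 <= cbin k <= cbin k.
Proof. destruct (cbin_bound k); lra. Qed.

Lemma asc_hyp (k : nat) : 0 <= asc k <= cbin k.
Proof. destruct (asc_bound k); lra. Qed.

Lemma is_derive_chord_sqr (x : R) : is_derive (fun y => chord y ^ 2) x (2 * chord x * cos (x / 2)).
Proof.
eapply is_derive_eq; [apply (is_derive_pow chord 2), is_derive_chord|simpl; ring].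
Qed.

Lemma is_derive_PSeries_chord (a : nat -> R) (x : R) :
  (forall k, 0 <= a k <= cbin k) -> 0 <= x < PI / 2 ->
  is_derive (fun y => PSeries a (chord y ^ 2)) x
    (2 * chord x * cos (x / 2) * PSeries (PS_derive a) (chord x ^ 2)).
Proof.
intros Ha Hx.
apply (is_derive_comp (PSeries a) (fun y => chord y ^ 2)).
- apply is_derive_PSeries, CV_radius_lt, chord_sqr_lt; auto.
- apply is_derive_chord_sqr.
Qed.

Lemma const_on_right (f : R -> R) (b x : R) :
  0 <= x < b -> (forall y, 0 <= y < b -> is_derive f y 0) -> f x = f 0.
Proof.
intros Hx Hf.
destruct (MVT_gen f 0 x (fun _ => 0)) as [c [_ Hc]].
- intros y; rewrite Rmin_left, Rmax_right by lra; intros Hy; apply Hf; lra.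
- intros y; rewrite Rmin_left, Rmax_right by lra; intros Hy.
  apply continuity_pt_filterlim, (is_derive_continuous _ _ 0), Hf; lra.
- lra.
Qed.

(** At y = 4 sin (x / 2) ^ 2 the differential equation has 1 - y / 4 = cos (x / 2) ^ 2, so the
    derivative of the product vanishes, and its value at 0 is 1. *)
Lemma cbin_series (x : R) : 0 <= x < PI / 2 -> cos (x / 2) * PSeries cbin (chord x ^ 2) = 1.
Proof.
intros Hx.
rewrite (const_on_right (fun y => cos (y / 2) * PSeries cbin (chord y ^ 2)) (PI / 2) x Hx).
- rewrite chord_0; replace (0 / 2) with 0 by field; rewrite cos_0.
  replace (0 ^ 2) with 0 by ring; rewrite PSeries_0.
  unfold cbin, Binomial.C; simpl; field.
- intros y Hy.
  eapply is_derive_eq.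
  + apply (is_derive_mult (K := R_AbsRing) (fun y => cos (y / 2)) (fun y => PSeries cbin (chord y ^ 2)));
      [auto_derive; auto; reflexivity|apply is_derive_PSeries_chord; auto using cbin_hyp|apply Rmult_comm].
  + pose proof (CV_radius_lt cbin _ cbin_hyp (chord_sqr_lt y Hy)) as HR.
    pose proof (PSeries_affine cbin (/ 8) (/ 4) _ HR) as E.
    assert (E2 : PSeries (PS_derive cbin) (chord y ^ 2) =
      PSeries (fun n => (/ 8 + / 4 * INR n) * cbin n) (chord y ^ 2)).
    { apply PSeries_ext; intros n; apply cbin_S. }
    rewrite <- E2 in E.
    set (D := PSeries (PS_derive cbin) (chord y ^ 2)) in *.
    set (g := PSeries cbin (chord y ^ 2)) in *.
    pose proof (cos2_half y) as Hc.
    unfold chord in *; unfold plus, mult; simpl.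
    change (y * / 2) with (y / 2).
    set (s := sin (y / 2)) in *; set (c := cos (y / 2)) in *.
    assert (Hk : (1 - s ^ 2) * D = / 8 * g) by lra.
    transitivity (s * (- / 2 * g + 4 * (c ^ 2 * D))); [field|rewrite Hc, Hk; field].
Qed.

(* The arcsine series at [chord x / 2 = sin (x / 2)]. *)
Lemma asc_series (x : R) : 0 <= x < PI / 2 -> chord x * PSeries asc (chord x ^ 2) = x.
Proof.
intros Hx.
enough (E : chord x * PSeries asc (chord x ^ 2) - x = 0) by lra.
rewrite (const_on_right (fun y => chord y * PSeries asc (chord y ^ 2) - y) (PI / 2) x Hx).
- rewrite chord_0; ring.
- intros y Hy.
  eapply is_derive_eq.
  + apply (is_derive_minus (V := R_NormedModule) (fun y => chord y * PSeries asc (chord y ^ 2)) (fun y => y));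
      [apply (is_derive_mult (K := R_AbsRing) chord (fun y => PSeries asc (chord y ^ 2)));
        [apply is_derive_chord|apply is_derive_PSeries_chord; auto using asc_hyp|apply Rmult_comm]
      |apply is_derive_id].
  + pose proof (CV_radius_lt asc _ asc_hyp (chord_sqr_lt y Hy)) as HR.
    pose proof (PSeries_affine asc 1 2 _ HR) as E.
    assert (E2 : PSeries cbin (chord y ^ 2) = PSeries (fun n => (1 + 2 * INR n) * asc n) (chord y ^ 2)).
    { apply PSeries_ext; intros n; apply cbin_asc. }
    rewrite <- E2 in E.
    pose proof (cbin_series y Hy) as H1; rewrite E in H1.
    set (D := PSeries (PS_derive asc) (chord y ^ 2)) in *.
    set (g := PSeries asc (chord y ^ 2)) in *.
    unfold minus, plus, opp, mult, Hierarchy.one; simpl.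
    simpl in H1; lra.
Qed.

Lemma chord_pow_odd (x : R) (k : nat) : chord x ^ (2 * k + 1) = chord x * (chord x ^ 2) ^ k.
Proof. rewrite pow_add, pow_mult, pow_1; ring. Qed.

Lemma asc_series_odd (x : R) : 0 <= x < PI / 2 -> Series (fun k => asc k * chord x ^ (2 * k + 1)) = x.
Proof.
intros Hx; transitivity (chord x * PSeries asc (chord x ^ 2)); [|apply asc_series, Hx].
unfold PSeries; rewrite <- Series_scal_l.
apply Series_ext; intros k; rewrite chord_pow_odd; ring.
Qed.

(** * Domination, and the sum as an integral *)

Lemma asc_le (k : nat) : asc k <= / 4 ^ k.
Proof.
destruct (asc_bound k) as [_ H1]; destruct (cbin_bound k) as [_ H2].
assert (0 < 4 ^ k) by (apply pow_lt; lra).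
apply Rmult_le_reg_r with (4 ^ k); [auto|]; rewrite Rinv_l by lra; nra.
Qed.

(** 37 = 33 + 4: the inner sum has k + 1 terms in [0, 1], the extra term is at most 1, and the
    coefficient at most 4 ^ (- k). *)
Definition majorant (k : nat) : R := 37 * (INR (S k) * (/ 4) ^ k).

Lemma ex_series_majorant : ex_series majorant.
Proof. apply ex_series_Rmult_l, ex_series_S_pow; lra. Qed.

Lemma sum_f_R0_bound (u : nat -> R) (k : nat) :
  (forall j, 0 <= u j <= 1) -> 0 <= sum_f_R0 u k <= INR (S k).
Proof.
intros H; induction k as [|k IH]; simpl sum_f_R0.
- simpl; apply H.
- rewrite (S_INR (S k)); specialize (H (S k)); lra.
Qed.

(** The sequence [u] is left free because the bound is used twice: with the moments for the terms,
    and with odd powers of [chord] for their derivatives. *)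
Lemma target_term_bound (u : nat -> R) (k : nat) :
  (forall j, 0 <= u j <= 1) -> Rabs (asc k * (33 * sum_f_R0 u k + 4 * u k)) <= majorant k.
Proof.
intros H; pose proof (sum_f_R0_bound u k H) as Hs; pose proof (H k) as Hk.
destruct (asc_bound k) as [Ha _]; pose proof (asc_le k) as Ha2; pose proof (INR_S_ge_1 k).
rewrite Rabs_pos_eq by (apply Rmult_le_pos; lra).
unfold majorant; rewrite pow_inv.
replace (37 * (INR (S k) * / 4 ^ k)) with (/ 4 ^ k * (37 * INR (S k))) by ring.
apply Rmult_le_compat; lra.
Qed.

(** Repeated integration by parts: s ^ n [polyint n (ln s)] is a primitive of s ^ (n - 1) (ln s) ^
    4. *)
Definition polyint (n : R) (l : R) : R :=
  l ^ 4 / n - 4 * l ^ 3 / n ^ 2 + 12 * l ^ 2 / n ^ 3 - 24 * l / n ^ 4 + 24 / n ^ 5.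

(* The integral of [s ^ (2 * j) * (ln s) ^ 4 / 24] over [0 < s < chord x]. *)
Definition moment (j : nat) (x : R) : R :=
  / 24 * (chord x ^ (2 * j + 1) * polyint (INR (2 * j + 1)) (lsin x)).

Lemma is_derive_moment (j : nat) (x : R) : 0 < x < 2 * PI ->
  is_derive (moment j) x (lsin x ^ 4 * dlsin x / 24 * chord x ^ (2 * j + 1)).
Proof.
intros Hx; pose proof (sin_half_pos x Hx) as Hs; pose proof (odd_pos j) as Hn.
unfold moment, polyint.
set (n := INR (2 * j + 1)) in *.
assert (Hl : is_derive (fun y => lsin y ^ 4 / n - 4 * lsin y ^ 3 / n ^ 2 + 12 * lsin y ^ 2 / n ^ 3
  - 24 * lsin y / n ^ 4 + 24 / n ^ 5) x
  (dlsin x * (4 * lsin x ^ 3 / n - 12 * lsin x ^ 2 / n ^ 2 + 24 * lsin x / n ^ 3 - 24 / n ^ 4))).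
{ pose proof (is_derive_lsin x Hx) as Hd.
  assert (Hex : ex_derive lsin x) by (eexists; exact Hd).
  auto_derive; [repeat split; auto|].
  replace (Derive (fun x0 => lsin x0) x) with (dlsin x) by (symmetry; apply is_derive_unique, Hd).
  simpl; field; lra. }
assert (Hp : is_derive (fun y => chord y ^ (2 * j + 1)) x (n * dlsin x * chord x ^ (2 * j + 1))).
{ eapply is_derive_eq; [apply (is_derive_pow chord (2 * j + 1)), is_derive_chord|].
  fold n; rewrite Nat.add_1_r; simpl Init.Nat.pred; simpl (chord x ^ S (2 * j)).
  unfold dlsin, chord; field; lra. }
eapply is_derive_eq.
- apply is_derive_scal, (is_derive_mult (K := R_AbsRing) _ _ x _ _ Hp Hl Rmult_comm).
- unfold plus, mult; simpl; field; lra.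
Qed.

Lemma polyint_nonneg (n l : R) : 1 <= n -> l <= 0 -> 0 <= polyint n l.
Proof.
intros Hn Hl; unfold polyint.
replace (l ^ 4 / n - 4 * l ^ 3 / n ^ 2 + 12 * l ^ 2 / n ^ 3 - 24 * l / n ^ 4 + 24 / n ^ 5)
  with ((- l) ^ 4 / n + 4 * (- l) ^ 3 / n ^ 2 + 12 * (- l) ^ 2 / n ^ 3 + 24 * (- l) / n ^ 4 + 24 / n ^ 5)
  by (field; lra).
assert (H : forall a k, 0 <= a -> 0 <= a / n ^ k).
{ intros a k Ha; apply Rdiv_le_0_compat; [exact Ha|apply pow_lt; lra]. }
assert (H1 : 0 <= (- l) ^ 4 / n) by (apply Rdiv_le_0_compat; [apply pow_le|]; lra).
repeat apply Rplus_le_le_0_compat; try apply H; try exact H1; try apply Rmult_le_pos; try apply pow_le; lra.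
Qed.

Lemma moment_end (j : nat) : moment j (PI / 3) = 1 / INR (2 * j + 1) ^ 5.
Proof.
pose proof (odd_pos j); unfold moment, polyint.
rewrite lsin_chord, chord_end, ln_1, pow1; field; lra.
Qed.

Lemma lsin_neg (x : R) : 0 < x <= PI / 3 -> lsin x <= 0.
Proof.
intros Hx; pose proof PI_RGT_0.
assert (chord x <= chord (PI / 3)) by (apply chord_increasing; lra); rewrite chord_end in *.
assert (0 < chord x) by (unfold chord; assert (0 < sin (x / 2)) by (apply sin_half_pos; lra); lra).
rewrite lsin_chord, <- ln_1; apply ln_le; lra.
Qed.

(** The moment increases with x, since its derivative is nonnegative, up to the end value 1 / (2 j +
    1) ^ 5. *)
Lemma moment_bounds (j : nat) (x : R) : 0 < x <= PI / 3 -> 0 <= moment j x <= 1.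
Proof.
intros Hx; pose proof PI_RGT_0; pose proof (odd_pos j) as Hn.
assert (Hpos : forall y, 0 < y <= PI / 3 -> 0 < chord y).
{ intros y Hy; unfold chord; assert (0 < sin (y / 2)) by (apply sin_half_pos; lra); lra. }
split.
- unfold moment; apply Rmult_le_pos; [lra|apply Rmult_le_pos].
  + apply pow_le; left; apply Hpos, Hx.
  + apply polyint_nonneg; [exact Hn|apply lsin_neg, Hx].
- assert (Hm : moment j x <= moment j (PI / 3)).
  { destruct (MVT_gen (moment j) x (PI / 3) (fun y => lsin y ^ 4 * dlsin y / 24 * chord y ^ (2 * j + 1)))
      as [y [Hy1 Hy2]].
    - intros y; rewrite Rmin_left, Rmax_right by lra; intros Hy; apply is_derive_moment; lra.
    - intros y; rewrite Rmin_left, Rmax_right by lra; intros Hy.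
      apply continuity_pt_filterlim; eapply is_derive_continuous, is_derive_moment; lra.
    - rewrite Rmin_left, Rmax_right in Hy1 by lra.
      assert (Hy : 0 < y <= PI / 3) by lra.
      assert (0 <= lsin y ^ 4) by (replace (lsin y ^ 4) with ((lsin y ^ 2) ^ 2) by ring; apply pow2_ge_0).
      assert (0 <= dlsin y).
      { unfold dlsin; apply Rdiv_le_0_compat.
        - apply cos_ge_0; lra.
        - assert (0 < sin (y / 2)) by (apply sin_half_pos; lra); lra. }
      assert (0 <= chord y ^ (2 * j + 1)) by (apply pow_le; left; apply Hpos, Hy).
      assert (0 <= lsin y ^ 4 * dlsin y / 24 * chord y ^ (2 * j + 1)).
      { apply Rmult_le_pos; auto; apply Rdiv_le_0_compat; [apply Rmult_le_pos; auto|lra]. }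
      nra. }
  rewrite moment_end in Hm.
  assert (1 / INR (2 * j + 1) ^ 5 <= 1).
  { unfold Rdiv; rewrite Rmult_1_l, <- Rinv_1; apply Rinv_le_contravar; [lra|apply pow_R1_Rle, Hn]. }
  lra.
Qed.

Lemma chord_lsin_lim (i : nat) : filterlim (fun x => chord x * lsin x ^ i) (at_right 0) (locally 0).
Proof.
pose proof PI_RGT_0.
apply (filterlim_zero_of_le _ (fun x => 1 * (Cmod (lcurve 0 x) ^ i * chord x)));
  [|apply lcurve_pow_chord_lim; lra].
assert (H3 : 0 < PI / 3) by lra.
generalize (at_right_lt 0 _ H3); apply filter_imp; intros x Hx.
pose proof (chord_bounds x Hx).
rewrite Rabs_mult, (Rabs_pos_eq (chord x)), <- RPow_abs by lra.
rewrite Rmult_1_l, Rmult_comm; apply Rmult_le_compat_r; [lra|].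
apply pow_incr; split; [apply Rabs_pos|apply (re_le_Cmod (lcurve 0 x))].
Qed.

Lemma moment_lim_0 (j : nat) : filterlim (moment j) (at_right 0) (locally 0).
Proof.
pose proof (odd_pos j) as Hn.
set (n := INR (2 * j + 1)) in *.
assert (H : filterlim (fun x => / 24 * (chord x ^ (2 * j) *
  (chord x * lsin x ^ 4 * / n + chord x * lsin x ^ 3 * (- 4 / n ^ 2) + chord x * lsin x ^ 2 * (12 / n ^ 3)
   + chord x * lsin x ^ 1 * (- 24 / n ^ 4) + chord x * lsin x ^ 0 * (24 / n ^ 5)))) (at_right 0)
  (locally (/ 24 * (chord 0 ^ (2 * j) * (0 * / n + 0 * (- 4 / n ^ 2) + 0 * (12 / n ^ 3) + 0 * (- 24 / n ^ 4)
   + 0 * (24 / n ^ 5)))))).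
{ apply filterlim_Rmult; [apply filterlim_const|apply filterlim_Rmult].
  - apply (filterlim_at_right_of_continuous (fun x => chord x ^ (2 * j)) 0).
    eapply is_derive_continuous, (is_derive_pow chord (2 * j)), is_derive_chord.
  - repeat apply filterlim_Rplus; apply filterlim_Rmult; try apply filterlim_const; apply chord_lsin_lim. }
rewrite !Rmult_0_l, !Rplus_0_r, !Rmult_0_r in H.
revert H; apply filterlim_ext; intros x; unfold moment, polyint; fold n.
rewrite Nat.add_1_r; change (chord x ^ S (2 * j)) with (chord x * chord x ^ (2 * j)); field; lra.
Qed.

(** The summand of the theorem with each 1 / (2 j + 1) ^ 5 replaced by an integral with upper limit
    [chord x]: it tends to 0 as x does, and is the summand itself at x = PI / 3. *)
Definition target (k : nat) (x : R) : R :=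
  asc k * (33 * sum_f_R0 (fun j => moment j x) k + 4 * moment k x).

Definition dtarget (k : nat) (x : R) : R :=
  lsin x ^ 4 * dlsin x / 24 *
  (asc k * (33 * sum_f_R0 (fun j => chord x ^ (2 * j + 1)) k + 4 * chord x ^ (2 * k + 1))).

Lemma is_derive_sum_f_R0 (f g : nat -> R -> R) (x : R) (k : nat) :
  (forall j, is_derive (f j) x (g j x)) ->
  is_derive (fun y => sum_f_R0 (fun j => f j y) k) x (sum_f_R0 (fun j => g j x) k).
Proof.
intros H; induction k as [|k IH]; simpl; [apply H|].
apply (is_derive_plus (V := R_NormedModule) (fun y => sum_f_R0 (fun j => f j y) k) (f (S k))); auto.
Qed.

Lemma is_derive_target (k : nat) (x : R) : 0 < x < 2 * PI -> is_derive (target k) x (dtarget k x).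
Proof.
intros Hx; unfold target, dtarget.
eapply is_derive_eq.
- apply is_derive_scal, (is_derive_plus (V := R_NormedModule)
    (fun y => 33 * sum_f_R0 (fun j => moment j y) k) (fun y => 4 * moment k y));
    apply is_derive_scal; [|apply is_derive_moment, Hx].
  apply (is_derive_sum_f_R0 moment (fun j x => lsin x ^ 4 * dlsin x / 24 * chord x ^ (2 * j + 1))).
  intros j; apply is_derive_moment, Hx.
- rewrite (sum_eq _ (fun j => chord x ^ (2 * j + 1) * (lsin x ^ 4 * dlsin x / 24)) k)
    by (intros; apply Rmult_comm).
  rewrite <- scal_sum.
  match goal with |- asc k * plus ?u ?v = _ => change (plus u v) with (u + v) end.
  ring.
Qed.

Lemma geometric_odd_sum (t : R) (k : nat) :
  (1 - t ^ 2) * sum_f_R0 (fun j => t ^ (2 * j + 1)) k = t - t ^ 2 * t ^ (2 * k + 1).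
Proof.
induction k as [|k IH]; [simpl; ring|].
rewrite tech5, Rmult_plus_distr_l, IH.
replace (2 * S k + 1)%nat with (2 + (2 * k + 1))%nat by lia; rewrite (pow_add t 2 (2 * k + 1)); ring.
Qed.

Lemma ex_series_asc_pow (t : R) : 0 <= t <= 1 -> ex_series (fun k => asc k * t ^ (2 * k + 1)).
Proof.
intros Ht; apply (ex_series_le_R _ (fun n => (/ 4) ^ n)); [|apply ex_series_geom_R; lra].
intros n; destruct (asc_bound n) as [Ha _]; pose proof (asc_le n) as Hb.
assert (0 <= t ^ (2 * n + 1)) by (apply pow_le; lra).
assert (t ^ (2 * n + 1) <= 1) by (apply Rle_trans with (1 ^ (2 * n + 1)); [apply pow_incr; lra|rewrite pow1; lra]).
rewrite pow_inv, Rabs_pos_eq by nra; nra.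
Qed.

(** The finite geometric sum of odd powers leaves two arcsine series, one at t with sum x and one at
    1 = [chord (PI / 3)] with sum PI / 3. *)
Lemma Series_dtarget (x : R) : 0 < x < PI / 3 ->
  Series (fun k => dtarget k x) =
  lsin x ^ 4 * dlsin x / 24 * (33 * (chord x * (PI / 3 - chord x * x) / (1 - chord x ^ 2)) + 4 * x).
Proof.
intros Hx; pose proof PI_RGT_0; pose proof (chord_bounds x Hx) as Hc.
assert (Hx2 : 0 <= x < PI / 2) by lra.
assert (Hp2 : 0 <= PI / 3 < PI / 2) by lra.
pose proof (asc_series_odd x Hx2) as E1.
pose proof (asc_series_odd (PI / 3) Hp2) as E2; rewrite chord_end in E2.
assert (Hg : 1 - chord x ^ 2 <> 0) by nra.
unfold dtarget; rewrite Series_scal_l; f_equal.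
rewrite (Series_ext _ (fun k => 33 * chord x / (1 - chord x ^ 2) * (asc k * 1 ^ (2 * k + 1))
  + (4 - 33 * chord x ^ 2 / (1 - chord x ^ 2)) * (asc k * chord x ^ (2 * k + 1)))).
- rewrite Series_plus, !Series_scal_l, E1, E2; [field; exact Hg| |];
    apply ex_series_Rmult_l, ex_series_asc_pow; lra.
- intros k; pose proof (geometric_odd_sum (chord x) k) as E.
  replace (sum_f_R0 (fun j => chord x ^ (2 * j + 1)) k)
    with ((chord x - chord x ^ 2 * chord x ^ (2 * k + 1)) / (1 - chord x ^ 2))
    by (rewrite <- E; field; exact Hg).
  rewrite pow1; field; exact Hg.
Qed.

Lemma nint_target :
  nint (fun x => lsin x ^ 4 * dlsin x / 24 *
      (33 * (chord x * (PI / 3 - chord x * x) / (1 - chord x ^ 2)) + 4 * x)) 0 (PI / 3)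
    (Series (fun k => target k (PI / 3))).
Proof.
pose proof PI_RGT_0.
exists (fun x => Series (fun k => target k x)), 0, (Series (fun k => target k (PI / 3))).
assert (Hbound : forall x k, 0 < x <= PI / 3 -> Rabs (target k x) <= majorant k).
{ intros x k Hx; apply (target_term_bound (fun j => moment j x)); intros j; apply moment_bounds, Hx. }
split; [|split; [|split; [|ring]]].
- intros x Hx; rewrite <- Series_dtarget by exact Hx.
  (* L ^ 4 dL is unbounded at 0, so the termwise differentiation is local, on an interval bounded
     away from 0. *)
  set (a := x / 2); set (b := PI / 3).
  assert (Ha : 0 < a) by (unfold a; lra).
  assert (Hsa : 0 < sin (a / 2)) by (apply sin_half_pos; unfold a; lra).
  (* L is negative and increasing and sin (y / 2) is increasing, so both factors of the bound are
     taken at a, with |cos| <= 1. *)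
  set (B := Rabs (lsin a) ^ 4 * / (2 * sin (a / 2)) / 24).
  apply (is_derive_Series (fun y k => target k y) (fun y k => dtarget k y) (fun k => B * majorant k) a b).
  + unfold a, b; lra.
  + apply ex_series_Rmult_l, ex_series_majorant.
  + intros k y Hy; apply is_derive_target; unfold b in Hy; lra.
  + intros k y Hy.
    assert (Hy2 : 0 < y < PI / 3) by (unfold b in Hy; lra).
    pose proof (chord_bounds y Hy2) as Hc.
    unfold dtarget; rewrite Rabs_mult; apply Rmult_le_compat; try apply Rabs_pos.
    * unfold B, Rdiv; rewrite !Rabs_mult, <- RPow_abs, (Rabs_pos_eq (/ 24)) by lra.
      apply Rmult_le_compat_r; [lra|].
      assert (Hsy : sin (a / 2) <= sin (y / 2)) by (apply sin_incr_1; unfold a, b in *; lra).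
      apply Rmult_le_compat; try apply Rabs_pos; [apply pow_le, Rabs_pos| |].
      -- apply pow_incr; split; [apply Rabs_pos|].
         assert (lsin a <= lsin y) by (apply ln_le; lra).
         assert (lsin y <= 0) by (apply lsin_neg; lra).
         rewrite <- (Rabs_Ropp (lsin y)), <- (Rabs_Ropp (lsin a)), !Rabs_pos_eq; lra.
      -- unfold dlsin, Rdiv; rewrite Rabs_mult, (Rabs_pos_eq (/ _)) by (left; apply Rinv_0_lt_compat; lra).
         change (a * / 2) with (a / 2); change (y * / 2) with (y / 2); rewrite <- (Rmult_1_l (/ (2 * sin (a / 2)))).
         apply Rmult_le_compat; [apply Rabs_pos|left; apply Rinv_0_lt_compat; lra
           |pose proof (COS_bound (y / 2)); apply Rabs_le; lra|apply Rinv_le_contravar; lra].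
    * apply (target_term_bound (fun j => chord y ^ (2 * j + 1))); intros j; split; [apply pow_le; lra|].
      apply Rle_trans with (1 ^ (2 * j + 1)); [apply pow_incr; lra|rewrite pow1; lra].
  + intros y Hy; apply (ex_series_le_R _ majorant); [|apply ex_series_majorant].
    intros k; apply Hbound; unfold b in Hy; lra.
- assert (HT : filterlim (fun x => Series (fun k => target k x)) (at_right 0) (locally (Series (fun _ => 0)))).
  { apply (Series_tannery (at_right 0) (fun x k => target k x) majorant (fun _ => 0)); [apply ex_series_majorant| |].
    - assert (H3 : 0 < PI / 3) by lra.
      generalize (at_right_lt 0 _ H3); apply filter_imp; intros x Hx k; apply Hbound; lra.
    - intros k; unfold target; apply filterlim_scal_zero.
      assert (Hs : filterlim (fun x => sum_f_R0 (fun j => moment j x) k) (at_right 0)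
        (locally (sum_f_R0 (fun _ => 0) k))).
      { apply (filterlim_sum_f_R0 (at_right 0) (fun x j => moment j x)); intros j; apply moment_lim_0. }
      rewrite sum_eq_R0 in Hs by auto.
      pose proof (filterlim_Rplus _ _ _ _ (filterlim_scal_zero 33 _ Hs) (filterlim_scal_zero 4 _ (moment_lim_0 k))) as H4.
      rewrite Rplus_0_r in H4; exact H4. }
  assert (E0 : Series (fun _ => 0) = 0).
  { rewrite (Series_ext _ (fun _ => 0 * 0)) by (intros; ring); rewrite Series_scal_l; ring. }
  rewrite E0 in HT; exact HT.
- apply (Series_tannery (at_left (PI / 3)) (fun x k => target k x) majorant (fun k => target k (PI / 3))).
  + apply ex_series_majorant.
  + assert (H3 : 0 < PI / 3) by lra.
    generalize (at_left_gt 0 _ H3); apply filter_imp; intros x Hx k; apply Hbound; lra.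
  + intros k; apply filterlim_at_left_of_continuous; eapply is_derive_continuous, is_derive_target; lra.
Qed.

(* Writing [h = PI / 3 - x], [L = lsin x], the coefficients are those that cancel the
   integrands [dgap * h ^ 5], [L ^ 5], [L ^ 3 * h ^ 2] and [L * h ^ 4]. *)
Lemma target_value :
  Series (fun k => target k (PI / 3)) = 35 / 288 * PI ^ 3 * zeta 3 + 1003 / 96 * PI * zeta 5.
Proof.
pose proof PI_RGT_0.
(* As t (PI / 3 - t x) / (1 - t ^ 2) = (PI / 3) t / (1 + t) + h t ^ 2 / (1 - t ^ 2), the weight 33
   splits into the alternating integral and - 33 / 48 times L ^ 4 h [dgap]. For the latter the ratio
   - 27 of 11 / 960 and - 297 / 960 removes L ^ 2 h ^ 3 [dgap]. The multiples of [nint_im4] and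
   [nint_x_im4] combine into the single factor h = PI / 3 - x. *)
pose proof (nint_plus _ _ _ _ _ _ (nint_scal (33 / 24 * (PI / 3)) _ _ _ _ nint_alternating)
  (nint_plus _ _ _ _ _ _ (nint_scal (11 / 960) _ _ _ _ nint_form_32)
  (nint_plus _ _ _ _ _ _ (nint_scal (- 297 / 960) _ _ _ _ nint_form_half)
  (nint_plus _ _ _ _ _ _ (nint_scal (- 297 / 3840) _ _ _ _ nint_gap_H5)
  (nint_plus _ _ _ _ _ _ (nint_scal (/ 6) _ _ _ _ nint_by_parts_lsin)
  (nint_plus _ _ _ _ _ _ (nint_scal (53 / 160) _ _ _ _ nint_form_w)
  (nint_plus _ _ _ _ _ _ (nint_scal (5 / 32 * (PI / 3)) _ _ _ _ nint_im4)
  (nint_plus _ _ _ _ _ _ (nint_scal (- 5 / 32) _ _ _ _ nint_x_im4)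
  (nint_scal (7 / 32) _ _ _ _ nint_LH4))))))))) as HN.
assert (Hp : 0 < PI / 3) by lra.
refine (eq_trans (nint_unique _ _ _ _ _ Hp nint_target (nint_ext _ _ _ _ _ _ HN)) _).
- intros x Hx; cbv beta.
  pose proof (chord_bounds x Hx) as Hc.
  assert (Hs : 0 < sin (x / 2)) by (apply sin_half_pos; lra).
  assert (Ed : dgap x = - 2 * (dlsin x * chord x ^ 2 / (1 - chord x ^ 2))).
  { unfold dgap; rewrite gap_chord, (sin_half x); unfold dlsin, chord in *; field; split; nra. }
  rewrite Ed; unfold im5, re5, im4.
  set (l := lsin x); set (d := dlsin x); set (t := chord x) in *.
  field; split; nra.
(* The values of order 6 add up to 27 [s6] - 891 / 32 [t6], which is 0 by [s6_t6]. *)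
- rewrite Im_Li_harm_5_PI3, c3_zeta, c5_zeta, s6_t6, Li_5_minus_1; field.
Qed.

Theorem mainTheorem19 :
  is_series
    (fun k : nat =>
       Binomial.C (2 * k) k / (INR (2 * k + 1) * 16 ^ k) *
       (sum_f_R0 (fun j : nat => 33 / INR (2 * j + 1) ^ 5) k
        + 4 / INR (2 * k + 1) ^ 5))
    (35 / 288 * PI ^ 3 * zeta 3 + 1003 / 96 * PI * zeta 5).
Proof.
assert (Hp : 0 < PI / 3 <= PI / 3) by (pose proof PI_RGT_0; lra).
rewrite <- target_value.
apply is_series_ext with (fun k => target k (PI / 3)).
- intros k; unfold target; rewrite moment_end, scal_sum; fold (asc k).
  f_equal; f_equal; [|unfold Rdiv; ring].
  apply sum_eq; intros j _; rewrite moment_end; unfold Rdiv; ring.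
- apply Series_correct, (ex_series_le_R _ majorant); [|apply ex_series_majorant].
  intros k; apply (target_term_bound (fun j => moment j (PI / 3))); intros j; apply moment_bounds, Hp.
Qed.
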